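(* (a) If $X$ is a quasi-operator system (respectively, operator system), then $X^{**}$ is a dual quasi-operator system (respectively, dual operator system). (b) If $T$ is a dualizable quasi-operator system, then $T^*$ is a dualizable dual quasi-operator system.
   Context: Matrices. For a complex vector space $X$ identify $M_n(X)\subseteq M_{n+1}(X)$ (upper left corner) and put $M_\infty(X)=\bigcup_n M_n(X)$. For linear $\varphi:X\to Y$, $\varphi^{(\infty)}([x_{i,j}])=[\varphi(x_{i,j})]$ on $M_\infty(X)$. An operator space is a complex vector space $X$ with a norm on $M_\infty(X)$ (a matrix norm) such that $\|\sum_k a_k^*x_kb_k\|\le\|\sum_k a_k^*a_k\|^{1/2}\|\sum_k b_k^*b_k\|^{1/2}\max_k\|x_k\|$ for all finite families $a_k,b_k\in M_\infty(\mathbb{C})$, $x_k\in M_\infty(X)$. A linear map $\varphi$ between operator spaces is a complete isometry / a complete embedding if $\varphi^{(\infty)}$ is isometric / bounded and bounded below ($\inf_{\|x\|=1}\|\varphi^{(\infty)}(x)\|>0$). SMOS and MOS. A semi-matrix ordered operator space (SMOS) is an operator space $X$ with an involution $*$ such that $[x_{i,j}]\mapsto[x_{j,i}^*]$ is isometric on $M_\infty(X)$, and a norm-closed subset (matrix cone) $M_\infty(X)^+\subseteq M_\infty(X)^{\mathrm{sa}}:=\{x:x^*=x\}$ with $\sum_k a_k^*x_ka_k\in M_\infty(X)^+$ for all finite families $a_k\in M_\infty(\mathbb{C})$, $x_k\in M_\infty(X)^+$. It is a MOS if $M_\infty(X)^+\cap -M_\infty(X)^+=\{0\}$. For SMOSs,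 a $*$-preserving linear map $\varphi:X\to Y$ is completely positive if $\varphi^{(\infty)}(M_\infty(X)^+)\subseteq M_\infty(Y)^+$; completely order monomorphic if it is injective and, for $x\in M_\infty(X)^{\mathrm{sa}}$, $x\in M_\infty(X)^+\Leftrightarrow\varphi^{(\infty)}(x)\in M_\infty(Y)^+$; a MOS isomorphism if it is a bijective completely order monomorphic complete embedding. An operator system is a self-adjoint subspace of some $\mathcal{L}(\mathfrak{H})$ (bounded operators on a Hilbert space) with the induced matrix norm, involution and matrix cone (up to completely isometric MOS isomorphism). A quasi-operator system is a MOS admitting a MOS isomorphism onto an operator system. Duals. For $f=[f_{i,j}]\in M_\infty(X^* )$ let $\theta_f(x)=[f_{i,j}(x)]$ ($x\in X$). The dual space $X^*$ of a SMOS $X$ is always the SMOS with involution $f^*(x)=\overline{f(x^* )}$, i.e. $[f_{i,j}]^*=[(f_{j,i})^*]$, dual matrix norm $\|f\|=\sup\{\|\theta_f^{(\infty)}(x)\|:x\in M_\infty(X),\|x\|\le1\}$ and dual matrix cone $M_\infty(X^* )^+=\{f\in M_\infty(X^* )^{\mathrm{sa}}:\theta_f\text{ is completely positive}\}$; $X^{**}=(X^* )^*$. Dual objects. A SMOS (resp. MOS) $D$ is a dual SMOS (resp. dual MOS) if there is a $*$-invariant norm-closed subspace $D_\#\subseteq D^*$ (a predual) such that the canonical map $D\to(D_\#)^*$ is a surjective complete isometry, and $M_\infty(D)^+$ is closed under the weak-$*$ topology $\sigma(M_\infty(D),M_\infty(D_\#))$ (entrywise $\sigma(D,D_\#)$-convergence).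 For complete $X$, $X^*$ is a dual SMOS with predual $X$ (in particular $X^{**}$ has predual $X^*$). A dual MOS $D$ is a dual quasi-operator system (resp. dual operator system) if there is a weak-$*$-homeomorphic (resp. weak-$*$-homeomorphic completely isometric) MOS isomorphism from $D$ onto a weak-$*$-closed (self-adjoint) subspace of some $\mathcal{L}(\mathfrak{H})$. A quasi-operator system $T$ is dualizable if the dual SMOS $T^*$ (with predual $T$; so $T$ is complete) is a dual quasi-operator system. *)

(* Defs.v *)
From HB Require Import structures.
From mathcomp Require Import all_boot all_order all_algebra sesquilinear complex.
From mathcomp Require Import all_classical all_reals all_analysis.
Set Implicit Arguments.
Unset Strict Implicit.
Unset Printing Implicit Defensive.
Import Order.TTheory GRing.Theory Num.Theory numFieldNormedType.Exports.
Local Open Scope classical_set_scope.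
Local Open Scope ring_scope.

Local Notation normc := ComplexField.Normc.normc.

(** * Finitely supported infinite matrices *)

Definition finsupp_mx {V : zmodType} : {pred nat -> nat -> V} :=
  fun x => `[< exists n, forall i j, ~~ ((i < n) && (j < n))%N -> x i j = 0 >].

Lemma finsupp_mx_submod {K : pzRingType} {V : lmodType K} :
  submod_closed (@finsupp_mx V : {pred nat -> nat -> V}).
Proof.
split; first by apply/asboolP; exists 0%N.
move=> a x y /asboolP[n xn] /asboolP[m ym]; apply/asboolP.
exists (maxn n m) => i j ij; rewrite !fctE xn ?ym ?scaler0 ?addr0//;
  apply: contra ij => /andP[ni nj]; by rewrite !leq_max ni nj ?orbT.
Qed.

HB.instance Definition _ (K : pzRingType) (V : lmodType K) :=
  GRing.isSubmodClosed.Build K (nat -> nat -> V) (@finsupp_mx V)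
    finsupp_mx_submod.

(* M_oo(V): the identification of M_n(V) with the upper left corner of
   M_(n+1)(V) amounts to padding with zeros. *)
Record Minf (V : zmodType) :=
  MkMinf { entry :> nat -> nat -> V; _ : entry \in finsupp_mx }.

HB.instance Definition _ (V : zmodType) := [isSub for @entry V].
HB.instance Definition _ (V : zmodType) := [Choice of Minf V by <:].
HB.instance Definition _ (K : pzRingType) (V : lmodType K) :=
  [SubChoice_isSubLmodule of Minf V by <:].

Section MatrixOperations.
Variable R : realType.
Local Notation C := R[i].
Implicit Types V W : lmodType C.

(* The matrix with entries [x i j]; the default value 0 is only taken when [x]
   is not finitely supported. *)
Definition mxinf V (x : nat -> nat -> V) : Minf V := insubd 0 x.

(* [v] as an element of M_1(V) *)
Definition mx1 V (v : V) : Minf V :=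
  mxinf (fun i j => if (i == 0%N) && (j == 0%N) then v else 0).

(* phi^(oo), for linear [phi] *)
Definition amp V W (phi : V -> W) (x : Minf V) : Minf W :=
  mxinf (fun i j => phi (x i j)).

(* a^* x b *)
Definition sandwich V (a : Minf C^o) (x : Minf V) (b : Minf C^o) : Minf V :=
  mxinf (fun i j => \sum_(k \in [set: nat]) \sum_(l \in [set: nat])
    (((a k i : C)^* * b l j) *: x k l)).

(* a^* a *)
Definition gram (a : Minf C^o) : Minf C^o :=
  mxinf (fun i j => \sum_(k \in [set: nat]) ((a k i : C)^* * a k j : C^o)).

End MatrixOperations.

(** * Matrices of operators acting on finitely supported families of vectors

   [ip] is the inner product of the space [E] on which the entries act. *)

Section OperatorMatrices.
Variables (R : realType) (E : lmodType R[i]) (ip : E -> E -> R[i]).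
Variable I : choiceType.

Definition l2norm (v : I -> E) : R :=
  Num.sqrt (\sum_(i \in [set: I]) complex.Re (ip (v i) (v i))).

Definition opmx_app (A : I -> I -> E -> E) (v : I -> E) : I -> E :=
  fun i => \sum_(j \in [set: I]) A i j (v j).

Definition finsupp_vec : set (I -> E) :=
  [set v | finite_set [set i | v i <> 0]].

Definition opmx_norm (A : I -> I -> E -> E) : R :=
  sup [set l2norm (opmx_app A v) | v in
    [set v | finsupp_vec v /\ l2norm v <= 1]].

Definition opmx_pos (A : I -> I -> E -> E) : Prop :=
  forall v, finsupp_vec v ->
    0 <= \sum_(i \in [set: I]) ip (opmx_app A v i) (v i).

End OperatorMatrices.

(** * Semi-matrix ordered operator spaces *)

(* Only the data of a SMOS: the axioms are [is_smos] and [is_mos], so that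
   [sub_mos], [dual] and [lop] below are defined without proving them. *)
Record mos_data (R : realType) := MosData {
  carrier :> lmodType R[i];
  star : carrier -> carrier;
  mnorm : Minf carrier -> R;
  mcone : set (Minf carrier) }.
Arguments star {R m} _.
Arguments mnorm {R m} _.
Arguments mcone {R m} _.

Section Smos.
Variable R : realType.
Local Notation C := R[i].
Implicit Types X Y : mos_data R.

Definition mstar X (x : Minf X) : Minf X := mxinf (fun i j => star (x j i)).

Definition msa X : set (Minf X) := [set x | mstar x = x].

Definition xnorm X (x : X) : R := mnorm (mx1 x).

Definition scal_ip (z w : C^o) : C := (z : C) * (w : C)^*.

Definition scal_mnorm (a : Minf C^o) : R :=
  opmx_norm scal_ip (fun i j z => (a i j : C) * z : C^o).

(* M_oo(C) as a SMOS: M_oo(M_oo(C)) acts on l^2(nat * nat). *)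
Definition Minf_block (y : Minf (Minf C^o)) :
    nat * nat -> nat * nat -> C^o -> C^o :=
  fun p q z => (y p.1 q.1 p.2 q.2 : C) * z.

Definition MinfC : mos_data R := {|
  carrier := Minf C^o : lmodType C;
  star := fun a : Minf C^o => mxinf (fun i j => ((a j i : C)^* : C^o));
  mnorm := fun y => opmx_norm scal_ip (Minf_block y);
  mcone := [set y | opmx_pos scal_ip (Minf_block y)] |}.

Definition norm_closed (V : zmodType) (N : V -> R) (A : set V) : Prop :=
  forall x, (forall e, 0 < e -> exists2 y, A y & N (x - y) < e) -> A x.

Definition is_operator_space X : Prop :=
  [/\ forall x y : Minf X, mnorm (x + y) <= mnorm x + mnorm y,
      forall (c : C) (x : Minf X), mnorm (c *: x) = normc c * mnorm x,
      forall x : Minf X, mnorm x = 0 -> x = 0 &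
      forall n (a b : 'I_n -> Minf C^o) (x : 'I_n -> Minf X),
        mnorm (\sum_k sandwich (a k) (x k) (b k)) <=
          Num.sqrt (scal_mnorm (\sum_k gram (a k))) *
          Num.sqrt (scal_mnorm (\sum_k gram (b k))) *
          \big[Num.max/0]_k mnorm (x k)].

Definition is_involution X : Prop :=
  [/\ forall x y : X, star (x + y) = star x + star y,
      forall (c : C) (x : X), star (c *: x) = c^* *: star x &
      forall x : X, star (star x) = x].

Definition is_smos X : Prop :=
  [/\ is_operator_space X,
      is_involution X,
      forall x : Minf X, mnorm (mstar x) = mnorm x,
      mcone `<=` @msa X /\ norm_closed mnorm (@mcone R X) &
      forall n (a : 'I_n -> Minf C^o) (x : 'I_n -> Minf X),
        (forall k, mcone (x k)) -> mcone (\sum_k sandwich (a k) (x k) (a k))].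

Definition is_mos X : Prop :=
  is_smos X /\ (forall x : Minf X, mcone x -> mcone (- x) -> x = 0).

(** * Morphisms *)

Definition complete_isometry X Y (phi : X -> Y) : Prop :=
  linear phi /\ forall x, mnorm (amp phi x) = mnorm x.

(* The infimum of [mnorm (amp phi x)] over the unit sphere is positive; it is
   +oo when the sphere is empty. *)
Definition complete_embedding X Y (phi : X -> Y) : Prop :=
  [/\ linear phi,
      exists K, forall x, mnorm (amp phi x) <= K * mnorm x &
      exists2 c, 0 < c & forall x, mnorm x = 1 -> c <= mnorm (amp phi x)].

Definition star_linear X Y (phi : X -> Y) : Prop :=
  linear phi /\ forall x, phi (star x) = star (phi x).

Definition completely_positive X Y (phi : X -> Y) : Prop :=
  star_linear phi /\ forall x, mcone x -> mcone (amp phi x).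

Definition completely_order_mono X Y (phi : X -> Y) : Prop :=
  [/\ star_linear phi, injective phi &
      forall x, msa x -> (mcone x <-> mcone (amp phi x))].

Definition mos_isomorphism X Y (phi : X -> Y) : Prop :=
  [/\ bijective phi, completely_order_mono phi & complete_embedding phi].

End Smos.

(** * Linear subspaces with the induced structure *)

Section Subspaces.
Variable R : realType.
Local Notation C := R[i].

Definition is_subspace (V : lmodType C) (A : set V) : Prop :=
  A 0 /\ forall (c : C) x y, A x -> A y -> A (c *: x + y).

Definition lin_span (V : lmodType C) (A : set V) : {pred V} :=
  fun x => `[< forall B, is_subspace B -> A `<=` B -> B x >].

Lemma lin_span_submod (V : lmodType C) (A : set V) :
  submod_closed (lin_span A).
Proof.
split; first by apply/asboolP => B [].
move=> a x y /asboolP Ax /asboolP Ay; apply/asboolP => B sB AB.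
by apply: sB.2; [exact: Ax|exact: Ay].
Qed.

HB.instance Definition _ (V : lmodType C) (A : set V) :=
  GRing.isSubmodClosed.Build C V (lin_span A) (lin_span_submod A).

(* Taking the span of [A] provides a vector space for every set [A]; below this
   is only applied to subspaces, which are equal to their span. *)
Record subsp (V : lmodType C) (A : set V) :=
  MkSubsp { subsp_val : V; _ : subsp_val \in lin_span A }.

HB.instance Definition _ (V : lmodType C) (A : set V) :=
  [isSub for @subsp_val V A].
HB.instance Definition _ (V : lmodType C) (A : set V) :=
  [Choice of subsp A by <:].
HB.instance Definition _ (V : lmodType C) (A : set V) :=
  [SubChoice_isSubLmodule of subsp A by <:].

Definition star_invariant (X : mos_data R) (A : set X) : Prop :=
  forall x, A x -> A (star x).

(* [star] is the restricted involution if [A] is a *-invariant subspace. *)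
Definition sub_mos (X : mos_data R) (A : set X) : mos_data R := {|
  carrier := subsp A : lmodType C;
  star := fun y : subsp A => insubd 0 (star (val y));
  mnorm := fun y : Minf (subsp A) => mnorm (amp val y);
  mcone := [set y : Minf (subsp A) | mcone (amp val y)] |}.

End Subspaces.

(** * Dual spaces *)

Section Duals.
Variable R : realType.
Local Notation C := R[i].
Implicit Types X : mos_data R.

Definition is_functional X : {pred X -> C^o} :=
  fun f => `[< linear f /\ exists K, forall x, normc (f x) <= K * xnorm x >].

Lemma is_functional_submod X : submod_closed (@is_functional X).
Proof.
split.
  apply/asboolP; split=> [a x y|].
    by rewrite -[LHS]/(0 : C^o) -[RHS]/(a *: 0 + 0 : C^o) scaler0 addr0.
  exists 0 => x; rewrite -[X in normc X]/(0 : C).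
  by rewrite mul0r ComplexField.Normc.normc0.
move=> a f g /asboolP[lf [K fK]] /asboolP[lg [L gL]]; apply/asboolP; split.
  move=> b x y; rewrite !fctE lf lg !scalerDr addrACA.
  by rewrite !scalerA [a * b]mulrC.
exists (normc a * K + L) => x; rewrite !fctE.
apply: le_trans (le_normcD _ _) _; rewrite mulrDl lerD//.
rewrite ComplexField.Normc.normcM -mulrA ler_wpM2l//.
by case: a => ? ?; exact: sqrtr_ge0.
Qed.

HB.instance Definition _ X :=
  GRing.isSubmodClosed.Build C (X -> C^o) (@is_functional X)
    (@is_functional_submod X).

Record functional X :=
  MkFunctional { fapp :> X -> C^o; _ : fapp \in @is_functional X }.

HB.instance Definition _ X := [isSub for @fapp X].
HB.instance Definition _ X := [Choice of functional X by <:].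
HB.instance Definition _ X := [SubChoice_isSubLmodule of functional X by <:].

Definition theta X (f : Minf (functional X)) (x : X) : MinfC R :=
  mxinf (fun i j => f i j x).

(* If [X] is a SMOS, the default value 0 of [insubd] is never taken in
   [dual_star], nor in [bidual_map] and [predual_map] below. *)
Definition dual_star X (f : functional X) : functional X :=
  insubd 0 (fun x => ((f (star x) : C)^* : C^o)).

Definition dual X : mos_data R := {|
  carrier := functional X : lmodType C;
  star := @dual_star X;
  mnorm := fun f : Minf (functional X) =>
    sup [set mnorm (amp (theta f) x) | x in [set x : Minf X | mnorm x <= 1]];
  mcone := [set f : Minf (functional X) |
    mxinf (fun i j => dual_star (f j i)) = f /\
    completely_positive (theta f)] |}.

(* X -> X^** *)
Definition bidual_map X (x : X) : dual (dual X) :=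
  insubd 0 (fun f : dual X => (f : functional X) x).

(* D -> (A)^* for a subspace A of D^* *)
Definition predual_map (D : mos_data R) (A : set (dual D)) (d : D) :
    dual (sub_mos A) :=
  insubd 0 (fun f : sub_mos A => (val (f : subsp A) : functional D) d).

End Duals.

(** * Weak topologies *)

(* The coarsest topology on [T] making all the functions in [F] continuous *)
Definition weak_top (R : realType) (T : choiceType) (F : set (T -> R[i]^o)) :
    topologicalType :=
  @initial_topology T (prod_topology (fun _ : set_type F => R[i]^o))
    (fun t f => set_val f t).


(** * Operators on Hilbert spaces *)

(* [inner] is linear in its first argument and conjugate linear in the second
   one. *)
Record hilbert (R : realType) := Hilbert {
  hspace :> completeNormedModType R[i];
  inner : {dot hspace for Num.conj};
  _ : forall u : hspace, inner u u = `|u| ^+ 2 }.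

Section Operators.
Variable R : realType.
Local Notation C := R[i].
Variable H : hilbert R.

Definition is_bounded_op : {pred H -> H} :=
  fun T => `[< linear T /\ exists K : R, forall u, `|T u| <= K%:C%C * `|u| >].

Lemma is_bounded_op_submod : submod_closed is_bounded_op.
Proof.
split.
  apply/asboolP; split=> [a x y|].
    by rewrite -[LHS]/(0 : H) -[RHS]/(a *: 0 + 0 : H) scaler0 addr0.
  by exists 0 => x; rewrite -[X in `|X|]/(0 : H) normr0 mul0r.
move=> a f g /asboolP[lf [K fK]] /asboolP[lg [L gL]]; apply/asboolP; split.
  move=> b x y; rewrite !fctE lf lg !scalerDr addrACA.
  by rewrite !scalerA [a * b]mulrC.
exists (normc a * K + L) => x; rewrite !fctE.
apply: le_trans (ler_normD _ _) _; rewrite rmorphD mulrDl lerD//.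
by rewrite normrZ rmorphM -mulrA ler_wpM2l.
Qed.

HB.instance Definition _ :=
  GRing.isSubmodClosed.Build C (H -> H) is_bounded_op is_bounded_op_submod.

Record bounded_op :=
  MkBoundedOp { op_fun :> H -> H; _ : op_fun \in is_bounded_op }.

HB.instance Definition _ := [isSub for op_fun].
HB.instance Definition _ := [Choice of bounded_op by <:].
HB.instance Definition _ := [SubChoice_isSubLmodule of bounded_op by <:].

Definition adjoint (T : bounded_op) : bounded_op :=
  xget (0 : bounded_op)
    [set S : bounded_op | forall u v, inner H (T u) v = inner H u (S v)].

Definition lop : mos_data R := {|
  carrier := bounded_op : lmodType C;
  star := adjoint;
  mnorm := fun x : Minf bounded_op => opmx_norm (inner H) (fun i j => x i j);
  mcone := [set x : Minf bounded_op |
    opmx_pos (inner H) (fun i j => x i j)] |}.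

Definition square_summable (u : nat -> H) : Prop :=
  cvgn (series (fun k => complex.Re (inner H (u k) (u k)))).

(* The weak-* topology of L(H), as the dual of the trace class operators, is
   the sigma-weak topology, given by these functionals. *)
Definition sigma_weak_functionals : set (bounded_op -> C^o) :=
  [set w | exists u v, [/\ square_summable u, square_summable v &
    forall T : bounded_op,
      w T = limn (series (fun k => inner H (T (u k)) (v k) : C^o))]].

Definition sigma_weak : topologicalType := weak_top sigma_weak_functionals.

(* the topology induced on a subspace of L(H) *)
Definition sigma_weak_sub (B : set bounded_op) : topologicalType :=
  @weak_top R (subsp B) [set w \o val | w in sigma_weak_functionals].

End Operators.

(** * Operator systems *)

Section OperatorSystems.
Variable R : realType.
Implicit Types X D T : mos_data R.

Definition selfadjoint_subspace (H : hilbert R) (B : set (lop H)) : Prop :=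
  is_subspace B /\ star_invariant B.

Definition operator_system X : Prop :=
  is_mos X /\
  exists (H : hilbert R) (B : set (lop H)) (phi : X -> sub_mos B),
    [/\ selfadjoint_subspace B, mos_isomorphism phi & complete_isometry phi].

Definition quasi_operator_system X : Prop :=
  is_mos X /\
  exists (Y : mos_data R) (phi : X -> Y),
    operator_system Y /\ mos_isomorphism phi.

(** * Dual objects *)

(* sigma(D, A) and sigma(M_oo(D), M_oo(A)) *)
Definition wstar D (A : set (dual D)) : topologicalType :=
  @weak_top R D ((@fapp R D) @` A).

Definition wstar_mx D (A : set (dual D)) : topologicalType :=
  @weak_top R (Minf D)
    [set w | exists (f : dual D) i j,
      A f /\ w = fun x : Minf D => (f : functional D) (x i j)].

Definition is_predual D (A : set (dual D)) : Prop :=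
  [/\ is_subspace A, star_invariant A & norm_closed (@xnorm R (dual D)) A] /\
  [/\ set_surj setT setT (@predual_map R D A),
      complete_isometry (@predual_map R D A) &
      closed (mcone : set (wstar_mx A))].

Definition dual_mos D (A : set (dual D)) : Prop := is_mos D /\ is_predual A.

Definition homeomorphism (S T : topologicalType) (f : S -> T) : Prop :=
  continuous f /\ exists2 g : T -> S, cancel f g /\ cancel g f & continuous g.

Definition dual_quasi_operator_system D (A : set (dual D)) : Prop :=
  dual_mos A /\
  exists (H : hilbert R) (B : set (lop H)) (phi : D -> sub_mos B),
    [/\ selfadjoint_subspace B, closed (B : set (sigma_weak H)),
        mos_isomorphism phi &
        homeomorphism (phi : wstar A -> sigma_weak_sub B)].

Definition dual_operator_system D (A : set (dual D)) : Prop :=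
  dual_mos A /\
  exists (H : hilbert R) (B : set (lop H)) (phi : D -> sub_mos B),
    [/\ selfadjoint_subspace B, closed (B : set (sigma_weak H)),
        mos_isomorphism phi, complete_isometry phi &
        homeomorphism (phi : wstar A -> sigma_weak_sub B)].

(* X, identified with its image in X^**, as a predual of X^*; its norm
   closedness amounts to the completeness of X. *)
Definition canonical_predual X : set (dual (dual X)) := range (@bidual_map R X).

Definition dualizable T : Prop :=
  quasi_operator_system T /\
  @dual_quasi_operator_system (dual T) (@canonical_predual T).

End OperatorSystems.

Arguments dual_quasi_operator_system {R} D A.
Arguments dual_operator_system {R} D A.
Arguments canonical_predual {R} X.
Arguments dualizable {R} T.

(* Main.v *)
(** Let X be represented in L(H0) by a *-linear completely positive map which is
    bounded and bounded below on matrices, and put Y = X^* and D = X^**.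

    Extending a linear form from Paulsen's operator system of 2x2 block matrices
    (with scalar diagonal blocks) by the Hahn-Banach theorem shows that every
    matrix f over Y with |f| <= 1 is a corner f = k a^* g b of a positive matrix g
    over Y with |g| <= 1, where |a|^2, |b|^2 <= 1 + e; the constant k only
    depends on the representation, and k = 1 if it is completely isometric.

    Consequently the direct sum of the maps F |-> [F(g_kl)], over all positive g
    with |g| <= 1, is a *-linear map from D into L(l^2). It preserves and reflects
    positivity, by the definition of the dual cone, and it is bounded below by
    1/k. Every f in Y is a vector functional of this representation; conversely
    the matrix entries of the representation are elements of Y, and each
    sigma-weak functional is a norm limit of combinations of them. Hence
    the representation is a weak-* homeomorphism onto its range, and an operator
    T in the closure of the range comes from the functional f |-> <T u_f, v_f>.

    If T^* is a dual quasi-operator system, its involution makes the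
    corresponding weak-* closed subspace of L(H) an operator system, so that T^*
    is a quasi-operator system, and the bidual of T is covered by the first part.
*)

Require Import Defs.
From HB Require Import structures.
From mathcomp Require Import all_boot all_order all_algebra sesquilinear spectral complex ring lra.
From mathcomp Require Import all_classical all_reals all_analysis.
Set Implicit Arguments.
Unset Strict Implicit.
Unset Printing Implicit Defensive.
Import Order.TTheory GRing.Theory Num.Theory numFieldNormedType.Exports.
Local Open Scope classical_set_scope.
Local Open Scope ring_scope.

Local Notation normc := ComplexField.Normc.normc.
Local Notation Re := complex.Re.
Local Notation Im := complex.Im.

(** The representation tests a functional on positive matrices only, whereas the norm of X^** is a
    supremum over the whole unit ball of X^*; the corner decomposition closes this gap, and its
    constant is the loss in the norm. Dual norms and cones are handled through the numbers
    [pair f (sandwich w x v)], the coefficients of theta_f(x) at vectors v, w of l^2(nat * nat),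
    written as finite matrices with the Hilbert-Schmidt norm; the same two descriptions (best
    constant, positive coefficients) serve for X^* and X^**. They also dictate the form extended
    from Paulsen's system: f(A^* k B) is bounded by |k| |A| |B| in Hilbert-Schmidt norms of A and B,
    whose squares are the traces of A^* A and B^* B, so f is completed by the trace on the diagonal
    blocks. The extension has a density matrix T with identity diagonal blocks, and dividing by a
    square root of T yields g; since T may be singular it is replaced by T + e, whence the factor 1
    + e. The constant k is c K, where |x| <= c |rho(x)| and |rho(x)| <= K |x| on matrices. *)

Section ComplexNumbers.
Variable R : realType.
Local Notation C := R[i].
Implicit Types z w : C.

Lemma normC_normc z : `|z| = (normc z)%:C%C.
Proof. by case: z. Qed.

Lemma normc_ge0 z : 0 <= normc z.
Proof. by case: z => a b; exact: sqrtr_ge0. Qed.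

Lemma normc_conj z : normc z^* = normc z.
Proof. by apply: complexI; rewrite -!normC_normc norm_conjC. Qed.

Lemma sqr_normc_mulc z : z * z^* = ((normc z) ^+ 2)%:C%C.
Proof. by rewrite -normCK normC_normc rmorphXn. Qed.

Lemma Re_le_normc z : Re z <= normc z.
Proof.
case: z => a b /=; apply: le_trans (ler_norm _) _.
by rewrite -sqrtr_sqr ler_wsqrtr// lerDl sqr_ge0.
Qed.

Lemma normc_real (r : R) : normc (r%:C)%C = `|r|.
Proof. by rewrite /= expr0n addr0 sqrtr_sqr. Qed.

Lemma cRe_conj z : Re z^* = Re z. Proof. by case: z. Qed.

Lemma cReD z w : Re (z + w) = Re z + Re w.
Proof. by case: z w => [a b] [c d]. Qed.

Lemma cReN z : Re (- z) = - Re z. Proof. by case: z. Qed.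

Lemma cReB z w : Re (z - w) = Re z - Re w.
Proof. by rewrite cReD cReN. Qed.

Lemma cRe_realM (r : R) z : Re (r%:C%C * z) = r * Re z.
Proof. by case: z => a b /=; rewrite mul0r subr0. Qed.

Lemma cRe_sum (I : Type) (s : seq I) (P : pred I) (F : I -> C) :
  Re (\sum_(i <- s | P i) F i) = \sum_(i <- s | P i) Re (F i).
Proof. by elim/big_rec2 : _ => // i y x _ <-; rewrite cReD. Qed.

Lemma normc_sum (I : Type) (s : seq I) (P : pred I) (F : I -> C) :
  normc (\sum_(i <- s | P i) F i) <= \sum_(i <- s | P i) normc (F i).
Proof.
elim/big_rec2 : _ => [|i x y _ h].
  by rewrite -[X in normc X]/(0 : C) ComplexField.Normc.normc0.
by apply: le_trans (le_normcD _ _) _; rewrite lerD2l.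
Qed.

Lemma ge0_complexE z : 0 <= z -> z = (Re z)%:C%C.
Proof. by case: z => a b; rewrite lecE /= => /andP[/eqP -> _]. Qed.

Lemma ge0_Re z : 0 <= z -> 0 <= Re z.
Proof. by case: z => a b; rewrite lecE /= => /andP[_]. Qed.

Lemma exists_phase z : exists2 u, normc u = 1 & u * z = (normc z)%:C%C.
Proof.
have [->|z0] := eqVneq z 0.
  exists 1; rewrite ?ComplexField.Normc.normc1// mulr0.
  by rewrite ComplexField.Normc.normc0.
have nz0 : (normc z)%:C%C != 0 by rewrite -normC_normc normr_eq0.
exists ((normc z)%:C%C / z); last by rewrite divfK.
rewrite ComplexField.Normc.normcM ComplexField.Normc.normcV.
rewrite normc_real ger0_norm ?normc_ge0// divff//.
by apply: contra_neq nz0 => ->.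
Qed.

(* The discriminant of a positive quadratic form; [s] and [t] stand for the
   scalings of the two arguments of a sesquilinear form. *)
Lemma normc_le_sqrt z (a b : R) : 0 <= a -> 0 <= b ->
  (forall s t : C,
    Re (s * t^* * z) <= (normc s ^+ 2 * a + normc t ^+ 2 * b) / 2) ->
  normc z <= Num.sqrt a * Num.sqrt b.
Proof.
move=> a0 b0 h.
have {}h (s t : R) : s * t * normc z <= (s ^+ 2 * a + t ^+ 2 * b) / 2.
  have [u u1 uz] := exists_phase z.
  have := h (s%:C%C * u) t%:C%C.
  rewrite !ComplexField.Normc.normcM u1 mulr1 !normc_real !real_normK ?num_real//.
  apply: le_trans.
  have -> : (s%:C%C * u * (t%:C%C)^* * z) = (s * t)%:C%C * (u * z).
    have -> : (t%:C%C)^* = t%:C%C :> C by rewrite conj_Creal// complex_real.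
    by rewrite rmorphM /=; ring.
  by rewrite uz -rmorphM.
set n := normc z in h *; have n0 : 0 <= n by exact: normc_ge0.
rewrite -sqrtrM// -[leLHS]ger0_norm// -sqrtr_sqr ler_wsqrtr//.
(* For [a = 0] the scalings [b + 1] and [n] force [n ^+ 2 * (b / 2 + 1) <= 0]; for [a > 0] the
   scalings [n] and [a] give [a * n ^+ 2 <= a ^+ 2 * b]. *)
have [a_eq0|a_neq0] := eqVneq a 0.
  have := h (b + 1) n; rewrite a_eq0 mulr0 add0r mul0r => {}h.
  have : n ^+ 2 * (b / 2 + 1) <= 0 by lra.
  by rewrite pmulr_lle0; lra.
have agt0 : 0 < a by rewrite lt_def a_neq0.
have := h n a => {}h.
have : a * n ^+ 2 <= a * (a * b) by nra.
by rewrite ler_pM2l.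
Qed.

End ComplexNumbers.

(** * Semi-inner products and operator matrices *)

Section InnerProducts.
Variable R : realType.
Local Notation C := R[i].

Definition semi_inner (E : lmodType C) (ip : E -> E -> C) : Prop :=
  [/\ forall a u v w, ip (a *: u + v) w = a * ip u w + ip v w,
      forall u v, ip u v = (ip v u)^* & forall u, 0 <= ip u u].

Definition sqn (E : lmodType C) (ip : E -> E -> C) u : R := Re (ip u u).

Section Theory.
Variables (E : lmodType C) (ip : E -> E -> C).
Hypothesis ipP : semi_inner ip.
Implicit Types u v w : E.

Lemma ipDl u v w : ip (u + v) w = ip u w + ip v w.
Proof. by have [l _ _] := ipP; rewrite -[u]scale1r l mul1r scale1r. Qed.

Lemma ip0l w : ip 0 w = 0.
Proof. by apply: (addrI (ip 0 w)); rewrite -ipDl !addr0. Qed.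

Lemma ipZl a u w : ip (a *: u) w = a * ip u w.
Proof. by have [l _ _] := ipP; rewrite -[a *: u]addr0 l ip0l addr0. Qed.

Lemma ipC u v : ip u v = (ip v u)^*.
Proof. by have [_ s _] := ipP. Qed.

Lemma ipDr u v w : ip w (u + v) = ip w u + ip w v.
Proof. by rewrite ipC ipDl rmorphD /= -!ipC. Qed.

Lemma ip0r w : ip w 0 = 0.
Proof. by rewrite ipC ip0l conjC0. Qed.

Lemma ipZr a u w : ip w (a *: u) = a^* * ip w u.
Proof. by rewrite ipC ipZl rmorphM /= -ipC. Qed.

Lemma ipNl u w : ip (- u) w = - ip u w.
Proof. by rewrite -scaleN1r ipZl mulN1r. Qed.

Lemma ipNr u w : ip w (- u) = - ip w u.
Proof. by rewrite ipC ipNl rmorphN /= -ipC. Qed.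

Lemma ip_suml (I : Type) (s : seq I) (P : pred I) (F : I -> E) w :
  ip (\sum_(i <- s | P i) F i) w = \sum_(i <- s | P i) ip (F i) w.
Proof. by apply: (big_morph (ip^~ w)) => [u v|]; rewrite ?ipDl ?ip0l. Qed.

Lemma ip_sumr (I : Type) (s : seq I) (P : pred I) (F : I -> E) w :
  ip w (\sum_(i <- s | P i) F i) = \sum_(i <- s | P i) ip w (F i).
Proof. by apply: (big_morph (ip w)) => [u v|]; rewrite ?ipDr ?ip0r. Qed.

Lemma sqn_ge0 u : 0 <= sqn ip u.
Proof. by have [_ _ p] := ipP; exact: ge0_Re. Qed.

Lemma ip_sqn u : ip u u = (sqn ip u)%:C%C.
Proof. by have [_ _ p] := ipP; exact: ge0_complexE. Qed.

Lemma sqnZ a u : sqn ip (a *: u) = normc a ^+ 2 * sqn ip u.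
Proof.
by rewrite /sqn ipZl ipZr mulrA sqr_normc_mulc cRe_realM.
Qed.

Lemma Re_ip_le u v : Re (ip u v) <= (sqn ip u + sqn ip v) / 2.
Proof.
have := sqn_ge0 (u - v); rewrite /sqn ipDl !ipDr !ipNl !ipNr opprK.
rewrite !cReD !cReN (ipC v u) cRe_conj; lra.
Qed.

Lemma cauchy_schwarz u v :
  normc (ip u v) <= Num.sqrt (sqn ip u) * Num.sqrt (sqn ip v).
Proof.
apply: normc_le_sqrt => [||s t]; try exact: sqn_ge0.
by rewrite -!sqnZ -mulrA -ipZr -ipZl Re_ip_le.
Qed.

End Theory.

Lemma semi_inner_scal : semi_inner (@scal_ip R).
Proof.
split=> [a u v w|u v|u]; rewrite /scal_ip.
- by rewrite mulrDl mulrA.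
- by rewrite rmorphM /= conjCK mulrC.
- exact: mul_conjC_ge0.
Qed.

Lemma sqn_scal (z : C) : sqn (@scal_ip R) z = normc z ^+ 2.
Proof. by rewrite /sqn /scal_ip sqr_normc_mulc. Qed.

Lemma semi_inner_hilbert (H : hilbert R) : semi_inner (inner H).
Proof.
split=> [a u v w|u v|u].
- by rewrite linearPl.
- by rewrite (hermC (inner H)) /= expr0 mul1r.
- case: H u => H ip ipE u /=; rewrite ipE; exact: exprn_ge0.
Qed.

Lemma semi_inner_sum (E : lmodType C) (ip : E -> E -> C) (I : Type)
  (s : seq I) : semi_inner ip ->
  semi_inner (fun v w : I -> E => \sum_(p <- s) ip (v p) (w p)).
Proof.
move=> ipP; split=> [a u v w|u v|u].
- rewrite mulr_sumr -big_split /=; apply: eq_bigr => i _.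
  by rewrite !fctE ipDl// ipZl.
- by rewrite rmorph_sum /=; apply: eq_bigr => i _; exact: ipC.
- by apply: sumr_ge0 => i _; have [_ _] := ipP; apply.
Qed.

Definition fam_sqn (E : lmodType C) (ip : E -> E -> C) (I : Type) (s : seq I)
    (v : I -> E) : R :=
  \sum_(p <- s) sqn ip (v p).

Lemma sqn_fam (E : lmodType C) (ip : E -> E -> C) (I : Type) (s : seq I) v :
  sqn (fun v w : I -> E => \sum_(p <- s) ip (v p) (w p)) v = fam_sqn ip s v.
Proof. by rewrite /sqn cRe_sum. Qed.

Lemma cauchy_schwarz_sum (E : lmodType C) (ip : E -> E -> C) (I : Type)
    (s : seq I) (v w : I -> E) : semi_inner ip ->
  normc (\sum_(p <- s) ip (v p) (w p)) <=
  Num.sqrt (fam_sqn ip s v) * Num.sqrt (fam_sqn ip s w).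
Proof.
by move=> ipP; have := cauchy_schwarz (semi_inner_sum s ipP) v w; rewrite !sqn_fam.
Qed.

End InnerProducts.

(** * Norm and positivity of finite operator matrices through their sesquilinear forms *)

Section OperatorMatrixNorm.
Variable R : realType.
Local Notation C := R[i].
Variables (E : lmodType C) (ip : E -> E -> C) (I : choiceType).
Hypothesis ipP : semi_inner ip.
Implicit Types (v w : I -> E) (A : I -> I -> E -> E) (s : seq I).

(** [A] is a bare family of functions, so the linearity of its entries has to be recorded along with
    the finite support; the sums over all indices then become sums over [s]. *)
Definition opmx_supp s A : Prop :=
  [/\ uniq s, forall p q u, (p \notin s) || (q \notin s) -> A p q u = 0,
      forall p q a u, A p q (a *: u) = a *: A p q u &
      forall p q (x y : E), A p q (x + y) = A p q x + A p q y].

Definition opmx_form s A v w : C :=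
  \sum_(p <- s) \sum_(q <- s) ip (A p q (v q)) (w p).

Lemma fsbig_seq_supp (V : nmodType) s (F : I -> V) : uniq s ->
  (forall p, p \notin s -> F p = 0) ->
  \sum_(p \in [set: I]) F p = \sum_(p <- s) F p.
Proof.
move=> us F0; rewrite (fsbig_seq _ _ us); apply/esym/fsbig_widen => // p /= [_ ps].
by apply: F0; apply/negP.
Qed.

Lemma finsupp_vec_seq s v : (forall p, p \notin s -> v p = 0) -> finsupp_vec v.
Proof.
move=> v0; apply: (@sub_finite_set _ _ [set` s]); last exact: finite_seq.
by move=> p /= vp; apply/negPn/negP => /v0.
Qed.

Lemma l2norm_supp s v : uniq s -> (forall p, p \notin s -> v p = 0) ->
  l2norm ip v = Num.sqrt (fam_sqn ip s v).
Proof.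
move=> us v0; rewrite /l2norm (fsbig_seq_supp us)// => p /v0 ->.
by rewrite ip0l.
Qed.

Lemma fam_sqn_ge0 s v : 0 <= fam_sqn ip s v.
Proof. by apply: sumr_ge0 => i _; exact: sqn_ge0. Qed.

Lemma fam_sqn_le s v : uniq s -> finsupp_vec v ->
  Num.sqrt (fam_sqn ip s v) <= l2norm ip v.
Proof.
move=> us fv; rewrite /l2norm ler_wsqrtr//.
have [r ur sr] : exists2 r, uniq r & (forall p, p \notin r -> v p = 0).
  have /finite_seqP[r rE] := fv; exists (undup r); first exact: undup_uniq.
  move=> p; rewrite mem_undup => /negP pr; apply: contrapT => vp; apply: pr.
  by have : [set` r] p by rewrite -rE.
rewrite (@fsbig_seq_supp _ (undup (s ++ r))) ?undup_uniq//; last first.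
  move=> p; rewrite mem_undup mem_cat negb_or => /andP[_ /sr ->].
  by rewrite ip0l.
have -> : fam_sqn ip s v = \sum_(p <- undup (s ++ r) | p \in s) Re (ip (v p) (v p)).
  rewrite /fam_sqn -[RHS]big_filter; apply: perm_big; apply: uniq_perm => //.
    by rewrite filter_uniq// undup_uniq.
  move=> p; rewrite mem_filter mem_undup mem_cat.
  by case: (p \in s).
rewrite [leRHS](bigID (fun p => p \in s)) /= lerDl.
by apply: sumr_ge0 => i _; exact: sqn_ge0.
Qed.

Section Bounds.
Variables (s : seq I) (A : I -> I -> E -> E).
Hypothesis sA : opmx_supp s A.

Let A0 p q : A p q 0 = 0.
Proof. by have [_ _ AZ _] := sA; rewrite -[0 in LHS](scale0r 0) AZ scale0r. Qed.

Lemma opmx_appE v p : opmx_app A v p = \sum_(q <- s) A p q (v q).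
Proof.
have [us As _ _] := sA; apply: fsbig_seq_supp => // q qs.
by rewrite As// qs orbT.
Qed.

Lemma opmx_app_supp v p : p \notin s -> opmx_app A v p = 0.
Proof.
have [us As _ _] := sA => ps.
by rewrite opmx_appE big1// => q _; rewrite As// ps.
Qed.

Lemma opmx_formE v w :
  opmx_form s A v w = \sum_(p <- s) ip (opmx_app A v p) (w p).
Proof. by apply: eq_bigr => p _; rewrite opmx_appE ip_suml. Qed.

(** Testing the form on [w = A v] turns its bound into |A v|^2 <= t |A v| for |v| <= 1. *)
Lemma opmx_norm_ubound t : 0 <= t ->
  (forall v w, normc (opmx_form s A v w) <=
     t * (Num.sqrt (fam_sqn ip s v) * Num.sqrt (fam_sqn ip s w))) ->
  ubound [set l2norm ip (opmx_app A v) | v in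
    [set v | finsupp_vec v /\ l2norm ip v <= 1]] t.
Proof.
have [us As _ _] := sA => t0 h _ [v [fv v1] <-].
rewrite (l2norm_supp us) => [|p ps]; last exact: opmx_app_supp.
set w := opmx_app A v; set n := Num.sqrt _.
have nn : n * n <= t * n.
  rewrite -expr2 sqr_sqrtr ?fam_sqn_ge0//.
  have -> : fam_sqn ip s w = Re (opmx_form s A v w).
    by rewrite opmx_formE cRe_sum.
  apply: le_trans (Re_le_normc _) _; apply: le_trans (h _ _) _.
  rewrite ler_wpM2l// ler_piMl ?sqrtr_ge0//.
  by apply: le_trans v1; exact: fam_sqn_le.
have [n0|n0] := eqVneq n 0; first by rewrite n0.
by rewrite -(@ler_pM2r _ n)// lt_def n0 sqrtr_ge0.
Qed.

Lemma opmx_norm_le t : 0 <= t ->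
  (forall v w, normc (opmx_form s A v w) <=
     t * (Num.sqrt (fam_sqn ip s v) * Num.sqrt (fam_sqn ip s w))) ->
  opmx_norm ip A <= t.
Proof.
move=> t0 h; apply: ge_sup; last exact: opmx_norm_ubound.
exists (l2norm ip (opmx_app A 0)); exists 0 => //; split.
  by apply: (@finsupp_vec_seq [::]).
by rewrite (@l2norm_supp [::])// /fam_sqn big_nil sqrtr0.
Qed.

Lemma opmx_appZ a v : opmx_app A (a *: v) = a *: opmx_app A v.
Proof.
have [us As AZ _] := sA; apply/funext => p; rewrite !fctE !opmx_appE scaler_sumr.
by apply: eq_bigr => q _; rewrite AZ.
Qed.

Lemma fam_sqnZ a v : fam_sqn ip s (a *: v) = normc a ^+ 2 * fam_sqn ip s v.
Proof.
by rewrite /fam_sqn mulr_sumr; apply: eq_bigr => p _; rewrite fctE sqnZ.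
Qed.

(** An a priori bound [t] makes the supremum in [opmx_norm] a genuine one; normalizing [v] then
    replaces [t] by the sharp constant. *)
Lemma opmx_norm_form t : 0 <= t ->
  (forall v w, normc (opmx_form s A v w) <=
     t * (Num.sqrt (fam_sqn ip s v) * Num.sqrt (fam_sqn ip s w))) ->
  forall v w, normc (opmx_form s A v w) <= opmx_norm ip A *
     (Num.sqrt (fam_sqn ip s v) * Num.sqrt (fam_sqn ip s w)).
Proof.
have [us As AZ _] := sA => t0 h v w.
have ub := opmx_norm_ubound t0 h.
rewrite opmx_formE; apply: le_trans (cauchy_schwarz_sum _ _ _ ipP) _.
rewrite mulrA ler_wpM2r ?sqrtr_ge0//.
(* The supremum only runs over finitely supported vectors, while [v] is arbitrary; cutting [v] down
   to [s] changes neither [A v] nor the seminorm on [s]. *)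
pose v' : I -> E := fun p => if p \in s then v p else 0.
have vv' : opmx_app A v = opmx_app A v'.
  apply/funext => p; rewrite !opmx_appE !big_seq; apply: eq_bigr => q qs.
  by rewrite /v' qs.
have -> : fam_sqn ip s v = fam_sqn ip s v'.
  rewrite /fam_sqn !big_seq; apply: eq_bigr => q qs.
  by rewrite /v' qs.
have v'0 a p : p \notin s -> (a *: v') p = 0.
  by move=> ps; rewrite fctE /v' (negbTE ps) scaler0.
rewrite vv'; set n := Num.sqrt (fam_sqn ip s v').
(* A vector of seminorm 0 cannot be normalized; here the a priori bound [h] shows that [A v'] has
   seminorm 0 as well. *)
have [n0|n0] := eqVneq n 0.
  rewrite n0 mulr0 le_eqVlt; apply/orP; left; apply/eqP.
  have := h v' (opmx_app A v'); rewrite -/n n0 mul0r mulr0 => h0.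
  have : Re (opmx_form s A v' (opmx_app A v')) <= 0.
    by apply: le_trans h0; exact: Re_le_normc.
  rewrite opmx_formE cRe_sum -[X in X <= 0]/(fam_sqn ip s (opmx_app A v')).
  by move=> ?; apply/eqP; rewrite sqrtr_eq0.
have ngt0 : 0 < n by rewrite lt_def n0 sqrtr_ge0.
rewrite -ler_pdivrMr//.
have -> : Num.sqrt (fam_sqn ip s (opmx_app A v')) / n =
    l2norm ip (opmx_app A ((n^-1)%:C%C *: v')).
  rewrite (l2norm_supp us) => [|p ps]; last exact: opmx_app_supp.
  rewrite opmx_appZ fam_sqnZ normc_real sqrtrM ?sqr_ge0// sqrtr_sqr normr_id.
  by rewrite ger0_norm ?invr_ge0 ?sqrtr_ge0// mulrC.
apply: ub_le_sup; first by exists t.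
exists ((n^-1)%:C%C *: v') => //; split.
  by apply: (@finsupp_vec_seq s) => p; exact: v'0.
rewrite (l2norm_supp us); last exact: v'0.
rewrite fam_sqnZ normc_real sqrtrM ?sqr_ge0// sqrtr_sqr normr_id.
by rewrite ger0_norm ?invr_ge0 ?sqrtr_ge0// mulVf.
Qed.

Lemma opmx_norm_ge0 t : 0 <= t ->
  (forall v w, normc (opmx_form s A v w) <=
     t * (Num.sqrt (fam_sqn ip s v) * Num.sqrt (fam_sqn ip s w))) ->
  0 <= opmx_norm ip A.
Proof.
move=> t0 h; apply: (@le_trans _ _ (l2norm ip (opmx_app A 0))).
  by rewrite /l2norm sqrtr_ge0.
apply: ub_le_sup; first by exists t; exact: opmx_norm_ubound.
exists 0 => //; split; first by apply: (@finsupp_vec_seq [::]).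
by rewrite (@l2norm_supp [::])// /fam_sqn big_nil sqrtr0.
Qed.

Lemma opmx_posP :
  opmx_pos ip A <-> forall v, 0 <= opmx_form s A v v.
Proof.
have [us As AZ _] := sA.
have E0 v : \sum_(i \in [set: I]) ip (opmx_app A v i) (v i) = opmx_form s A v v.
  rewrite (fsbig_seq_supp us) ?opmx_formE// => p ps.
  by rewrite opmx_app_supp// ip0l.
split=> [h v|h v _]; last by rewrite E0.
pose v' : I -> E := fun p => if p \in s then v p else 0.
have -> : opmx_form s A v v = opmx_form s A v' v'.
  rewrite /opmx_form !big_seq; apply: eq_bigr => p ps.
  rewrite !big_seq; apply: eq_bigr => q qs.
  by rewrite /v' ps qs.
rewrite -E0; apply: h; apply: (@finsupp_vec_seq s) => p ps.
by rewrite /v' (negbTE ps).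
Qed.

End Bounds.

End OperatorMatrixNorm.

(** Provides the a priori bound required above: the sum of the bounds of the finitely many
    entries. *)
Lemma opmx_bounded (R : realType) (E : lmodType R[i]) (ip : E -> E -> R[i])
    (I : choiceType) (ipP : semi_inner ip) (s : seq I) (A : I -> I -> E -> E) :
  (forall p q, exists2 M, 0 <= M & forall u w, normc (ip (A p q u) w) <=
     M * (Num.sqrt (sqn ip u) * Num.sqrt (sqn ip w))) ->
  exists2 t, 0 <= t & forall v w, normc (opmx_form ip s A v w) <=
     t * (Num.sqrt (fam_sqn ip s v) * Num.sqrt (fam_sqn ip s w)).
Proof.
move=> h; pose M p q := sval (cid2 (h p q)).
have M0 p q : 0 <= M p q by rewrite /M; case: cid2.
have MP p q u w : normc (ip (A p q u) w) <=
     M p q * (Num.sqrt (sqn ip u) * Num.sqrt (sqn ip w)).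
  by rewrite /M; case: cid2.
exists (\sum_(p <- s) \sum_(q <- s) M p q).
  by apply: sumr_ge0 => p _; apply: sumr_ge0.
move=> v w; have le v' p : p \in s ->
    Num.sqrt (sqn ip (v' p)) <= Num.sqrt (fam_sqn ip s v').
  move=> ps; rewrite ler_wsqrtr// /fam_sqn (big_rem p)//= lerDl.
  by apply: sumr_ge0 => i _; exact: sqn_ge0.
rewrite mulr_suml; apply: le_trans (normc_sum _ _ _) _.
rewrite !big_seq; apply: ler_sum => p ps.
rewrite mulr_suml; apply: le_trans (normc_sum _ _ _) _.
rewrite !big_seq; apply: ler_sum => q qs.
apply: le_trans (MP _ _ _ _) _; rewrite ler_wpM2l//.
by apply: ler_pM; rewrite ?sqrtr_ge0 ?le.
Qed.

(** * Finitely supported matrices and their pairing *)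

Section FiniteMatrices.
Variable R : realType.
Local Notation C := R[i].

Definition mbnd (V : zmodType) (n : nat) (x : nat -> nat -> V) : Prop :=
  forall i j, ~~ ((i < n) && (j < n))%N -> x i j = 0.

(** Some bound for the support, not the least one; only [mdimP] is known about it. *)
Definition mdim (V : zmodType) (x : Minf V) : nat := xget 0%N [set n | mbnd n x].

Lemma mdimP (V : zmodType) (x : Minf V) : mbnd (mdim x) x.
Proof.
apply: (@xgetPex _ 0%N [set n | mbnd n x]).
by case: x => x /= /asboolP.
Qed.

Global Arguments mdimP {V} x [i j] _.

Lemma mbnd_le (V : zmodType) n m (x : nat -> nat -> V) :
  (n <= m)%N -> mbnd n x -> mbnd m x.
Proof.
move=> nm nx i j ij; apply: nx; apply: contra ij => /andP[ni nj].
by rewrite !(leq_trans _ nm).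
Qed.

Lemma mbnd_row (V : zmodType) n (x : nat -> nat -> V) i j :
  mbnd n x -> (n <= i)%N -> x i j = 0.
Proof. by move=> nx ni; apply: nx; rewrite ltnNge ni. Qed.

Lemma mbnd_col (V : zmodType) n (x : nat -> nat -> V) i j :
  mbnd n x -> (n <= j)%N -> x i j = 0.
Proof. by move=> nx ni; apply: nx; rewrite andbC ltnNge ni. Qed.

Lemma Minf_eq (V : zmodType) (x y : Minf V) :
  (forall i j, x i j = y i j) -> x = y.
Proof.
by move=> xy; apply: val_inj; apply/funext => i; apply/funext => j; exact: xy.
Qed.

Lemma mxinfE (V : lmodType C) n (x : nat -> nat -> V) :
  mbnd n x -> forall i j, mxinf x i j = x i j.
Proof.
move=> nx i j; rewrite /mxinf -[LHS]/(val (insubd 0 x : Minf V) i j) insubdK//.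
by apply/asboolP; exists n.
Qed.

Lemma mxD (V : lmodType C) (x y : Minf V) i j : (x + y) i j = x i j + y i j.
Proof. by []. Qed.

Lemma mxN (V : lmodType C) (x : Minf V) i j : (- x) i j = - x i j.
Proof. by []. Qed.

Lemma mxB (V : lmodType C) (x y : Minf V) i j : (x - y) i j = x i j - y i j.
Proof. by []. Qed.

Lemma mxZ (V : lmodType C) c (x : Minf V) i j : (c *: x) i j = c *: x i j.
Proof. by []. Qed.

Lemma mx_sum (V : lmodType C) (I : Type) (s : seq I) (P : pred I)
    (F : I -> Minf V) i j :
  (\sum_(k <- s | P k) F k) i j = \sum_(k <- s | P k) F k i j.
Proof. by elim/big_rec2 : _ => // k y x _ <-. Qed.

Lemma ampE (V W : lmodType C) (phi : V -> W) (x : Minf V) i j :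
  phi 0 = 0 -> amp phi x i j = phi (x i j).
Proof. by move=> p0; apply: (@mxinfE _ (mdim x)) => k l /mdimP ->. Qed.

Lemma mx1E (V : lmodType C) (v : V) i j :
  mx1 v i j = if (i == 0%N) && (j == 0%N) then v else 0.
Proof.
apply: (@mxinfE _ 1); move=> k l; rewrite !ltnS !leqn0.
by case: eqP => //= _; case: eqP.
Qed.

Lemma mbnd_mx1 (V : lmodType C) (v : V) : mbnd 1 (mx1 v).
Proof. by move=> k l; rewrite mx1E !ltnS !leqn0 => /negbTE ->. Qed.

Lemma sum_nat_supp (V : nmodType) n (F : nat -> V) :
  (forall p, (n <= p)%N -> F p = 0) ->
  \sum_(p \in [set: nat]) F p = \sum_(p < n) F p.
Proof.
move=> F0; rewrite (@fsbig_seq_supp _ _ (iota 0 n)) ?iota_uniq//.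
  by rewrite -{1}[n]subn0 -/(index_iota 0 n) big_mkord.
by move=> p; rewrite mem_iota add0n /= -leqNgt; exact: F0.
Qed.

Lemma sum_ord_widen (V : nmodType) n m (F : nat -> V) : (n <= m)%N ->
  (forall p, (n <= p)%N -> F p = 0) -> \sum_(p < m) F p = \sum_(p < n) F p.
Proof.
move=> nm F0; rewrite (big_ord_widen _ F nm) [RHS]big_mkcond /=.
by apply: eq_bigr => i _; case: ltnP => // /F0.
Qed.

Lemma sum_ord2_widen (V : nmodType) n m (F : nat -> nat -> V) : (n <= m)%N ->
  (forall p q, ~~ ((p < n) && (q < n))%N -> F p q = 0) ->
  \sum_(p < m) \sum_(q < m) F p q = \sum_(p < n) \sum_(q < n) F p q.
Proof.
move=> nm F0.
rewrite (@sum_ord_widen _ n m (fun p => \sum_(q < m) F p q) nm) => [|p np]; last first.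
  by rewrite big1// => q _; rewrite F0// ltnNge np.
apply: eq_bigr => p _; apply: (@sum_ord_widen _ n m (F p)) => // q nq.
by rewrite F0// andbC ltnNge nq.
Qed.

Lemma sandwichE (V : lmodType C) n (a : Minf C^o) (x : Minf V) (b : Minf C^o)
    i j : mbnd n x ->
  sandwich a x b i j =
  \sum_(k < n) \sum_(l < n) (((a k i : C)^* * b l j) *: x k l).
Proof.
move=> nx.
have E k l : \sum_(p \in [set: nat]) \sum_(q \in [set: nat])
    (((a p k : C)^* * b q l) *: x p q) =
    \sum_(p < n) \sum_(q < n) (((a p k : C)^* * b q l) *: x p q).
  rewrite (@sum_nat_supp _ n) => [|p np]; last first.
    by apply: fsbig1 => q _; rewrite (mbnd_row _ nx)// scaler0.
  apply: eq_bigr => p _; apply: sum_nat_supp => q nq.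
  by rewrite (mbnd_col _ nx)// scaler0.
rewrite /sandwich (@mxinfE _ (maxn (mdim a) (mdim b))) ?E// => k l.
rewrite negb_and -!leqNgt !geq_max => kl; rewrite E.
apply: big1 => p _; apply: big1 => q _.
case/orP: kl => /andP[ak bl].
  by rewrite (mbnd_col _ (mdimP a))// conjC0 mul0r scale0r.
by rewrite (mbnd_col _ (mdimP b))// mulr0 scale0r.
Qed.

Lemma mbnd_sandwich (V : lmodType C) n (a : Minf C^o) (x : Minf V)
  (b : Minf C^o) : mbnd n a -> mbnd n b -> mbnd n (sandwich a x b).
Proof.
move=> na nb i j ij; rewrite (sandwichE _ _ _ _ (mdimP x)).
apply: big1 => p _; apply: big1 => q _.
move: ij; rewrite negb_and -!leqNgt => /orP[ni|nj].
  by rewrite (mbnd_col _ na)// conjC0 mul0r scale0r.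
by rewrite (mbnd_col _ nb)// mulr0 scale0r.
Qed.

Lemma sandwichZ (V : lmodType C) a c (x : Minf V) b :
  sandwich a (c *: x) b = c *: sandwich a x b.
Proof.
have nx : mbnd (mdim x) (c *: x) by move=> i j ij; rewrite mxZ mdimP ?scaler0.
apply: Minf_eq => i j.
rewrite mxZ (sandwichE _ _ _ _ nx) (sandwichE _ _ _ _ (mdimP x)) scaler_sumr.
apply: eq_bigr => k _; rewrite scaler_sumr; apply: eq_bigr => l _.
by rewrite mxZ !scalerA mulrC.
Qed.

Definition mmul (a v : Minf C^o) : Minf C^o :=
  mxinf (fun i j => \sum_(k < mdim v) a i k * v k j).

Lemma mmulE n (a v : Minf C^o) i j : mbnd n v \/ mbnd n a ->
  mmul a v i j = \sum_(k < n) a i k * v k j.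
Proof.
move=> nv; rewrite /mmul (@mxinfE _ (maxn (mdim a) (mdim v))) => [|p q].
  have [le_nv|le_vn] := leqP n (mdim v).
    apply: (@sum_ord_widen _ _ _ (fun k => (a i k : C) * v k j)) => // p np.
    case: nv => [nv|na]; first by rewrite (mbnd_row _ nv)// mulr0.
    by rewrite (mbnd_col _ na)// mul0r.
  apply/esym.
  apply: (@sum_ord_widen _ _ _ (fun k => (a i k : C) * v k j)) => [|p vp].
    exact: ltnW.
  by rewrite (mbnd_row _ (mdimP v))// mulr0.
rewrite negb_and -!leqNgt !geq_max => /orP[]/andP[ap vq].
  by apply: big1 => k _; rewrite (mbnd_row _ (mdimP a))// mul0r.
by apply: big1 => k _; rewrite (mbnd_col _ (mdimP v))// mulr0.
Qed.

Lemma mbnd_mmul n (a v : Minf C^o) : mbnd n a -> mbnd n v -> mbnd n (mmul a v).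
Proof.
move=> na nv i j; rewrite (@mmulE n) ?negb_and -?leqNgt; last by left.
move=> /orP[ni|nj]; apply: big1 => k _.
  by rewrite (mbnd_row _ na)// mul0r.
by rewrite (mbnd_col _ nv)// mulr0.
Qed.

Lemma sandwich_mmul (V : lmodType C) (a b w v : Minf C^o) (x : Minf V) :
  sandwich a (sandwich w x v) b = sandwich (mmul w a) x (mmul v b).
Proof.
pose n := maxn (mdim w) (mdim v).
have nw : mbnd n w by apply: mbnd_le (mdimP w); rewrite leq_maxl.
have nv : mbnd n v by apply: mbnd_le (mdimP v); rewrite leq_maxr.
have nwxv : mbnd n (sandwich w x v) by exact: mbnd_sandwich.
pose m := mdim x; have mx : mbnd m x by exact: mdimP.
apply: Minf_eq => i j.
rewrite (sandwichE _ _ _ _ nwxv) (sandwichE _ _ _ _ mx).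
under eq_bigr => p _.
  under eq_bigr => q _.
    rewrite (sandwichE _ _ _ _ mx) scaler_sumr.
    under eq_bigr => k _ do rewrite scaler_sumr.
    over.
  rewrite exchange_big /=.
  under eq_bigr => k _ do rewrite exchange_big /=.
  over.
rewrite exchange_big /=; apply: eq_bigr => k _.
rewrite exchange_big /=; apply: eq_bigr => l _.
rewrite !(@mmulE n); try by right.
rewrite rmorph_sum /= mulr_suml scaler_suml; apply: eq_bigr => p _.
rewrite mulr_sumr scaler_suml; apply: eq_bigr => q _.
rewrite scalerA rmorphM /=; congr (_ *: _); ring.
Qed.

Definition mtr (a : Minf C^o) : Minf C^o := mxinf (fun i j => a j i).

Lemma mtrE a i j : mtr a i j = a j i.
Proof.
apply: (@mxinfE _ (mdim a)) => k l; rewrite andbC; exact: mdimP.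
Qed.

Lemma mbnd_mtr n (a : Minf C^o) : mbnd n a -> mbnd n (mtr a).
Proof. by move=> na i j ij; rewrite mtrE na// andbC. Qed.

(** The squared Hilbert-Schmidt norm: finite scalar matrices play the role of vectors of l^2(nat *
    nat), the space on which M_oo(M_oo(C)) acts in [MinfC]. *)
Definition hs2 (v : Minf C^o) : R :=
  \sum_(i < mdim v) \sum_(j < mdim v) normc (v i j) ^+ 2.

Lemma hs2E n (v : Minf C^o) : mbnd n v ->
  hs2 v = \sum_(i < n) \sum_(j < n) normc (v i j) ^+ 2.
Proof.
have z0 : normc (0 : C) ^+ 2 = 0 by rewrite ComplexField.Normc.normc0 expr0n.
move=> nv; have [le_nv|le_vn] := leqP n (mdim v).
  by apply: (sum_ord2_widen le_nv (F := fun i j => normc (v i j) ^+ 2)) => i j /nv ->.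
apply/esym.
apply: (sum_ord2_widen (ltnW le_vn) (F := fun i j => normc (v i j) ^+ 2)) => i j.
by move=> /mdimP ->.
Qed.

Lemma hs2_ge0 v : 0 <= hs2 v.
Proof. by apply: sumr_ge0 => i _; apply: sumr_ge0 => j _; exact: sqr_ge0. Qed.

Definition hs v : R := Num.sqrt (hs2 v).

Lemma hs_ge0 v : 0 <= hs v.
Proof. exact: sqrtr_ge0. Qed.

Lemma sqr_hs v : hs v ^+ 2 = hs2 v.
Proof. by rewrite sqr_sqrtr// hs2_ge0. Qed.

Lemma mbnd_common (V W : zmodType) (x : Minf V) (y : Minf W) :
  exists n, mbnd n x /\ mbnd n y.
Proof.
exists (maxn (mdim x) (mdim y)); split.
  by apply: mbnd_le (mdimP x); rewrite leq_maxl.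
by apply: mbnd_le (mdimP y); rewrite leq_maxr.
Qed.

Lemma mbnd_common3 (V W U : zmodType) (x : Minf V) (y : Minf W) (z : Minf U) :
  exists n, [/\ mbnd n x, mbnd n y & mbnd n z].
Proof.
have [n [nx ny]] := mbnd_common x y; exists (maxn n (mdim z)).
split; [apply: mbnd_le nx|apply: mbnd_le ny|apply: mbnd_le (mdimP z)];
  by rewrite ?leq_maxl ?leq_maxr.
Qed.

End FiniteMatrices.

(** * The pairing of matrices over X^* with matrices over X *)

Section Pairing.
Variable R : realType.
Local Notation C := R[i].
Implicit Types X : mos_data R.

Lemma fappD X (f g : functional X) x : (f + g) x = (f x : C) + g x.
Proof. by []. Qed.

Lemma fappZ X c (f : functional X) x : (c *: f) x = c * (f x : C).
Proof. by []. Qed.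

Lemma fappN X (f : functional X) x : (- f) x = - (f x : C).
Proof. by []. Qed.

Lemma fapp_sum X (I : Type) (s : seq I) (P : pred I) (F : I -> functional X) x :
  (\sum_(i <- s | P i) F i) x = \sum_(i <- s | P i) (F i x : C).
Proof. by elim/big_rec2 : _ => // k y z _ <-. Qed.

Lemma functional_linear X (f : functional X) : linear f.
Proof. by case: f => f /= /asboolP[]. Qed.

Lemma functional_bound X (f : functional X) :
  exists K, forall x, normc (f x) <= K * xnorm x.
Proof. by case: f => f /= /asboolP[]. Qed.

Lemma fapplD X (f : functional X) x y : f (x + y) = (f x : C) + f y.
Proof. by rewrite -{1}[x]scale1r functional_linear scale1r. Qed.

Lemma fapp0 X (f : functional X) : f 0 = 0.
Proof. by apply: (addrI (f 0)); rewrite -[LHS]fapplD !addr0. Qed.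

Lemma fapplZ X (f : functional X) c x : f (c *: x) = c * (f x : C).
Proof. by rewrite -[c *: x]addr0 functional_linear fapp0 addr0. Qed.

Lemma fappl_sum X (f : functional X) (I : Type) (s : seq I) (P : pred I)
  (F : I -> X) :
  f (\sum_(i <- s | P i) F i) = \sum_(i <- s | P i) (f (F i) : C).
Proof. by apply: (big_morph f) => [x y|]; [exact: fapplD|exact: fapp0]. Qed.

Lemma functional_eq X (f g : functional X) : (forall x, f x = g x) -> f = g.
Proof. by move=> fg; apply: val_inj; apply/funext. Qed.

(** The dual norm and the dual cone are both read off from this bilinear pairing, by
    [theta_form]. *)
Definition pair X (f : Minf (functional X)) (y : Minf X) : C :=
  \sum_(k < mdim f) \sum_(l < mdim f) (f k l (y k l) : C).

Lemma pairE n X (f : Minf (functional X)) (y : Minf X) :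
  mbnd n f \/ mbnd n y ->
  pair f y = \sum_(k < n) \sum_(l < n) (f k l (y k l) : C).
Proof.
move=> nfy; rewrite /pair.
have [le_nf|le_fn] := leqP n (mdim f).
  apply: (@sum_ord2_widen _ _ _ (fun k l => f k l (y k l) : C)) => // p q pq.
  case: nfy => [nf|ny]; first by rewrite nf.
  by rewrite ny// fapp0.
apply/esym.
apply: (@sum_ord2_widen _ _ _ (fun k l => f k l (y k l) : C)) => [|p q pq].
  exact: ltnW.
by rewrite mdimP.
Qed.

Lemma pairZr X (f : Minf (functional X)) c y : pair f (c *: y) = c * pair f y.
Proof.
rewrite /pair mulr_sumr; apply: eq_bigr => k _; rewrite mulr_sumr.
by apply: eq_bigr => l _; rewrite mxZ fapplZ.
Qed.

Lemma pairDl X (f g : Minf (functional X)) y : pair (f + g) y = pair f y + pair g y.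
Proof.
have [n [nf ng]] := mbnd_common f g.
have nfg : mbnd n (f + g) by move=> i j ij; rewrite mxD nf// ng// addr0.
rewrite !(@pairE n); try by left.
rewrite -big_split; apply: eq_bigr => k _; rewrite -big_split.
by apply: eq_bigr => l _; rewrite mxD fappD.
Qed.

Lemma pairZl X c (f : Minf (functional X)) y : pair (c *: f) y = c * pair f y.
Proof.
have nf : mbnd (mdim f) (c *: f) by move=> i j ij; rewrite mxZ mdimP// scaler0.
rewrite (pairE (or_introl nf)) mulr_sumr; apply: eq_bigr => k _; rewrite mulr_sumr.
by apply: eq_bigr => l _; rewrite mxZ fappZ.
Qed.

Lemma pair0l X (y : Minf X) : pair 0 y = 0.
Proof. by rewrite -(scale0r 0) pairZl mul0r. Qed.

Lemma pairNl X (f : Minf (functional X)) y : pair (- f) y = - pair f y.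
Proof. by rewrite -scaleN1r pairZl mulN1r. Qed.

Lemma pair_suml X (I : Type) (s : seq I) (P : pred I)
    (F : I -> Minf (functional X)) y :
  pair (\sum_(i <- s | P i) F i) y = \sum_(i <- s | P i) pair (F i) y.
Proof.
by apply: (big_morph (@pair X ^~ y)) => [f g|]; [exact: pairDl|exact: pair0l].
Qed.

(** The transposes carry no conjugation because [pair] is bilinear and matches equal indices: the
    coefficient [(a p k)^* * b q l] stays the same, only the summation over (k, l) is carried over
    to [y]. *)
Lemma pair_sandwich X (a b : Minf C^o) (f : Minf (functional X)) (y : Minf X) :
  pair (sandwich a f b) y = pair f (sandwich (mtr a) y (mtr b)).
Proof.
have [n [na nb nf]] := mbnd_common3 a b f.
have nafb := mbnd_sandwich f na nb.
rewrite (pairE (or_introl nf)) (pairE (or_introl nafb)).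
have [m [ny nm]] : exists m, mbnd m y /\ (n <= m)%N.
  exists (maxn n (mdim y)); split; last by rewrite leq_maxl.
  by apply: mbnd_le (mdimP y); rewrite leq_maxr.
transitivity (\sum_(k < m) \sum_(l < m) \sum_(p < n) \sum_(q < n)
    (((a p k : C)^* * b q l) * (f p q (y k l) : C))).
  rewrite -(@sum_ord2_widen _ _ _ (fun k l => sandwich a f b k l (y k l) : C) nm).
    apply: eq_bigr => k _; apply: eq_bigr => l _.
    rewrite (sandwichE _ _ _ _ nf) fapp_sum; apply: eq_bigr => p _.
    by rewrite fapp_sum; apply: eq_bigr => q _; rewrite fappZ.
  by move=> p q /nafb ->.
under eq_bigr => k _.
  rewrite exchange_big /=; under eq_bigr => p _ do rewrite exchange_big /=; over.
rewrite exchange_big /=; apply: eq_bigr => p _.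
rewrite exchange_big /=; apply: eq_bigr => q _.
rewrite (sandwichE _ _ _ _ ny) fappl_sum; apply: eq_bigr => k _.
rewrite fappl_sum; apply: eq_bigr => l _.
by rewrite fapplZ !mtrE.
Qed.

Lemma pair_mx1 X (f : functional X) (y : Minf X) : pair (mx1 f) y = f (y 0%N 0%N).
Proof.
have -> : pair (mx1 f) y = \sum_(k < 1) \sum_(l < 1) (mx1 f k l (y k l) : C).
  by apply: pairE; left; exact: mbnd_mx1.
by rewrite !big_ord1 mx1E.
Qed.

Definition unitmxinf (p q : nat) : Minf (C^o) :=
  mxinf (fun i j => if (i == p) && (j == q) then 1 else 0).

Lemma unitmxinfE p q i j : unitmxinf p q i j = if (i == p) && (j == q) then 1 else 0.
Proof.
apply: (@mxinfE _ _ (maxn p q).+1) => k l; rewrite !ltnS.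
case: eqP => [->|//]; case: eqP => [->|//]; by rewrite leq_maxl leq_maxr.
Qed.

(** Compression by matrix units moves an entry to the corner, so that bounds for matrix norms become
    bounds for single entries. *)
Lemma sandwich_unit (V : lmodType C) (x : Minf V) p q :
  sandwich (unitmxinf p 0) x (unitmxinf q 0) = mx1 (x p q).
Proof.
apply: Minf_eq => i j; rewrite mx1E.
pose n := maxn (mdim x) (maxn p q).+1.
have nx : mbnd n x by apply: mbnd_le (mdimP x); rewrite leq_maxl.
have pn : (p < n)%N by rewrite leq_max !ltnS leq_maxl orbT.
have qn : (q < n)%N by rewrite leq_max !ltnS leq_maxr orbT.
rewrite (sandwichE _ _ _ _ nx).
rewrite (bigD1 (Ordinal pn))//= (bigD1 (Ordinal qn))//= !unitmxinfE !eqxx /=.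
rewrite [X in _ + X]big1 => [|k kp]; last first.
  apply: big1 => l _; rewrite !unitmxinfE -[_ == p]/(k == Ordinal pn) (negbTE kp).
  by rewrite conjC0 mul0r scale0r.
rewrite [X in _ + X + _]big1 => [|k kp]; last first.
  rewrite !unitmxinfE -[_ == q]/(k == Ordinal qn) (negbTE kp).
  by rewrite mulr0 scale0r.
rewrite !addr0; case: eqP => _ /=; last by rewrite conjC0 mul0r scale0r.
by case: eqP => _ /=; rewrite ?mulr0 ?scale0r// conjC1 mulr1 scale1r.
Qed.

End Pairing.

(** * The operator norm of scalar matrices and Hilbert-Schmidt estimates *)

Section ScalarNorm.
Variable R : realType.
Local Notation C := R[i].
Implicit Types a b v w : Minf (C^o).

Lemma opmx_supp_scal (I : choiceType) (s : seq I) (a : I -> I -> C) :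
  uniq s -> (forall p q, (p \notin s) || (q \notin s) -> a p q = 0) ->
  opmx_supp s (fun p q (z : C^o) => a p q * (z : C) : C^o).
Proof.
move=> us a0; split=> // [p q z /a0 ->|p q c z|p q y z].
- by rewrite mul0r.
- by rewrite /GRing.scale /=; ring.
- by rewrite mulrDr.
Qed.

Lemma opmx_bounded_scal (I : choiceType) (s : seq I) (a : I -> I -> C) :
  exists2 t, 0 <= t & forall v w : I -> C^o,
    normc (opmx_form (@scal_ip R) s (fun p q (z : C^o) => a p q * (z : C) : C^o) v w) <=
     t * (Num.sqrt (fam_sqn (@scal_ip R) s v) * Num.sqrt (fam_sqn (@scal_ip R) s w)).
Proof.
apply: (opmx_bounded (semi_inner_scal R)) => p q.
exists (normc (a p q)); first exact: normc_ge0.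
move=> u w; rewrite !sqn_scal !sqrtr_sqr !ger0_norm ?normc_ge0//.
by rewrite /scal_ip !ComplexField.Normc.normcM normc_conj mulrA.
Qed.

Definition scal_form n a (v w : nat -> C) : C :=
  \sum_(i < n) \sum_(j < n) a i j * v j * (w i)^*.

Lemma sum_iota (V : nmodType) n (F : nat -> V) :
  \sum_(i <- iota 0 n) F i = \sum_(i < n) F i.
Proof. by rewrite -{1}[n]subn0 -/(index_iota 0 n) big_mkord. Qed.

Lemma opmx_supp_mx n a : mbnd n a ->
  opmx_supp (iota 0 n) (fun i j (z : C^o) => (a i j : C) * z : C^o).
Proof.
move=> na; apply: opmx_supp_scal; first exact: iota_uniq.
by move=> p q pq; apply: na; rewrite negb_and; rewrite !mem_iota !add0n /= in pq.
Qed.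

Lemma opmx_form_mx n a (v w : nat -> C^o) :
  opmx_form (@scal_ip R) (iota 0 n) (fun i j (z : C^o) => (a i j : C) * z : C^o) v w
  = scal_form n a v w.
Proof.
rewrite /opmx_form sum_iota; apply: eq_bigr => i _.
by rewrite sum_iota; apply: eq_bigr.
Qed.

Lemma fam_sqn_mx n (v : nat -> C^o) :
  fam_sqn (@scal_ip R) (iota 0 n) v = \sum_(i < n) normc (v i) ^+ 2.
Proof. by rewrite /fam_sqn sum_iota; apply: eq_bigr => i _; rewrite sqn_scal. Qed.

Lemma scal_mnorm_form n a (v w : nat -> C) : mbnd n a ->
  normc (scal_form n a v w) <= scal_mnorm a *
    (Num.sqrt (\sum_(i < n) normc (v i) ^+ 2) *
     Num.sqrt (\sum_(i < n) normc (w i) ^+ 2)).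
Proof.
move=> na; have [t t0 h] := opmx_bounded_scal (iota 0 n) (fun i j => a i j : C).
have := opmx_norm_form (semi_inner_scal R) (opmx_supp_mx na) t0 h v w.
by rewrite opmx_form_mx !fam_sqn_mx.
Qed.

Lemma scal_mnorm_ge0 a : 0 <= scal_mnorm a.
Proof.
have [t t0 h] := opmx_bounded_scal (iota 0 (mdim a)) (fun i j => a i j : C).
exact: (opmx_norm_ge0 (semi_inner_scal R) (opmx_supp_mx (mdimP a)) t0 h).
Qed.

Lemma scal_mnorm_le n a t : mbnd n a -> 0 <= t ->
  (forall v w : nat -> C, normc (scal_form n a v w) <= t *
    (Num.sqrt (\sum_(i < n) normc (v i) ^+ 2) *
     Num.sqrt (\sum_(i < n) normc (w i) ^+ 2))) ->
  scal_mnorm a <= t.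
Proof.
move=> na t0 h; apply: (opmx_norm_le (semi_inner_scal R) (opmx_supp_mx na) t0).
by move=> v w; rewrite opmx_form_mx !fam_sqn_mx.
Qed.

Lemma gramE n a i j : mbnd n a ->
  gram a i j = \sum_(k < n) (a k i : C)^* * a k j.
Proof.
move=> na.
have E p q : \sum_(k \in [set: nat]) ((a k p : C)^* * a k q : C^o) =
             \sum_(k < n) (a k p : C)^* * a k q.
  apply: sum_nat_supp => k nk; by rewrite (mbnd_row _ na)// conjC0 mul0r.
rewrite /gram (@mxinfE _ _ n) ?E// => p q; rewrite negb_and -!leqNgt E => pq.
apply: big1 => k _; case/orP: pq => nn.
  by rewrite (mbnd_col _ na)// conjC0 mul0r.
by rewrite [X in _ * X](mbnd_col _ na)// mulr0.
Qed.

Lemma mbnd_gram n a : mbnd n a -> mbnd n (gram a).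
Proof.
move=> na i j; rewrite (gramE _ _ na) negb_and -!leqNgt => ij.
apply: big1 => k _; case/orP: ij => nn.
  by rewrite (mbnd_col _ na)// conjC0 mul0r.
by rewrite [X in _ * X](mbnd_col _ na)// mulr0.
Qed.

Lemma scal_form_gram n a (c : nat -> C) : mbnd n a ->
  scal_form n (gram a) c c =
  (\sum_(i < n) normc (\sum_(j < n) (a i j : C) * c j) ^+ 2)%:C%C.
Proof.
move=> na; rewrite rmorph_sum /=.
under [RHS]eq_bigr => i _ do rewrite -sqr_normc_mulc rmorph_sum mulr_suml /=.
rewrite /scal_form exchange_big /= [RHS]exchange_big /=.
apply: eq_bigr => j _.
under eq_bigr => k _ do rewrite (gramE _ _ na) !mulr_suml.
rewrite exchange_big /=; apply: eq_bigr => i _.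
rewrite mulr_sumr; apply: eq_bigr => k _.
rewrite rmorphM /=; ring.
Qed.

Lemma hs2_mmul_mtr n v b : mbnd n v -> mbnd n b ->
  hs2 (mmul v (mtr b)) =
  \sum_(r < n) Re (scal_form n (gram b) (v r) (v r)).
Proof.
move=> nv nb.
have ntb := mbnd_mtr nb.
rewrite (hs2E (mbnd_mmul nv ntb)); apply: eq_bigr => r _.
rewrite (scal_form_gram _ nb) /=; apply: eq_bigr => i _.
rewrite (@mmulE _ n); last by left.
by congr (normc _ ^+ 2); apply: eq_bigr => j _; rewrite mtrE mulrC.
Qed.

Lemma scal_form_sum m n (a : 'I_m -> Minf (C^o)) (v w : nat -> C) :
  scal_form n (\sum_k a k) v w = \sum_k scal_form n (a k) v w.
Proof.
rewrite /scal_form [RHS]exchange_big; apply: eq_bigr => i _.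
rewrite [RHS]exchange_big; apply: eq_bigr => j _.
by rewrite mx_sum !mulr_suml.
Qed.

(** The rows of [mmul v (mtr (b k))] are [b k] applied to the rows of [v]; hence the left side is
    the sum, over the rows c of [v], of the form of the summed Gram matrix at c. *)
Lemma sum_hs2_mmul m (b : 'I_m -> Minf (C^o)) v :
  \sum_k hs2 (mmul v (mtr (b k))) <= scal_mnorm (\sum_k gram (b k)) * hs2 v.
Proof.
pose n := maxn (mdim v) (\max_k mdim (b k)).
have nv : mbnd n v by apply: mbnd_le (mdimP v); rewrite leq_maxl.
have nb k : mbnd n (b k).
  by apply: mbnd_le (mdimP _); rewrite leq_max (leq_bigmax k) orbT.
under eq_bigr => k _ do rewrite (hs2_mmul_mtr nv (nb k)).
rewrite exchange_big (hs2E nv) mulr_sumr; apply: ler_sum => r _.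
rewrite -cRe_sum -scal_form_sum; apply: le_trans (Re_le_normc _) _.
have ng : mbnd n (\sum_k gram (b k)).
  move=> i j ij; rewrite mx_sum big1// => k _.
  exact: (mbnd_gram (nb k)).
apply: le_trans (scal_mnorm_form _ _ ng) _.
by rewrite -expr2 sqr_sqrtr// sumr_ge0// => i _; exact: sqr_ge0.
Qed.

(** The product keeps column [p] of [w] and moves it to column 0, so its Gram matrix has a single
    entry, the squared length of that column. *)
Lemma gram_col w p :
  scal_mnorm (gram (mmul w (unitmxinf R p 0))) <= hs2 w.
Proof.
pose n := maxn (mdim w) p.+1.
have nw : mbnd n w by apply: mbnd_le (mdimP w); rewrite leq_maxl.
have pn : (p < n)%N by rewrite leq_max ltnSn orbT.
have n0 : (0 < n)%N by exact: leq_ltn_trans pn.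
set a := mmul _ _.
have aE i j : a i j = if j == 0%N then w i p else 0.
  rewrite (@mmulE _ n); last by right.
  rewrite (bigD1 (Ordinal pn))//= big1 ?addr0 => [|k kp]; last first.
    by rewrite unitmxinfE -[_ == p]/(k == Ordinal pn) (negbTE kp) mulr0.
  by rewrite unitmxinfE eqxx /=; case: eqP => _; rewrite ?mulr1 ?mulr0.
have na : mbnd n a.
  move=> i j; rewrite aE; case: eqP => [->|//].
  by rewrite n0 andbT => ni; apply: nw; rewrite (negbTE ni).
apply: (@scal_mnorm_le 1 (gram a)); last 2 first.
- exact: hs2_ge0.
- move=> v u; rewrite /scal_form !big_ord1 !ComplexField.Normc.normcM normc_conj.
  rewrite !sqrtr_sqr !ger0_norm ?normc_ge0// -mulrA ler_wpM2r//.
    by rewrite mulr_ge0 ?normc_ge0.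
  rewrite (gramE _ _ na); apply: le_trans (normc_sum _ _ _) _.
  rewrite (hs2E nw); apply: ler_sum => i _.
  rewrite ComplexField.Normc.normcM normc_conj !aE /= -expr2.
  by rewrite (bigD1 (Ordinal pn))//= lerDl sumr_ge0// => j _; exact: sqr_ge0.
- move=> i j; rewrite !ltnS !leqn0 negb_and => ij; rewrite (gramE _ _ na).
  apply: big1 => k _; rewrite !aE; case/orP: ij => /negbTE ->.
    by rewrite conjC0 mul0r.
  by rewrite mulr0.
Qed.

End ScalarNorm.

(** * The dual norm and the dual cone in terms of the pairing *)

Section SmosTheory.
Variables (R : realType) (X : mos_data R).
Local Notation C := R[i].
Hypothesis smosX : is_smos X.
Implicit Types (x y : Minf X) (f g : Minf (functional X)) (v w : Minf C^o).

Lemma mnormD x y : mnorm (x + y) <= mnorm x + mnorm y.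
Proof. by have [[h _ _ _] _ _ _ _] := smosX; exact: h. Qed.

Lemma mnormZ (c : C) x : mnorm (c *: x) = normc c * mnorm x.
Proof. by have [[_ h _ _] _ _ _ _] := smosX; exact: h. Qed.

Lemma mnorm0_eq0 x : mnorm x = 0 -> x = 0.
Proof. by have [[_ _ h _] _ _ _ _] := smosX; exact: h. Qed.

Lemma mnorm0 : mnorm (0 : Minf X) = 0.
Proof. by rewrite -(scale0r 0) mnormZ ComplexField.Normc.normc0 mul0r. Qed.

Lemma mnormN x : mnorm (- x) = mnorm x.
Proof.
by rewrite -scaleN1r mnormZ normcN ComplexField.Normc.normc1 mul1r.
Qed.

Lemma mnorm_ge0 x : 0 <= mnorm x.
Proof. by have := mnormD x (- x); rewrite subrr mnorm0 mnormN; lra. Qed.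

Lemma xnorm_ge0 (x : X) : 0 <= xnorm x.
Proof. exact: mnorm_ge0. Qed.

Lemma mnorm_sandwich (a b : Minf C^o) x : mnorm (sandwich a x b) <=
  Num.sqrt (scal_mnorm (gram a)) * Num.sqrt (scal_mnorm (gram b)) * mnorm x.
Proof.
have [[_ _ _ h] _ _ _ _] := smosX.
have := h 1%N (fun=> a) (fun=> b) (fun=> x).
rewrite !big_ord1 big_ord_recl big_ord0 => /le_trans; apply.
by rewrite ler_wpM2l// ?mulr_ge0 ?sqrtr_ge0// ge_max lexx mnorm_ge0.
Qed.

(** Matrix units isolate the entry and leave only column [p] of [w] and column [q] of [v], to which
    [gram_col] applies. *)
Lemma xnorm_sandwich w x v p q :
  xnorm (sandwich w x v p q) <= hs w * hs v * mnorm x.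
Proof.
rewrite /xnorm -sandwich_unit sandwich_mmul; apply: le_trans (mnorm_sandwich _ _ _) _.
rewrite ler_wpM2r ?mnorm_ge0//; apply: ler_pM; rewrite ?sqrtr_ge0//;
  by rewrite ler_wsqrtr// gram_col.
Qed.

Lemma starD (x y : X) : star (x + y) = star x + star y.
Proof. by have [_ [h _ _] _ _ _] := smosX; exact: h. Qed.

Lemma starZ (c : C) (x : X) : star (c *: x) = c^* *: star x.
Proof. by have [_ [_ h _] _ _ _] := smosX; exact: h. Qed.

Lemma starK (x : X) : star (star x) = x.
Proof. by have [_ [_ _ h] _ _ _] := smosX; exact: h. Qed.

Lemma star0 : star (0 : X) = 0.
Proof. by rewrite -[0 in LHS](scale0r (0 : X)) starZ conjC0 scale0r. Qed.

Lemma star_sum (I : Type) (s : seq I) (P : pred I) (F : I -> X) :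
  star (\sum_(i <- s | P i) F i) = \sum_(i <- s | P i) star (F i).
Proof. by apply: (big_morph _ starD star0). Qed.

Lemma mstarE x i j : mstar x i j = star (x j i).
Proof.
apply: (@mxinfE _ _ (mdim x)) => k l kl; rewrite mdimP ?star0//.
by rewrite andbC.
Qed.

Lemma mnorm_mstar x : mnorm (mstar x) = mnorm x.
Proof. by have [_ _ h _ _] := smosX; exact: h. Qed.

Lemma mstar_mx1 (x : X) : mstar (mx1 x) = mx1 (star x).
Proof.
apply: Minf_eq => i j; rewrite mstarE !mx1E andbC.
by case: ifP => // _; rewrite star0.
Qed.

Lemma xnorm_star (x : X) : xnorm (star x) = xnorm x.
Proof. by rewrite /xnorm -mstar_mx1 mnorm_mstar. Qed.

Lemma mstarZ (c : C) x : mstar (c *: x) = c^* *: mstar x.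
Proof. by apply: Minf_eq => i j; rewrite mxZ !mstarE mxZ starZ. Qed.

Lemma mbnd_mstar n x : mbnd n x -> mbnd n (mstar x).
Proof. by move=> nx i j ij; rewrite mstarE nx ?star0// andbC. Qed.

Lemma mstar_sandwich w x v : mstar (sandwich w x v) = sandwich v (mstar x) w.
Proof.
apply: Minf_eq => i j; rewrite mstarE (sandwichE _ _ _ _ (mdimP x)).
rewrite (sandwichE _ _ _ _ (mbnd_mstar (mdimP x))) exchange_big star_sum.
apply: eq_bigr => k _; rewrite star_sum; apply: eq_bigr => l _.
by rewrite starZ mstarE rmorphM /= conjCK mulrC.
Qed.

Lemma thetaE f (x : X) i j : theta f x i j = f i j x.
Proof. by apply: (@mxinfE _ _ (mdim f)) => k l /mdimP ->. Qed.

Lemma theta0 f : theta f 0 = 0.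
Proof. by apply: Minf_eq => i j; rewrite thetaE fapp0. Qed.

Lemma amp_thetaE f x i j : amp (theta f) x i j = theta f (x i j).
Proof. by apply: ampE; exact: theta0. Qed.

Definition sqr_iota n : seq (nat * nat) :=
  [seq (i, k) | i <- iota 0 n, k <- iota 0 n].

Lemma mem_sqr_iota n p : (p \in sqr_iota n) = (p.1 < n)%N && (p.2 < n)%N.
Proof.
case: p => i k; apply/allpairsP/idP => /= [[[i' k'] /= [] + + [-> ->]]|/andP[ilt klt]].
  by rewrite !mem_iota !add0n /= => -> ->.
by exists (i, k); split; rewrite //= mem_iota.
Qed.

Lemma uniq_sqr_iota n : uniq (sqr_iota n).
Proof.
by apply: allpairs_uniq; rewrite ?iota_uniq// => -[a b] [c d] _ _ /= [-> ->].
Qed.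

Lemma sum_sqr_iota (V : nmodType) n (F : nat * nat -> V) :
  \sum_(p <- sqr_iota n) F p = \sum_(i < n) \sum_(k < n) F (i : nat, k : nat).
Proof.
rewrite /sqr_iota big_allpairs sum_iota.
by apply: eq_bigr => i _; rewrite sum_iota.
Qed.

Definition vec_mxinf n (v : nat * nat -> C^o) : Minf C^o :=
  mxinf (fun i k => if (i < n)%N && (k < n)%N then v (i, k) else 0).

Lemma vec_mxinfE n (v : nat * nat -> C^o) i k :
  vec_mxinf n v i k = if (i < n)%N && (k < n)%N then v (i, k) else 0.
Proof. by apply: (@mxinfE _ _ n) => p q /negbTE ->. Qed.

Lemma mbnd_vec_mxinf n (v : nat * nat -> C^o) : mbnd n (vec_mxinf n v).
Proof. by move=> i k /negbTE ik; rewrite vec_mxinfE ik. Qed.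

Lemma fam_sqn_sqr n (v : nat * nat -> C^o) :
  fam_sqn (@scal_ip R) (sqr_iota n) v = hs2 (vec_mxinf n v).
Proof.
rewrite /fam_sqn sum_sqr_iota (hs2E (@mbnd_vec_mxinf n v)).
apply: eq_bigr => i _; apply: eq_bigr => k _.
by rewrite vec_mxinfE !ltn_ord sqn_scal.
Qed.

Lemma theta_supp n f x : mbnd n f -> mbnd n x ->
  opmx_supp (sqr_iota n) (Minf_block (amp (theta f) x)).
Proof.
move=> nf nx; apply: (@opmx_supp_scal R _ (sqr_iota n)
  (fun p q => (amp (theta f) x p.1 q.1 p.2 q.2 : C))); first exact: uniq_sqr_iota.
move=> p q; rewrite !mem_sqr_iota -negb_and amp_thetaE thetaE => pq.
have [pq1|/nx ->] := boolP ((p.1 < n)%N && (q.1 < n)%N); last by rewrite fapp0.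
rewrite nf//; apply: contra pq => /andP[-> ->].
by case/andP: pq1 => -> ->.
Qed.

(** The coefficient of theta_f(x) at two vectors of l^2(nat * nat) is a value of [pair f] once the
    vectors are written as matrices. Norm and positivity in M_oo(M_oo(C)) thereby become statements
    about [f] on the matrices w^* x v, the form in which they are used from here on. *)
Lemma theta_form n f x (v w : nat * nat -> C^o) : mbnd n f -> mbnd n x ->
  opmx_form (@scal_ip R) (sqr_iota n) (Minf_block (amp (theta f) x)) v w =
  pair f (sandwich (vec_mxinf n w) x (vec_mxinf n v)).
Proof.
move=> nf nx; rewrite /opmx_form sum_sqr_iota (pairE (or_introl nf)).
rewrite exchange_big /=; apply: eq_bigr => k _.
under eq_bigr => i _ do rewrite sum_sqr_iota exchange_big /=.
rewrite exchange_big /=; apply: eq_bigr => l _.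
rewrite (sandwichE _ _ _ _ nx) fappl_sum; apply: eq_bigr => i _.
rewrite fappl_sum; apply: eq_bigr => j _.
rewrite fapplZ !vec_mxinfE !ltn_ord /= /Minf_block /scal_ip /=.
rewrite amp_thetaE thetaE [LHS]mulrC -[RHS]mulrA; congr (_ * _); exact: mulrC.
Qed.

Lemma pair_sandwich_trunc n f x v w : mbnd n f -> mbnd n x ->
  pair f (sandwich w x v) =
  pair f (sandwich (vec_mxinf n (fun p => w p.1 p.2)) x
                   (vec_mxinf n (fun p => v p.1 p.2))).
Proof.
move=> nf nx; rewrite !(pairE (or_introl nf)).
apply: eq_bigr => k _; apply: eq_bigr => l _; congr (fapp _ _).
rewrite !(sandwichE _ _ _ _ nx); apply: eq_bigr => i _; apply: eq_bigr => j _.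
by rewrite !vec_mxinfE !ltn_ord.
Qed.

Lemma hs_trunc n v : hs (vec_mxinf n (fun p => v p.1 p.2)) <= hs v.
Proof.
rewrite ler_wsqrtr//; set m := maxn n (mdim v).
have mv : mbnd m v by apply: mbnd_le (mdimP v); rewrite leq_maxr.
have mvn : mbnd m (vec_mxinf n (fun p => v p.1 p.2)).
  by apply: mbnd_le (@mbnd_vec_mxinf n _); rewrite leq_maxl.
rewrite (hs2E mv) (hs2E mvn); apply: ler_sum => i _; apply: ler_sum => j _.
rewrite vec_mxinfE; case: ifP => // _.
by rewrite ComplexField.Normc.normc0 expr0n sqr_ge0.
Qed.

Lemma mnorm_theta_le f x t : 0 <= t ->
  (forall v w, normc (pair f (sandwich w x v)) <= t * (hs v * hs w)) ->
  mnorm (amp (theta f) x) <= t.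
Proof.
move=> t0 h; have [n [nf nx]] := mbnd_common f x.
apply: (opmx_norm_le (semi_inner_scal R) (theta_supp nf nx) t0) => v w.
by rewrite (theta_form _ _ nf nx) !fam_sqn_sqr; exact: h.
Qed.

Lemma theta_bounded n f x : exists2 t, 0 <= t & forall v w : nat * nat -> C^o,
    normc (opmx_form (@scal_ip R) (sqr_iota n) (Minf_block (amp (theta f) x)) v w) <=
     t * (Num.sqrt (fam_sqn (@scal_ip R) (sqr_iota n) v) *
          Num.sqrt (fam_sqn (@scal_ip R) (sqr_iota n) w)).
Proof.
exact: (opmx_bounded_scal (sqr_iota n) (fun p q => amp (theta f) x p.1 q.1 p.2 q.2 : C)).
Qed.

Lemma mnorm_theta_ge0 f x : 0 <= mnorm (amp (theta f) x).
Proof.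
have [n [nf nx]] := mbnd_common f x; have [t t0 h] := theta_bounded n f x.
exact: (opmx_norm_ge0 (semi_inner_scal R) (theta_supp nf nx) t0 h).
Qed.

Lemma pair_le_mnorm_theta f x v w :
  normc (pair f (sandwich w x v)) <= mnorm (amp (theta f) x) * (hs v * hs w).
Proof.
have [n [nf nx]] := mbnd_common f x; have [t t0 h] := theta_bounded n f x.
rewrite (pair_sandwich_trunc _ _ nf nx) -(theta_form _ _ nf nx).
apply: le_trans
  (opmx_norm_form (semi_inner_scal R) (theta_supp nf nx) t0 h _ _) _.
rewrite !fam_sqn_sqr ler_wpM2l ?mnorm_theta_ge0//.
by apply: ler_pM; rewrite ?sqrtr_ge0// hs_trunc.
Qed.

Lemma theta_posP f x :
  mcone (amp (theta f) x) <-> forall v, 0 <= pair f (sandwich v x v).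
Proof.
have [n [nf nx]] := mbnd_common f x.
split=> [/(opmx_posP (semi_inner_scal R) (theta_supp nf nx)) h v|h].
  by rewrite (pair_sandwich_trunc _ _ nf nx) -(theta_form _ _ nf nx); exact: h.
apply/(opmx_posP (semi_inner_scal R) (theta_supp nf nx)) => v.
by rewrite (theta_form _ _ nf nx).
Qed.

(** A crude bound from the boundedness of the entries of [f]; it ensures that the supremum defining
    the dual norm is finite. *)
Lemma pair_bounded f : exists2 t, 0 <= t & forall x v w,
  normc (pair f (sandwich w x v)) <= t * mnorm x * (hs v * hs w).
Proof.
pose K k l := sval (cid (functional_bound (f k l))).
have KP k l (x : X) : normc (f k l x) <= `|K k l| * xnorm x.
  rewrite /K; case: cid => c /= h; apply: le_trans (h x) _.
  by rewrite ler_wpM2r ?xnorm_ge0// ler_norm.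
exists (\sum_(k < mdim f) \sum_(l < mdim f) `|K k l|).
  by apply: sumr_ge0 => k _; apply: sumr_ge0.
move=> x v w; rewrite /pair -mulrA mulr_suml.
apply: le_trans (normc_sum _ _ _) _; apply: ler_sum => k _.
rewrite mulr_suml; apply: le_trans (normc_sum _ _ _) _; apply: ler_sum => l _.
apply: le_trans (KP _ _ _) _; rewrite ler_wpM2l//.
by apply: le_trans (xnorm_sandwich _ _ _ _ _) _; lra.
Qed.

Lemma dual_mnorm_le (f : Minf (dual X)) t : 0 <= t ->
  (forall x v w, mnorm x <= 1 ->
     normc (pair f (sandwich w x v)) <= t * (hs v * hs w)) ->
  mnorm f <= t.
Proof.
move=> t0 h; apply: ge_sup.
  by exists (mnorm (amp (theta f) 0)); exists 0 => //=; rewrite mnorm0.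
by move=> _ [x /= x1 <-]; apply: mnorm_theta_le => // v w; exact: h.
Qed.

Lemma dual_has_sup (f : Minf (functional X)) :
  has_ubound [set mnorm (amp (theta f) x) | x in [set x : Minf X | mnorm x <= 1]].
Proof.
have [t t0 h] := pair_bounded f; exists t => _ [x /= x1 <-].
apply: mnorm_theta_le => // v w; apply: le_trans (h _ _ _) _.
by rewrite ler_wpM2r ?mulr_ge0 ?hs_ge0// ler_piMr.
Qed.

Lemma dual_mnorm_ge0 (f : Minf (dual X)) : 0 <= mnorm f.
Proof.
apply: le_trans (mnorm_theta_ge0 f 0) _; apply: ub_le_sup; first exact: dual_has_sup.
by exists 0 => //=; rewrite mnorm0.
Qed.

Lemma dual_mnorm_theta (f : Minf (dual X)) x : mnorm x <= 1 ->
  mnorm (amp (theta f) x) <= mnorm f.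
Proof. by move=> x1; apply: ub_le_sup; [exact: dual_has_sup|exists x]. Qed.

(** By homogeneity from the unit ball. Together with [dual_mnorm_le] it identifies the dual norm as
    the best constant in this inequality. *)
Lemma pair_le_mnorm (f : Minf (dual X)) x v w :
  normc (pair f (sandwich w x v)) <= mnorm f * mnorm x * (hs v * hs w).
Proof.
have [x0|x0] := eqVneq (mnorm x) 0.
  rewrite (mnorm0_eq0 x0) -(scale0r (0 : Minf X)) sandwichZ pairZr mul0r.
  by rewrite ComplexField.Normc.normc0 mulr_ge0// ?mulr_ge0 ?hs_ge0 ?mnorm_ge0// dual_mnorm_ge0.
have xgt0 : 0 < mnorm x by rewrite lt_def x0 mnorm_ge0.
pose y := (mnorm x)^-1%:C%C *: x.
have y1 : mnorm y = 1.
  by rewrite mnormZ normc_real ger0_norm ?invr_ge0 ?mnorm_ge0// mulVf.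
have := pair_le_mnorm_theta f y v w.
rewrite sandwichZ pairZr ComplexField.Normc.normcM normc_real ger0_norm ?invr_ge0 ?mnorm_ge0//.
rewrite mulrC ler_pdivrMr// => /le_trans; apply.
rewrite mulrAC ler_wpM2r ?mulr_ge0 ?hs_ge0//.
by rewrite ler_wpM2r ?mnorm_ge0// dual_mnorm_theta// y1.
Qed.

(** Recovers single entries from the pairing, so that identities of matrices over the dual follow
    from identities of pairings. *)
Lemma pair_unit f (y : X) k l :
  pair f (sandwich (unitmxinf R 0 k) (mx1 y) (unitmxinf R 0 l)) = f k l y.
Proof.
set z := sandwich _ _ _.
have zE p q : z p q = if (p == k) && (q == l) then y else 0.
  rewrite (sandwichE _ _ _ _ (@mbnd_mx1 _ _ y)) !big_ord1 mx1E !unitmxinfE /=.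
  case: eqP => _ /=; last by rewrite conjC0 mul0r scale0r.
  by case: eqP => _ /=; rewrite ?mulr0 ?scale0r// conjC1 mulr1 scale1r.
pose n := (maxn k l).+1.
have nz : mbnd n z.
  move=> p q; rewrite zE; case: eqP => [->|//]; case: eqP => [->|//].
  by rewrite !ltnS leq_maxl leq_maxr.
have kn : (k < n)%N by rewrite ltnS leq_maxl.
have ln : (l < n)%N by rewrite ltnS leq_maxr.
rewrite (pairE (or_intror nz)) (bigD1 (Ordinal kn))//= (bigD1 (Ordinal ln))//=.
rewrite zE !eqxx /= big1 ?addr0 => [|q ql]; last first.
  by rewrite zE -[_ == l]/(q == Ordinal ln) (negbTE ql) andbF fapp0.
rewrite big1 ?addr0// => p pk; apply: big1 => q _.
by rewrite zE -[(_ == k :> nat)]/(p == Ordinal kn) (negbTE pk) fapp0.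
Qed.

Lemma dual_starE (f : functional X) (x : X) : dual_star f x = (f (star x) : C)^*.
Proof.
rewrite /dual_star.
have h : (fun x : X => ((f (star x) : C)^* : C^o)) \in @is_functional R X.
  apply/asboolP; split.
    move=> a y z; rewrite starD starZ functional_linear rmorphD /=.
    by rewrite rmorphM /= conjCK.
  have [K KP] := functional_bound f; exists K => y.
  by rewrite normc_conj -xnorm_star.
by rewrite -[LHS]/(val (insubd 0 _ : functional X) x) insubdK.
Qed.

End SmosTheory.

(** * Dual spaces *)

Section DualSmos.
Variables (R : realType) (X : mos_data R).
Local Notation C := R[i].
Hypothesis smosX : is_smos X.
Implicit Types (x y : Minf X) (f g : Minf (dual X)) (v w : Minf C^o).

Lemma dual_mnormD f g : mnorm (f + g) <= mnorm f + mnorm g.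
Proof.
apply: (dual_mnorm_le smosX); first by rewrite addr_ge0// dual_mnorm_ge0.
move=> x v w x1; rewrite pairDl; apply: le_trans (le_normcD _ _) _.
rewrite mulrDl lerD//; apply: le_trans (pair_le_mnorm smosX _ _ _ _) _;
  by rewrite ler_wpM2r ?mulr_ge0 ?hs_ge0// ler_piMr// dual_mnorm_ge0.
Qed.

Lemma dual_mnormZ (c : C) f : mnorm (c *: f) = normc c * mnorm f.
Proof.
have le d g : mnorm (d *: g) <= normc d * mnorm g.
  apply: (dual_mnorm_le smosX); first by rewrite mulr_ge0 ?normc_ge0 ?dual_mnorm_ge0.
  move=> x v w x1; rewrite pairZl ComplexField.Normc.normcM -mulrA.
  rewrite ler_wpM2l ?normc_ge0//; apply: le_trans (pair_le_mnorm smosX _ _ _ _) _.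
  by rewrite ler_wpM2r ?mulr_ge0 ?hs_ge0// ler_piMr// dual_mnorm_ge0.
apply/eqP; rewrite eq_le le /=.
have [->|c0] := eqVneq c 0.
  by rewrite ComplexField.Normc.normc0 mul0r dual_mnorm_ge0.
have nc0 : 0 < normc c.
  rewrite lt_def normc_ge0 andbT; apply: contra_neq c0.
  exact: ComplexField.Normc.eq0_normc.
have := le c^-1 (c *: f).
rewrite scalerA mulVf// scale1r ComplexField.Normc.normcV.
by rewrite mulrC ler_pdivlMr// mulrC.
Qed.

Lemma dual_mnorm0_eq0 f : mnorm f = 0 -> f = 0.
Proof.
move=> f0; apply: Minf_eq => k l; apply: functional_eq => y.
rewrite -[LHS](pair_unit f y k l); apply: ComplexField.Normc.eq0_normc; apply/eqP.
rewrite eq_le normc_ge0 andbT; apply: le_trans (pair_le_mnorm smosX _ _ _ _) _.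
by rewrite f0 !mul0r.
Qed.

(** [pair_sandwich] shifts the scalar matrices onto the vectors, which become [mmul v (mtr (b k))]
    and [mmul w (mtr (a k))]. The Cauchy-Schwarz inequality over k and [sum_hs2_mmul] then produce
    the two Gram norms. *)
Lemma dual_mnorm_sandwich n (a b : 'I_n -> Minf C^o) (f : 'I_n -> Minf (dual X)) :
  mnorm (\sum_k sandwich (a k) (f k) (b k) : Minf (dual X)) <=
    Num.sqrt (scal_mnorm (\sum_k gram (a k))) *
    Num.sqrt (scal_mnorm (\sum_k gram (b k))) *
    \big[Num.max/0]_k mnorm (f k).
Proof.
set m := \big[Num.max/0]_k _.
have fm k : mnorm (f k) <= m by exact: le_bigmax.
have m0 : 0 <= m by exact: bigmax_ge_id.
apply: (dual_mnorm_le smosX); first by rewrite !mulr_ge0 ?sqrtr_ge0.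
move=> x v w x1; rewrite pair_suml; apply: le_trans (normc_sum _ _ _) _.
apply: (@le_trans _ _ (\sum_k m * (hs (mmul v (mtr (b k))) * hs (mmul w (mtr (a k)))))).
  apply: ler_sum => k _; rewrite pair_sandwich sandwich_mmul.
  apply: le_trans (pair_le_mnorm smosX _ _ _ _) _.
  rewrite ler_wpM2r ?mulr_ge0 ?hs_ge0//; apply: le_trans (fm k).
  by rewrite ler_piMr// dual_mnorm_ge0.
rewrite -mulr_sumr [leRHS]mulrAC [leRHS]mulrC ler_wpM2l//.
pose p k := (hs (mmul v (mtr (b k))))%:C%C; pose q k := (hs (mmul w (mtr (a k))))%:C%C.
have := @cauchy_schwarz_sum R _ (@scal_ip R) _ (index_enum 'I_n) p q (semi_inner_scal R).
have -> : \sum_(k <- index_enum 'I_n) scal_ip (p k) (q k) =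
    (\sum_k hs (mmul v (mtr (b k))) * hs (mmul w (mtr (a k))))%:C%C.
  rewrite rmorph_sum /=; apply: eq_bigr => k _; rewrite rmorphM /= /scal_ip.
  by congr (_ * _); rewrite conj_Creal// complex_real.
have sq (u : Minf C^o) (c : 'I_n -> Minf C^o) :
    fam_sqn (@scal_ip R) (index_enum 'I_n) (fun k => (hs (mmul u (mtr (c k))))%:C%C)
    <= scal_mnorm (\sum_k gram (c k)) * hs2 u.
  apply: le_trans (sum_hs2_mmul c u); apply: ler_sum => k _.
  by rewrite sqn_scal normc_real real_normK ?num_real// sqr_hs.
rewrite normc_real => /(le_trans (ler_norm _)) /le_trans; apply.
apply: le_trans (_ : _ <= Num.sqrt (scal_mnorm (\sum_k gram (b k)) * hs2 v) *
  Num.sqrt (scal_mnorm (\sum_k gram (a k)) * hs2 w)) _.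
  by apply: ler_pM; rewrite ?sqrtr_ge0//; apply: ler_wsqrtr; exact: sq.
by rewrite !sqrtrM ?scal_mnorm_ge0// -/(hs v) -/(hs w) mulrACA [X in X * _ <= _]mulrC.
Qed.

Lemma dual_involution : is_involution (dual X).
Proof.
split=> [f g|c f|f]; apply: functional_eq => x.
- rewrite -[RHS]/((dual_star f x : C) + dual_star g x) [LHS](dual_starE smosX).
  by rewrite !(dual_starE smosX) fappD rmorphD.
- rewrite -[RHS]/(c^* * (dual_star f x : C)) [LHS](dual_starE smosX).
  by rewrite !(dual_starE smosX) fappZ rmorphM.
- rewrite [LHS](dual_starE smosX) (dual_starE smosX f) starK//.
  exact: conjCK.
Qed.

Lemma dual_mstarE f i j : mstar f i j = dual_star (f j i).
Proof.
have s0 : dual_star (0 : functional X) = 0.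
  by apply: functional_eq => x; rewrite (dual_starE smosX) conjC0.
by apply: (@mxinfE _ _ (mdim f)) => k l kl; rewrite mdimP ?s0// andbC.
Qed.

Lemma pair_mstar f x : pair (mstar f) x = (pair f (mstar x))^*.
Proof.
have [n [nf nx]] := mbnd_common f x.
have nsx : mbnd n (mstar x) := mbnd_mstar smosX nx.
rewrite !(@pairE _ n); try by right.
rewrite exchange_big rmorph_sum; apply: eq_bigr => k _.
rewrite rmorph_sum; apply: eq_bigr => l _.
by rewrite dual_mstarE (dual_starE smosX) (mstarE smosX).
Qed.

Lemma dual_mnorm_mstar f : mnorm (mstar f) = mnorm f.
Proof.
have le g : mnorm (mstar g) <= mnorm g.
  apply: (dual_mnorm_le smosX); first exact: dual_mnorm_ge0.
  move=> x v w x1; rewrite pair_mstar normc_conj (mstar_sandwich smosX).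
  apply: le_trans (pair_le_mnorm smosX _ _ _ _) _.
  rewrite (mnorm_mstar smosX) [hs w * _]mulrC ler_wpM2r ?mulr_ge0 ?hs_ge0//.
  by rewrite ler_piMr// dual_mnorm_ge0.
apply/eqP; rewrite eq_le; apply/andP; split; first exact: le.
suff ff : mstar (mstar f) = f by rewrite -[X in mnorm X <= _]ff; exact: le.
apply: Minf_eq => i j; rewrite (dual_mstarE (mstar f)) (dual_mstarE f).
by have [_ _ h] := dual_involution; exact: h.
Qed.

(** The equation [mstar f = f] already makes theta_f a *-linear map, so complete positivity reduces
    to positive coefficients, by [theta_posP]. *)
Lemma dual_coneP f : mcone f <-> mstar f = f /\
  forall x v, mcone x -> 0 <= pair f (sandwich v x v).
Proof.
split=> [[sf [_ h]]|[sf h]]; split=> //.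
  by move=> x v /h/theta_posP; apply.
split; last by move=> x cx; apply/theta_posP => v; exact: h.
split=> [a x y|x].
  apply: Minf_eq => i j; rewrite mxD mxZ !thetaE.
  exact: functional_linear.
apply: Minf_eq => i j; rewrite thetaE /=.
rewrite (@mxinfE _ _ (mdim f)) => [|k l kl]; last first.
  by rewrite thetaE mdimP ?conjC0// andbC.
by rewrite thetaE -{1}sf dual_mstarE (dual_starE smosX) starK.
Qed.

(** Closedness of the half-line of nonnegative numbers, with an error [e * K] because norm estimates
    come with a fixed factor. *)
Lemma ge0_approx (z : C) (K : R) :
  (forall e, 0 < e -> exists2 p, 0 <= p & normc (z - p) <= e * K) -> 0 <= z.
Proof.
move=> h.
have h' e : 0 < e -> - e <= Re z /\ `|Im z| <= e.
  move=> e0; have K0 : 0 < `|K| + 1 by rewrite ltr_wpDl.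
  have [p p0 zp] := h (e / (`|K| + 1)) (divr_gt0 e0 K0).
  have {}zp : normc (z - p) <= e.
    apply: le_trans zp _; rewrite mulrAC ler_pdivrMr// ler_wpM2l ?(ltW e0)//.
    by apply: le_trans (ler_norm _) _; rewrite lerDl.
  move: zp p0; case: z {h} => a b; case: p => c d.
  rewrite lecE /= => zp /andP[/eqP d0 c0]; subst d; move: zp; rewrite subr0 => zp.
  split.
    have : `|a - c| <= e.
      by apply: le_trans zp; rewrite -sqrtr_sqr ler_wsqrtr// lerDl sqr_ge0.
    by rewrite ler_norml => /andP[]; lra.
  by apply: le_trans zp; rewrite -sqrtr_sqr ler_wsqrtr// lerDr sqr_ge0.
case: z h' {h} => a b h'; rewrite lecE /=; apply/andP; split.
  rewrite -normr_le0; apply/ler_addgt0Pr => e e0; rewrite add0r.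
  by have [] := h' e e0.
by apply/ler_addgt0Pr => e e0; have [/= + _] := h' e e0; lra.
Qed.

Lemma dual_cone_closed : norm_closed mnorm (@mcone R (dual X)).
Proof.
move=> f h; apply/dual_coneP; split.
  apply/eqP; rewrite -subr_eq0; apply/eqP/dual_mnorm0_eq0; apply/eqP.
  rewrite eq_le dual_mnorm_ge0// andbT; apply/ler_addgt0Pr => e e0.
  have e20 : 0 < e / 2 by rewrite divr_gt0.
  have [g /dual_coneP[sg _] fg] := h _ e20.
  have -> : mstar f - f = mstar (f - g) - (f - g).
    have -> : mstar (f - g) = mstar f - mstar g.
      have [aD aZ _] := dual_involution.
      apply: Minf_eq => i j; rewrite !mxB !dual_mstarE.
      apply: functional_eq => x.
      by rewrite !fappD !fappN !(dual_starE smosX) fappD fappN rmorphB.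
    by rewrite sg opprB addrA subrK.
  rewrite add0r; apply: le_trans (dual_mnormD _ _) _.
  have -> : mnorm (- (f - g)) = mnorm (f - g).
    by rewrite -scaleN1r dual_mnormZ normcN ComplexField.Normc.normc1 mul1r.
  by rewrite dual_mnorm_mstar; move: fg; lra.
move=> x v cx; apply: (@ge0_approx _ (mnorm x * (hs v * hs v))) => e e0.
have [g /dual_coneP[_ pg] fg] := h _ e0.
exists (pair g (sandwich v x v)); first exact: pg.
rewrite -pairNl -pairDl; apply: le_trans (pair_le_mnorm smosX _ _ _ _) _.
by rewrite -mulrA ler_wpM2r ?mulr_ge0 ?hs_ge0 ?mnorm_ge0// ltW.
Qed.

Lemma dual_smos : is_smos (dual X).
Proof.
split.
- by split; [exact: dual_mnormD|exact: dual_mnormZ|exact: dual_mnorm0_eq0|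
             exact: dual_mnorm_sandwich].
- exact: dual_involution.
- exact: dual_mnorm_mstar.
- by split; [move=> f /dual_coneP[]|exact: dual_cone_closed].
move=> n a f h; apply/dual_coneP; split.
  apply: Minf_eq => i j; apply: functional_eq => x.
  rewrite -!(pair_unit _ x) pair_mstar (mstar_sandwich smosX) (mstar_mx1 smosX).
  rewrite !pair_suml rmorph_sum; apply: eq_bigr => k _ /=.
  have [sf _] := (dual_coneP _).1 (h k).
  rewrite !pair_sandwich -{1}sf pair_mstar conjCK; congr (pair _ _).
  rewrite !(mstar_sandwich smosX) (mstar_mx1 smosX) starK//.
move=> x v cx; rewrite pair_suml; apply: sumr_ge0 => k _.
rewrite pair_sandwich sandwich_mmul; have [_ pf] := (dual_coneP _).1 (h k).
exact: pf.
Qed.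

End DualSmos.

(** * Weak topologies and the canonical predual *)

Section WeakTopologies.
Variables (R : realType) (T : choiceType) (F : set (T -> R[i]^o)).
Local Notation C := R[i].

Lemma weak_top_gen w : F w -> continuous (w : weak_top F -> C^o).
Proof.
move=> Fw t.
pose f : T -> prod_topology (fun _ : set_type F => C^o) := fun t g => set_val g t.
pose i : set_type F := exist _ w (mem_set Fw).
have c1 : continuous (f : weak_top F -> _) by exact: initial_continuous.
have c2 : continuous (fun p : prod_topology (fun _ : set_type F => C^o) => p i).
  move=> p; have /cvg_sup/(_ i) h : p --> p by exact: cvg_id.
  move=> A /(@initial_continuous _ _ (fun p : set_type F -> C^o => p i)) pA.
  exact: h.
exact: (continuous_comp (c1 t) (c2 _)).
Qed.

Lemma continuous_weak_top (S : topologicalType) (f : S -> weak_top F) :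
  (forall w, F w -> continuous ((w : T -> C^o) \o f : S -> C^o)) -> continuous f.
Proof.
move=> h; apply: continuous_comp_initial => s.
apply/cvg_sup => i.
pose g : S -> initial_topology (fun p : set_type F -> C^o => p i) :=
  (fun t (k : set_type F) => set_val k t) \o f.
suff : continuous g by exact.
apply: continuous_comp_initial.
exact: (h (set_val i) (set_valP i)).
Qed.

(** Continuity at a point with real tolerances: membership in a weak closure is exploited through
    finite combinations of such functions. *)
Definition weak_cont (t : T) (g : T -> C) : Prop :=
  forall e, 0 < e -> nbhs (t : weak_top F) [set b | normc (g b - g t) < e].

Lemma weak_cont_gen t w : F w -> weak_cont t w.
Proof.
move=> /weak_top_gen/(_ t)/cvgrPdist_lt h e e0.
have /h : (0 : C) < e%:C%C by rewrite ltcR.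
apply: filterS => b /=; rewrite normC_normc ltcR.
by rewrite -normcN opprB.
Qed.

Lemma weak_contD t g1 g2 : weak_cont t g1 -> weak_cont t g2 ->
  weak_cont t (fun b => g1 b + g2 b).
Proof.
move=> h1 h2 e e0; have e20 : 0 < e / 2 by rewrite divr_gt0.
apply: filterS2 (h1 _ e20) (h2 _ e20) => b /= lt1 lt2.
rewrite opprD addrACA; apply: le_lt_trans (le_normcD _ _) _.
by rewrite [e]splitr ltrD.
Qed.

Lemma weak_contZ t c g : weak_cont t g -> weak_cont t (fun b => c * g b).
Proof.
move=> h e e0; have c0 : 0 < normc c + 1 by rewrite ltr_wpDl ?normc_ge0.
have ec : 0 < e / (normc c + 1) by rewrite divr_gt0.
apply: filterS (h _ ec) => b /=; rewrite ltr_pdivlMr// => lt.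
rewrite -mulrBr ComplexField.Normc.normcM; apply: le_lt_trans lt.
by rewrite mulrC ler_wpM2l ?normc_ge0// lerDl.
Qed.

Lemma weak_cont_conj t g : weak_cont t g -> weak_cont t (fun b => (g b)^*).
Proof.
move=> h e /h; apply: filterS => b /=.
by rewrite -rmorphB normc_conj.
Qed.

Lemma weak_cont_cst t c : weak_cont t (fun=> c).
Proof.
have fF : Filter (nbhs (t : weak_top F)) := nbhs_filter _.
move=> e e0; apply: filterS filterT => b _ /=.
by rewrite subrr -[X in normc X]/(0 : C) ComplexField.Normc.normc0.
Qed.

Lemma weak_cont_sum t (I : Type) (s : seq I) (P : pred I) (g : I -> T -> C) :
  (forall i, weak_cont t (g i)) ->
  weak_cont t (fun b => \sum_(i <- s | P i) g i b).
Proof.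
move=> h; elim: s => [|i s IH].
  by under [X in weak_cont t X]eq_fun do rewrite big_nil; exact: weak_cont_cst.
under [X in weak_cont t X]eq_fun do rewrite big_cons.
by case: (P i) => //; apply: weak_contD.
Qed.

Lemma weak_closure_approx (B : set T) t g : closure (B : set (weak_top F)) t ->
  weak_cont t g -> forall e, 0 < e -> exists2 b, B b & normc (g b - g t) < e.
Proof. by move=> Bt gt e /gt/Bt[b [Bb ltb]]; exists b. Qed.

(** Applied to the defect of an identity that holds on [B], in order to carry the identity over to
    the closure. *)
Lemma weak_closure_eq0 (B : set T) t g : closure (B : set (weak_top F)) t ->
  weak_cont t g -> (forall b, B b -> g b = 0) -> g t = 0.
Proof.
move=> Bt gt g0; apply: ComplexField.Normc.eq0_normc; apply/eqP.
rewrite eq_le normc_ge0 andbT; apply/ler_addgt0Pr => e e0; rewrite add0r.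
have [b Bb] := weak_closure_approx Bt gt e0.
by rewrite g0// sub0r normcN => /ltW.
Qed.

End WeakTopologies.

Section Subspaces.
Variable R : realType.
Local Notation C := R[i].

Lemma lin_spanP (V : lmodType C) (A : set V) v :
  is_subspace A -> v \in lin_span A <-> A v.
Proof.
move=> sA; split=> [/asboolP|Av]; first by apply.
by apply/asboolP => B _; apply.
Qed.

Lemma subsp_mem (V : lmodType C) (A : set V) (x : subsp A) :
  is_subspace A -> A (val x).
Proof. by move=> sA; apply/(lin_spanP _ sA); case: x. Qed.

Lemma insubd_subsp (V : lmodType C) (A : set V) v :
  is_subspace A -> A v -> val (insubd (0 : subsp A) v) = v.
Proof. by move=> sA Av; rewrite insubdK//; apply/(lin_spanP _ sA). Qed.

Lemma amp_mx1 (V W : lmodType C) (phi : V -> W) (v : V) : phi 0 = 0 ->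
  amp phi (mx1 v) = mx1 (phi v).
Proof.
move=> p0; apply: Minf_eq => i j; rewrite ampE// !mx1E.
by case: ifP.
Qed.

Lemma mnorm_sub (X : mos_data R) (A : set X) (x : Minf (sub_mos A)) :
  mnorm x = mnorm (amp val (x : Minf (subsp A))).
Proof. by []. Qed.

Lemma xnorm_sub (X : mos_data R) (A : set X) (x : sub_mos A) :
  xnorm x = xnorm (val (x : subsp A)).
Proof. by rewrite /xnorm mnorm_sub; congr mnorm; exact: amp_mx1. Qed.

Lemma valD_subsp (V : lmodType C) (A : set V) (x y : subsp A) :
  val (x + y) = val x + val y.
Proof. by []. Qed.

Lemma valZ_subsp (V : lmodType C) (A : set V) c (x : subsp A) :
  val (c *: x) = c *: val x.
Proof. by []. Qed.

End Subspaces.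

(** * The canonical map into the bidual *)

Section BidualMap.
Variables (R : realType) (X : mos_data R).
Local Notation C := R[i].
Hypothesis smosX : is_smos X.

Lemma hs_unit00 : hs (unitmxinf R 0 0) = 1.
Proof.
have n1 : mbnd 1 (unitmxinf R 0 0).
  by move=> i j; rewrite unitmxinfE !ltnS !leqn0 => /negbTE ->.
rewrite /hs (hs2E n1) !big_ord1 unitmxinfE !eqxx ComplexField.Normc.normc1.
by rewrite expr1n sqrtr1.
Qed.

Lemma functional_le_xnorm (f : dual X) (x : X) :
  normc ((f : functional X) x) <= xnorm f * xnorm x.
Proof.
have := pair_le_mnorm smosX (mx1 f) (mx1 x) (unitmxinf R 0 0) (unitmxinf R 0 0).
by rewrite (pair_unit (mx1 f) x 0 0) hs_unit00 !mulr1 mx1E.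
Qed.

Lemma xnorm_functional_le (f : dual X) t : 0 <= t ->
  (forall x, normc ((f : functional X) x) <= t * xnorm x) -> xnorm f <= t.
Proof.
move=> t0 h; apply: (dual_mnorm_le smosX) => // x v w x1.
rewrite pair_mx1; apply: le_trans (h _) _; rewrite ler_wpM2l//.
apply: le_trans (xnorm_sandwich smosX _ _ _ _ _) _.
by rewrite mulrC [hs v * _]mulrC ler_piMl ?mulr_ge0 ?hs_ge0.
Qed.

Lemma bidual_mapE (x : X) (f : functional X) : (bidual_map x : functional (dual X)) f = f x.
Proof.
have h : (fun f : dual X => (f : functional X) x) \in @is_functional R (dual X).
  apply/asboolP; split; first by move=> a f' g'.
  exists (xnorm x) => g; rewrite mulrC; exact: functional_le_xnorm.
by rewrite -[LHS]/(val (insubd 0 _ : functional (dual X)) f) insubdK.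
Qed.

Lemma bidual_map_linear : linear (@bidual_map R X).
Proof.
move=> a x y; apply: functional_eq => f.
rewrite bidual_mapE functional_linear -[RHS]/(a *: (bidual_map x : functional (dual X)) f + (bidual_map y : functional (dual X)) f).
by rewrite !bidual_mapE.
Qed.

Lemma bidual_map0 : bidual_map (0 : X) = 0.
Proof. by apply: functional_eq => f; rewrite bidual_mapE fapp0. Qed.

Lemma amp_bidualE (x : Minf X) i j : amp (@bidual_map R X) x i j = bidual_map (x i j).
Proof. by apply: ampE; exact: bidual_map0. Qed.

Lemma pair_bidual (x : Minf X) (f : Minf (dual X)) :
  pair (amp (@bidual_map R X) x : Minf (functional (dual X))) f = pair f x.
Proof.
have [n [nx nf]] := mbnd_common x f.
rewrite !(@pairE _ n); try by [left|right].
apply: eq_bigr => k _; apply: eq_bigr => l _.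
by rewrite amp_bidualE bidual_mapE.
Qed.

Lemma hs_mtr v : hs (mtr v) = hs v :> R.
Proof.
rewrite /hs; congr Num.sqrt.
rewrite (hs2E (mbnd_mtr (mdimP v))) exchange_big /hs2.
by apply: eq_bigr => i _; apply: eq_bigr => j _; rewrite mtrE.
Qed.

Lemma mtrK v : mtr (mtr v) = v :> Minf C^o.
Proof. by apply: Minf_eq => i j; rewrite !mtrE. Qed.

Let smosD := dual_smos smosX.

Lemma mnorm_bidual_le (x : Minf X) :
  mnorm (amp (@bidual_map R X) x : Minf (dual (dual X))) <= mnorm x.
Proof.
apply: (dual_mnorm_le smosD); first exact: mnorm_ge0.
move=> f v w f1; rewrite pair_bidual pair_sandwich.
apply: le_trans (pair_le_mnorm smosX _ _ _ _) _.
by rewrite !hs_mtr ler_wpM2r ?mulr_ge0 ?hs_ge0// ler_piMl// mnorm_ge0.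
Qed.

Lemma bidual_map_star (x : X) : bidual_map (star x) = star (bidual_map x : dual (dual X)).
Proof.
apply: functional_eq => f; rewrite bidual_mapE.
rewrite [RHS](dual_starE smosD) bidual_mapE.
by rewrite [X in _ = X^*](dual_starE smosX) conjCK.
Qed.

End BidualMap.

(** * X^* as a predual of X^** *)

Section CanonicalPredual.
Variables (R : realType) (X : mos_data R).
Local Notation C := R[i].
Hypothesis smosX : is_smos X.
Local Notation Y := (dual X).
Local Notation D := (dual (dual X)).
Let smosY : is_smos Y := dual_smos smosX.
Let smosD : is_smos D := dual_smos smosY.
Local Notation A := (canonical_predual Y).

(** The image of [y] evaluated at the image of [x] is [y] evaluated at [x], and X maps contractively
    into X^**; so the unit ball of X already recovers the norm of [y] from its image. *)
Lemma mnorm_bidual_dual (y : Minf Y) :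
  mnorm (amp (@bidual_map R Y) y : Minf (dual (dual Y))) = mnorm y.
Proof.
apply/eqP; rewrite eq_le; apply/andP; split; first exact: mnorm_bidual_le.
apply: (dual_mnorm_le smosX); first exact: (mnorm_ge0 (dual_smos smosD)).
move=> x v w x1.
rewrite -{1}[w]mtrK -{1}[v]mtrK -pair_sandwich -(pair_bidual smosX).
rewrite -pair_sandwich -(pair_bidual smosY).
apply: le_trans (pair_le_mnorm smosD _ _ _ _) _.
rewrite ler_wpM2r ?mulr_ge0 ?hs_ge0// ler_piMr//.
  exact: (mnorm_ge0 (dual_smos smosD)).
by apply: le_trans x1; exact: mnorm_bidual_le.
Qed.

Lemma xnorm_bidual_dual (y : Y) : xnorm (bidual_map y) = xnorm y.
Proof. by rewrite /xnorm -amp_mx1 ?mnorm_bidual_dual// bidual_map0. Qed.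

Lemma bidual_map_inj : injective (@bidual_map R Y).
Proof.
move=> y z yz; apply/eqP; rewrite -subr_eq0; apply/eqP.
suff : mx1 (y - z) = 0 by move=> /(congr1 (fun x : Minf Y => x 0%N 0%N)); rewrite mx1E.
apply: (mnorm0_eq0 smosY); rewrite -[mnorm _]/(xnorm (y - z)) -xnorm_bidual_dual.
have -> : bidual_map (y - z) = 0.
  rewrite -[y - z]addrC -scaleN1r (bidual_map_linear smosY) yz scaleN1r.
  by rewrite addNr.
rewrite /xnorm; have -> : mx1 (0 : dual (dual Y)) = 0.
  by apply: Minf_eq => i j; rewrite mx1E; case: ifP.
exact: (mnorm0 (dual_smos smosD)).
Qed.

Lemma canonical_predual_subspace : is_subspace (A : set (dual D)).
Proof.
split; first by exists 0 => //; exact: bidual_map0.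
move=> c _ _ [y _ <-] [z _ <-]; exists (c *: y + z) => //.
exact: bidual_map_linear.
Qed.

Lemma canonical_predual_star : star_invariant (A : set (dual D)).
Proof.
move=> _ [y _ <-]; exists (star y) => //; exact: bidual_map_star.
Qed.

(** This is the completeness of X^*. Restricting the limit [xi] to X gives [y0]; restriction is
    contractive, so elements of X^* whose images are close to [xi] are close to [y0], and [xi] is
    the image of [y0]. *)
Lemma canonical_predual_closed : norm_closed (@xnorm R (dual D)) A.
Proof.
move=> xi h; have smosDD := dual_smos smosD.
have h0 : (fun x : X => (xi : functional D) (bidual_map x)) \in @is_functional R X.
  apply/asboolP; split=> [a x z|].
    by rewrite (bidual_map_linear smosX) functional_linear.
  exists (xnorm xi) => x; apply: le_trans (functional_le_xnorm smosD _ _) _.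
  rewrite ler_wpM2l ?(mnorm_ge0 smosDD)//.
  by rewrite /xnorm -amp_mx1 ?mnorm_bidual_le// bidual_map0.
pose y0 : Y := MkFunctional h0.
exists y0 => //; apply/eqP; rewrite -subr_eq0; apply/eqP.
suff : mx1 (bidual_map y0 - xi) = 0.
  by move=> /(congr1 (fun x : Minf (dual D) => x 0%N 0%N)); rewrite mx1E.
apply: (mnorm0_eq0 smosDD); apply/eqP.
rewrite eq_le (mnorm_ge0 smosDD) andbT; apply/ler_addgt0Pr => e e0; rewrite add0r.
have e20 : 0 < e / 2 by rewrite divr_gt0.
have [_ [y _ <-] lt] := h _ e20.
have le0 : xnorm (y0 - y) <= e / 2.
  apply: (xnorm_functional_le smosX); first exact: ltW.
  move=> x.
  have -> : (y0 - y : functional X) x = (xi - bidual_map y : functional D) (bidual_map x).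
    by rewrite !fappD !fappN (bidual_mapE smosY) (bidual_mapE smosX).
  apply: le_trans (functional_le_xnorm smosD _ _) _.
  apply: ler_pM; rewrite ?(mnorm_ge0 smosDD) ?(mnorm_ge0 smosD)//; first exact: ltW.
  by rewrite /xnorm -amp_mx1 ?mnorm_bidual_le// bidual_map0.
have -> : mx1 (bidual_map y0 - xi) =
    mx1 (bidual_map (y0 - y)) - mx1 (xi - bidual_map y).
  apply: Minf_eq => i j; rewrite mxB !mx1E; case: ifP => _; rewrite ?subr0//.
  rewrite -[y0 - y]addrC -scaleN1r (bidual_map_linear smosY) scaleN1r.
  by rewrite opprB [- _ + bidual_map y0]addrC -addrA addKr.
apply: le_trans (mnormD smosDD _ _) _; rewrite (mnormN smosDD).
have := xnorm_bidual_dual (y0 - y); rewrite /xnorm in le0 lt * => ->.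
by move: le0 lt; lra.
Qed.

Lemma predual_mapE (F : D) (xi : subsp (A : set (dual D))) :
  (predual_map A F : functional (sub_mos A)) xi = (val xi : functional D) F.
Proof.
have h : (fun f : sub_mos A => (val (f : subsp A) : functional D) F) \in
    @is_functional R (sub_mos A).
  apply/asboolP; split; first by move=> a f g; rewrite valD_subsp valZ_subsp.
  exists (xnorm F) => f; rewrite mulrC; apply: le_trans (functional_le_xnorm smosD _ _) _.
  by rewrite xnorm_sub.
by rewrite -[LHS]/(val (insubd 0 _ : functional (sub_mos A)) xi) insubdK.
Qed.

Lemma predual_map_surj : set_surj setT setT (@predual_map R D A).
Proof.
move=> G _; pose inA (y : Y) : subsp (A : set (dual D)) := insubd 0 (bidual_map y).
have inAE y : val (inA y) = bidual_map y.
  by apply: insubd_subsp; [exact: canonical_predual_subspace|exists y].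
have inA_lin : linear inA.
  move=> a y z; apply: val_inj; rewrite valD_subsp valZ_subsp !inAE.
  exact: bidual_map_linear.
have h : (fun y : Y => (G : functional (sub_mos A)) (inA y)) \in @is_functional R Y.
  apply/asboolP; split=> [a y z|]; first by rewrite inA_lin functional_linear.
  have [K KP] := functional_bound (G : functional (sub_mos A)).
  exists K => y; apply: le_trans (KP _) _.
  have -> : xnorm (inA y : sub_mos A) = xnorm y.
    by rewrite xnorm_sub inAE xnorm_bidual_dual.
  by [].
exists (MkFunctional h) => //; apply: functional_eq => xi; rewrite predual_mapE.
have [y _ yE] := subsp_mem xi canonical_predual_subspace.
rewrite -yE (bidual_mapE smosY) /=; congr (fapp _ _).
by apply: val_inj; rewrite inAE.
Qed.

Lemma predual_map_isometry : complete_isometry (@predual_map R D A).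
Proof.
have p0 : predual_map A (0 : D) = 0.
  by apply: functional_eq => xi; rewrite predual_mapE fapp0.
split=> [a F G|F].
  apply: functional_eq => xi; rewrite predual_mapE functional_linear.
  by rewrite -!predual_mapE.
(* [inv] and [inA] are mutually inverse complete isometries between the predual and X^*; through
   them the two norms are suprema of the same set. *)
pose inv (xi : subsp (A : set (dual D))) : Y :=
  xget 0 [set y | bidual_map y = val xi].
have invE xi : bidual_map (inv xi) = val xi.
  have [y _ yE] := subsp_mem xi canonical_predual_subspace.
  by apply: (@xgetPex _ (0 : Y) [set y | bidual_map y = val xi]); exists y.
have inv0 : inv 0 = 0.
  by apply: bidual_map_inj; rewrite invE bidual_map0.
pose inA (y : Y) : subsp (A : set (dual D)) := insubd 0 (bidual_map y).
have inAE y : val (inA y) = bidual_map y.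
  by apply: insubd_subsp; [exact: canonical_predual_subspace|exists y].
have inA0 : inA 0 = 0.
  by apply: val_inj; rewrite inAE bidual_map0.
have thE (xi : Minf (subsp (A : set (dual D)))) :
    amp (theta (amp (predual_map A) F : Minf (functional (sub_mos A)))) xi =
    amp (theta (F : Minf (functional Y))) (amp inv xi).
  apply: Minf_eq => i j; apply: Minf_eq => k l.
  rewrite !amp_thetaE !thetaE (ampE F k l p0) predual_mapE (ampE xi i j inv0) -invE.
  exact: bidual_mapE.
have nE (xi : Minf (subsp (A : set (dual D)))) :
    mnorm (xi : Minf (sub_mos A)) = mnorm (amp inv xi : Minf Y).
  rewrite -(mnorm_bidual_dual (amp inv xi)).
  suff e : amp val xi = amp (@bidual_map R Y) (amp inv xi) by exact: (congr1 mnorm e).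
  by apply: Minf_eq => i j; rewrite amp_bidualE// !ampE// invE.
have invK y : inv (inA y) = y by apply: bidual_map_inj; rewrite invE inAE.
have xE y : amp inv (amp inA y) = y.
  by apply: Minf_eq => i j; rewrite !ampE// invK.
rewrite -[LHS]/(sup _) -[RHS]/(sup _); congr sup.
apply/seteqP; split=> _ [x x1 <-].
  exists (amp inv x); last by rewrite thE.
  have {}x1 : mnorm x <= 1 := x1.
  by rewrite nE in x1.
have {}x1 : mnorm x <= 1 := x1.
exists (amp inA x); last by rewrite thE xE.
suff : mnorm (amp inA x : Minf (sub_mos A)) <= 1 by [].
by rewrite nE xE.
Qed.

(** Each condition in [dual_coneP] involves only finitely many of the values [G i j y], and these
    are continuous in [G] for the topology at hand. *)
Lemma canonical_predual_cone_closed : closed (mcone : set (wstar_mx A)).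
Proof.
move=> F clF.
have gen i j y : weak_cont
    [set w | exists (f : dual D) i j,
      A f /\ w = fun x : Minf D => (f : functional D) (x i j)] F
    (fun G : Minf D => (G i j : functional Y) y).
  apply: weak_cont_gen; exists (bidual_map y), i, j; split; first by exists y.
  by apply/funext => G; rewrite (bidual_mapE smosY).
apply/(dual_coneP smosY); split.
  apply: Minf_eq => i j; apply: functional_eq => y.
  rewrite (dual_mstarE smosY) (dual_starE smosY); apply/eqP; rewrite -subr_eq0; apply/eqP.
  apply: (weak_closure_eq0 clF (g := fun G : Minf D =>
      ((G j i : functional Y) (star y) : C)^* - (G i j : functional Y) y)).
    apply: weak_contD; first exact/weak_cont_conj/gen.
    under [X in weak_cont _ _ X]eq_fun do rewrite -mulN1r.
    exact/weak_contZ/gen.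
  move=> G /(dual_coneP smosY)[sG _].
  by rewrite -{2}sG (dual_mstarE smosY) (dual_starE smosY) subrr.
move=> x v cx; set z := sandwich v x v.
have gz : weak_cont [set w | exists (f : dual D) i j,
      A f /\ w = fun x : Minf D => (f : functional D) (x i j)] F
      (fun G : Minf D => pair (G : Minf (functional Y)) z).
  under [X in weak_cont _ _ X]eq_fun do rewrite (pairE (or_intror (mdimP z))).
  by apply: weak_cont_sum => k; apply: weak_cont_sum => l; exact: gen.
apply: (@ge0_approx _ _ 1) => e e0.
have [G /(dual_coneP smosY)[_ Gp] lt] := weak_closure_approx clF gz e0.
exists (pair (G : Minf (functional Y)) z); first exact: Gp.
by rewrite -normcN opprB mulr1 ltW.
Qed.

Lemma canonical_predual_is_predual : is_predual (A : set (dual D)).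
Proof.
split; split.
- exact: canonical_predual_subspace.
- exact: canonical_predual_star.
- exact: canonical_predual_closed.
- exact: predual_map_surj.
- exact: predual_map_isometry.
- exact: canonical_predual_cone_closed.
Qed.

End CanonicalPredual.

(** * Extension of functionals from Paulsen's operator system *)

Section SublinearFunctionals.
Variables (R : realType) (V : lmodType R[i]).
Implicit Types (p q : V -> R) (x y : V).

Definition sublinear p : Prop :=
  (forall x y, p (x + y) <= p x + p y) /\
  (forall (t : R) x, 0 <= t -> p (t%:C%C *: x) = t * p x).

Lemma sublinear0 p : sublinear p -> p 0 = 0.
Proof. by move=> [_ h]; rewrite -(scale0r (0 : V)) -[0 in LHS]/(0%:C%C) h// mul0r. Qed.

Lemma sublinear_ge p x : sublinear p -> - p (- x) <= p x.
Proof. by move=> sp; have := sp.1 x (- x); rewrite subrr (sublinear0 sp); lra. Qed.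

(** Serves three times: for the perturbed functional in [minimal_sublinear], for the lower bound of
    a chain in [hahn_banach], and for the infimum over majorants in [psn_extension]. *)
Lemma sublinear_inf (S : V -> set R) :
  (forall x, S x !=set0) -> (forall x, has_lbound (S x)) ->
  (forall x y a b, S x a -> S y b -> exists2 c, S (x + y) c & c <= a + b) ->
  (forall t x a, 0 < t -> S x a -> exists2 c, S (t%:C%C *: x) c & c <= t * a) ->
  S 0 0 -> (forall a, S 0 a -> 0 <= a) -> sublinear (fun x => inf (S x)).
Proof.
move=> S0 Sb SD SZ S00 Sge0; split=> [x y|t x].
  rewrite -lerBlDr; apply: lb_le_inf => // a Sa.
  rewrite lerBlDr -lerBlDl; apply: lb_le_inf => // b Sb'.
  rewrite lerBlDl; have [c Sc] := SD x y a b Sa Sb'; apply: le_trans.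
  exact: ge_inf.
have le s y : 0 < s -> inf (S (s%:C%C *: y)) <= s * inf (S y).
  move=> s0; rewrite -ler_pdivrMl//; apply: lb_le_inf => // a Sa.
  rewrite ler_pdivrMl//; have [c Sc] := SZ s y a s0 Sa; apply: le_trans.
  exact: ge_inf.
rewrite le_eqVlt => /orP[/eqP <-|t0].
  rewrite -[0%:C%C]/(0 : R[i]) scale0r mul0r; apply/eqP; rewrite eq_le.
  by rewrite ge_inf// lb_le_inf.
apply/eqP; rewrite eq_le le//= -ler_pdivlMl//.
have := le t^-1 (t%:C%C *: x); rewrite scalerA -rmorphM mulVf ?gt_eqF//.
by rewrite scale1r; apply; rewrite invr_gt0.
Qed.

(** For fixed [y], the infimum over t >= 0 of q(x + t y) - t q(y) is sublinear in x and at most q,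
    hence equal to q. At x = - y the value for t = 1 yields q(- y) <= - q(y). *)
Lemma minimal_sublinear q : sublinear q ->
  (forall q', sublinear q' -> (forall x, q' x <= q x) -> q' = q) ->
  forall x, q (- x) = - q x.
Proof.
move=> sq qmin y.
pose S x := [set q (x + t%:C%C *: y) - t * q y | t in [set t : R | 0 <= t]].
have lb x : lbound (S x) (- q (- x)).
  move=> _ [t t0 <-]; rewrite -(sq.2 t y t0) lerBrDr.
  have := sq.1 (x + t%:C%C *: y) (- x); rewrite addrAC subrr add0r; lra.
have sS : sublinear (fun x => inf (S x)).
  apply: sublinear_inf.
  - by move=> x; exists (q (x + 0%:C%C *: y) - 0 * q y); exists 0 => //=.
  - by move=> x; exists (- q (- x)); exact: lb.
  - move=> x x' _ _ [t /= t0 <-] [t' /= t'0 <-].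
    exists (q (x + x' + (t + t')%:C%C *: y) - (t + t') * q y).
      by exists (t + t') => //=; rewrite addr_ge0.
    rewrite rmorphD scalerDl addrACA.
    have := sq.1 (x + t%:C%C *: y) (x' + t'%:C%C *: y); lra.
  - move=> s x _ s0 [t /= t0 <-].
    exists (q (s%:C%C *: x + (s * t)%:C%C *: y) - (s * t) * q y).
      by exists (s * t) => //=; rewrite mulr_ge0// ltW.
    have -> : (s * t)%:C%C *: y = s%:C%C *: (t%:C%C *: y) by rewrite scalerA -rmorphM.
    by rewrite -scalerDr (sq.2 s) ?(ltW s0)// mulrBr mulrA.
  - exists 0 => //=; rewrite -[0%:C%C]/(0 : R[i]).
    by rewrite scale0r add0r (sublinear0 sq) mul0r subr0.
  - by move=> _ [t /= t0 <-]; rewrite add0r sq.2// subrr.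
have qS : (fun x => inf (S x)) = q.
  apply: qmin => // x; apply: ge_inf; first by exists (- q (- x)); exact: lb.
  by exists 0 => //=; rewrite -[0%:C%C]/(0 : R[i]) scale0r addr0 mul0r subr0.
apply/eqP; rewrite eq_le; apply/andP; split; last first.
  by have := sublinear_ge y sq; lra.
rewrite -[in leLHS]qS; apply: ge_inf; first by exists (- q (- - y)); exact: lb.
by exists 1 => //=; rewrite scale1r addNr (sublinear0 sq) mul1r sub0r.
Qed.

Theorem hahn_banach p : sublinear p -> exists m : V -> R,
  [/\ forall x y, m (x + y) = m x + m y,
      forall (t : R) x, m (t%:C%C *: x) = t * m x & forall x, m x <= p x].
Proof.
move=> sp; pose T := {q | sublinear q /\ forall x, q x <= p x}.
(* The order is reversed, so that a maximal element is a minimal sublinear functional and a chain is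
   bounded by its pointwise infimum. *)
pose Rel (q1 q2 : T) := `[< forall x, sval q2 x <= sval q1 x >].
have [||||[q [sq qp]] qmax] := @Zorn T Rel.
- by move=> q; apply/asboolP.
- move=> q1 q2 q3 /asboolP h12 /asboolP h23; apply/asboolP => x.
  exact: le_trans (h12 x).
- move=> [q1 q1P] [q2 q2P] /asboolP /= h12 /asboolP /= h21.
  by apply/eq_exist/funext => x; apply/eqP; rewrite eq_le h12 h21.
- move=> A totA; have [[q0 Aq0]|A0] := pselect (exists q : T, A q); last first.
    exists (exist _ p (conj sp (fun x => lexx (p x)))) => q Aq.
    by case: A0; exists q.
  pose S x := [set sval q x | q in A].
  have lb x : lbound (S x) (- p (- x)).
    move=> _ [[q [sq qp]] _ <-] /=; apply: le_trans (sublinear_ge x sq).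
    by rewrite lerN2.
  have Sb x : has_lbound (S x) by exists (- p (- x)); exact: lb.
  have sS : sublinear (fun x => inf (S x)).
    apply: sublinear_inf => //.
    - by move=> x; exists (sval q0 x); exists q0.
    - move=> x y _ _ [q1 Aq1 <-] [q2 Aq2 <-].
      have [/asboolP h|/asboolP h] := totA _ _ Aq1 Aq2.
        exists (sval q2 (x + y)); first by exists q2.
        by case: q2 {Aq2} h => q2 [[s2 _] _] /= h; rewrite (le_trans (s2 _ _))// lerD2r.
      exists (sval q1 (x + y)); first by exists q1.
      by case: q1 {Aq1} h => q1 [[s1 _] _] /= h; rewrite (le_trans (s1 _ _))// lerD2l.
    - move=> t x _ t0 [q Aq <-]; exists (sval q (t%:C%C *: x)); first by exists q.
      by case: q {Aq} => q [[q1 q2] q3] /=; rewrite q2// ltW.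
    - by exists q0 => //; case: q0 {Aq0} => q [sq _] /=; exact: sublinear0.
    - by move=> _ [[q [sq _]] _ <-] /=; rewrite sublinear0.
  have Sp x : inf (S x) <= p x.
    apply: (@le_trans _ _ (sval q0 x)); last by case: q0 {Aq0} => q [_ +] /=.
    by apply: ge_inf => //; exists q0.
  exists (exist _ (fun x => inf (S x)) (conj sS Sp)) => q Aq.
  by apply/asboolP => x /=; apply: ge_inf => //; exists q.
have oddq : forall x, q (- x) = - q x.
  apply: minimal_sublinear => // q' sq' q'q.
  have q'p x : q' x <= p x by apply: le_trans (q'q x) _.
  have := qmax (exist _ q' (conj sq' q'p)).
  by move=> /(_ (asboolT q'q))/(congr1 sval).
exists q; split=> // [x y|t x].
  apply/eqP; rewrite eq_le sq.1 /=.
  have := sq.1 (x + y) (- y); rewrite addrK oddq; lra.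
have [t0|t0] := leP 0 t; first by rewrite sq.2.
rewrite -[t]opprK rmorphN scaleNr oddq sq.2; last by rewrite oppr_ge0 ltW.
by rewrite [RHS]mulNr.
Qed.

End SublinearFunctionals.

(** * Invertible square roots of positive definite scalar matrices *)

Section SquareRoots.
Variable R : realType.
Local Notation C := R[i].

Lemma mmulA (a b c : Minf C^o) : mmul (mmul a b) c = mmul a (mmul b c).
Proof.
have [n [na nb nc]] := mbnd_common3 a b c.
apply: Minf_eq => i j; rewrite (@mmulE _ n); last by left.
rewrite [RHS](@mmulE _ n); last by right.
under eq_bigr => k _ do rewrite (@mmulE _ n _ _ _ _ (or_introl nb)) mulr_suml.
rewrite exchange_big; apply: eq_bigr => l _ /=.
rewrite (@mmulE _ n); last by left.
by rewrite mulr_sumr; apply: eq_bigr => k _; rewrite mulrA.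
Qed.

Lemma mtr_mmul (a b : Minf C^o) : mtr (mmul a b) = mmul (mtr b) (mtr a).
Proof.
have [n [na nb]] := mbnd_common a b.
apply: Minf_eq => i j; rewrite mtrE !(@mmulE _ n); last 2 first.
- by left; exact: mbnd_mtr.
- by left.
by apply: eq_bigr => k _; rewrite !mtrE mulrC.
Qed.

Definition mone n : Minf C^o :=
  mxinf (fun i j => if (i == j) && (i < n)%N then 1 else 0).

Lemma mbnd_mone_aux n :
  mbnd n (fun i j => if (i == j) && (i < n)%N then 1 else 0 : C^o).
Proof. by move=> i j; case: eqP => [<-|//]; rewrite andbb => /negbTE ->. Qed.

Lemma moneE n i j : mone n i j = if (i == j) && (i < n)%N then 1 else 0.
Proof. exact: (mxinfE (@mbnd_mone_aux n)). Qed.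

Lemma mbnd_mone n : mbnd n (mone n).
Proof. by move=> i j ij; rewrite moneE mbnd_mone_aux. Qed.

Lemma mtr_mone n : mtr (mone n) = mone n.
Proof.
apply: Minf_eq => i j; rewrite mtrE !moneE [j == i]eq_sym.
by case: eqP => // ->.
Qed.

Lemma hs2_mmul_mone n v : hs2 (mmul v (mone n)) <= hs2 v.
Proof.
pose m := maxn n (mdim v).
have mv : mbnd m v by apply: mbnd_le (mdimP v); rewrite leq_maxr.
have m1 : mbnd m (mone n) by apply: mbnd_le (@mbnd_mone n); rewrite leq_maxl.
rewrite (hs2E (mbnd_mmul mv m1)) (hs2E mv).
apply: ler_sum => i _; apply: ler_sum => j _.
rewrite (@mmulE _ m); last by left.
rewrite (bigD1 j)//= big1 ?addr0 => [|k kj]; last first.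
  by rewrite moneE -[_ == j :> nat]/(k == j) (negbTE kj) mulr0.
rewrite moneE eqxx /=; case: ifP => _; first by rewrite mulr1.
by rewrite mulr0 ComplexField.Normc.normc0 expr0n sqr_ge0.
Qed.

Lemma sandwich_mone (V : lmodType C) n (x : Minf V) : mbnd n x ->
  sandwich (mone n) x (mone n) = x.
Proof.
move=> nx; apply: Minf_eq => i j; rewrite (sandwichE _ _ _ _ nx).
have [/andP[ilt jlt]|ij] := boolP ((i < n)%N && (j < n)%N); last first.
  rewrite nx//; apply: big1 => k _; apply: big1 => l _; rewrite !moneE.
  case: eqP => [ki|_]; last by rewrite conjC0 mul0r scale0r.
  case: eqP => [lj|_]; last by rewrite mulr0 scale0r.
  by move: ij; rewrite -ki -lj !ltn_ord.
rewrite (bigD1 (Ordinal ilt))//= (bigD1 (Ordinal jlt))//= !moneE !eqxx ilt jlt /=.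
rewrite conjC1 mulr1 scale1r big1 ?addr0 => [|l lj]; last first.
  by rewrite moneE -[_ == j]/(l == Ordinal jlt) (negbTE lj) mulr0 scale0r.
rewrite big1 ?addr0// => k ki; apply: big1 => l _.
by rewrite moneE -[_ == i]/(k == Ordinal ilt) (negbTE ki) conjC0 mul0r scale0r.
Qed.

Definition mx_Minf n (M : 'M[C]_n) : Minf C^o :=
  mxinf (fun i j => if (insub i, insub j) is (Some a, Some b) then M a b else 0).

Lemma mbnd_mx_Minf_aux n (M : 'M[C]_n) :
  mbnd n (fun i j => if (insub i, insub j) is (Some a, Some b) then M a b else 0 : C^o).
Proof. by move=> i j; case: insubP => // a -> _; case: insubP => // b ->. Qed.

Lemma mbnd_mx_Minf n (M : 'M[C]_n) : mbnd n (mx_Minf M).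
Proof.
move=> i j ij; rewrite /mx_Minf (mxinfE (mbnd_mx_Minf_aux M)).
exact: (mbnd_mx_Minf_aux M ij).
Qed.

Lemma mx_MinfE n (M : 'M[C]_n) (i j : 'I_n) : mx_Minf M i j = M i j.
Proof. by rewrite /mx_Minf (mxinfE (mbnd_mx_Minf_aux M)) !valK. Qed.

Lemma mx_Minf_mul n (M N : 'M[C]_n) : mmul (mx_Minf M) (mx_Minf N) = mx_Minf (M *m N).
Proof.
apply: Minf_eq => p q; have [/andP[plt qlt]|pq] := boolP ((p < n)%N && (q < n)%N).
  rewrite -[p]/(val (Ordinal plt)) -[q]/(val (Ordinal qlt)) mx_MinfE mxE.
  rewrite (@mmulE _ n); last by left; exact: mbnd_mx_Minf.
  by apply: eq_bigr => k _; rewrite !mx_MinfE.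
rewrite (mbnd_mmul _ _ pq) ?(mbnd_mx_Minf _ pq)//; exact: mbnd_mx_Minf.
Qed.

Lemma mx_Minf1 n : mx_Minf (1%:M : 'M[C]_n) = mone n.
Proof.
apply: Minf_eq => p q; have [/andP[plt qlt]|pq] := boolP ((p < n)%N && (q < n)%N).
  rewrite -[p]/(val (Ordinal plt)) -[q]/(val (Ordinal qlt)) mx_MinfE mxE moneE.
  by rewrite -val_eqE ltn_ord andbT /=; case: eqP.
by rewrite (mbnd_mx_Minf _ pq) mbnd_mone.
Qed.

(** Diagonalize the matrix as U^* D U and take W = D^(1/2) U. The lower bound [d] keeps the
    eigenvalues away from 0 and thus makes W invertible. *)
Lemma hermitian_sqrt n (a : nat -> nat -> C) (d : R) : 0 < d ->
  (forall i j : 'I_n, a j i = (a i j)^*) ->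
  (forall c : 'I_n -> C, d * \sum_i normc (c i) ^+ 2 <=
     Re (\sum_(i < n) \sum_(j < n) a i j * c j * (c i)^*)) ->
  exists W Wi : Minf C^o, [/\ mbnd n W, mbnd n Wi,
    mmul W Wi = mone n, mmul Wi W = mone n &
    forall i j : 'I_n, gram W i j = a i j].
Proof.
move=> d0 aH apos; pose A : 'M[C]_n := \matrix_(i, j) a i j.
have AH : A \is hermsymmx.
  apply/is_hermitianmxP; rewrite expr0 scale1r; apply/matrixP => i j.
  by rewrite !mxE.
have /hermitian_normalmx/orthomx_spectralP AE := AH.
set U := spectralmx A in AE; set D := spectral_diag A in AE.
have Uu : U \is unitarymx by exact: spectral_unitarymx.
have UU : U *m (map_mx Num.conj U^T) = 1%:M by exact/unitarymxP.
rewrite (invmx_unitary Uu) in AE.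
have Uunit : U \in unitmx by exact: unitarymx_unit.
have UU' : (map_mx Num.conj U^T) *m U = 1%:M.
  by rewrite -(invmx_unitary Uu) mulVmx.
have DE i : D 0 i = \sum_(k < n) \sum_(l < n) a k l * (U i l)^* * ((U i k)^*)^*.
  have : diag_mx D = U *m A *m (map_mx Num.conj U^T).
    by rewrite {1}AE !mulmxA UU mul1mx -mulmxA UU mulmx1.
  move=> /matrixP/(_ i i); rewrite !mxE eqxx mulr1n => ->.
  rewrite exchange_big; apply: eq_bigr => l _ /=; rewrite !mxE mulr_suml.
  apply: eq_bigr => k _; rewrite !mxE conjCK; ring.
have Ui i : \sum_(k < n) normc ((U i k)^*) ^+ 2 = 1.
  have /matrixP/(_ i i) := UU; rewrite !mxE eqxx.
  under eq_bigr => k _ do rewrite !mxE sqr_normc_mulc -normc_conj.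
  by rewrite -rmorph_sum => /(congr1 (@complex.Re R)).
have Dreal i : D 0 i = (Re (D 0 i))%:C%C.
  have /mxOverP/(_ 0 i) := hermitian_spectral_diag_real AH.
  by move=> /RRe_real ->.
have Dpos i : 0 < Re (D 0 i).
  apply: (lt_le_trans d0); rewrite DE.
  by have := apos (fun k => (U i k)^*); rewrite Ui mulr1.
pose r i : R := Num.sqrt (Re (D 0 i)).
have r0 i : r i != 0 by rewrite gt_eqF// sqrtr_gt0.
pose W : 'M[C]_n := diag_mx (\row_i (r i)%:C%C) *m U.
pose Wi : 'M[C]_n := (map_mx Num.conj U^T) *m diag_mx (\row_i ((r i)^-1)%:C%C).
exists (mx_Minf W), (mx_Minf Wi).
have WWi : W *m Wi = 1%:M.
  rewrite /W /Wi mulmxA -[_ *m U *m _]mulmxA UU mulmx1 mulmx_diag.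
  apply/matrixP => i j; rewrite !mxE; case: eqP => // -> /=.
  by rewrite -rmorphM mulfV.
have WiW : Wi *m W = 1%:M by exact: mulmx1C.
split; try exact: mbnd_mx_Minf.
- by rewrite mx_Minf_mul WWi mx_Minf1.
- by rewrite mx_Minf_mul WiW mx_Minf1.
move=> i j; rewrite (gramE _ _ (mbnd_mx_Minf W)).
have -> : a i j = A i j by rewrite mxE.
rewrite AE mxE; apply: eq_bigr => k _; rewrite !mx_MinfE.
rewrite /W mul_diag_mx mul_mx_diag !mxE Dreal rmorphM /=.
have -> : ((r k)%:C%C)^* = (r k)%:C%C :> C by rewrite conj_Creal// complex_real.
have -> : (Re (D 0 k))%:C%C = (r k)%:C%C * (r k)%:C%C :> C.
  by rewrite -rmorphM -expr2 sqr_sqrtr// ltW.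
ring.
Qed.

End SquareRoots.

Section LinearMaps.
Variables (R : realType) (U V : lmodType R[i]) (g : U -> V).
Hypothesis gl : linear g.

Lemma lin_0 : g 0 = 0.
Proof.
apply: (addrI (g 0)); rewrite addr0; have := gl 1 0 0.
by rewrite !scale1r addr0 => <-.
Qed.

Lemma lin_D x y : g (x + y) = g x + g y.
Proof. by have := gl 1 x y; rewrite !scale1r. Qed.

Lemma lin_Z c x : g (c *: x) = c *: g x.
Proof. by have := gl c x 0; rewrite !addr0 lin_0 addr0. Qed.

Lemma lin_sum (I : Type) (s : seq I) (P : pred I) (F : I -> U) :
  g (\sum_(i <- s | P i) F i) = \sum_(i <- s | P i) g (F i).
Proof. by apply: (big_morph g); [exact: lin_D|exact: lin_0]. Qed.

End LinearMaps.

Lemma conj_real (R : realType) (r : R) : (r%:C%C)^* = r%:C%C :> R[i].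
Proof. by rewrite conj_Creal// complex_real. Qed.

Lemma cRe_mul2 (R : realType) (z : R[i]) : Re (2 * z) = 2 * Re z.
Proof. by rewrite !mulr_natl !mulr2n cReD. Qed.

Lemma ip_sum2 (R : realType) (E : lmodType R[i]) (ip : E -> E -> R[i])
    (I J : Type) (s : seq I) (r : seq J) (F : I -> E) (G : J -> E) :
  semi_inner ip ->
  ip (\sum_(i <- s) F i) (\sum_(j <- r) G j) =
  \sum_(i <- s) \sum_(j <- r) ip (F i) (G j).
Proof.
by move=> ipP; rewrite (ip_suml ipP); apply: eq_bigr => i _; rewrite (ip_sumr ipP).
Qed.

Lemma exchange_big4 (V : nmodType) m n (F : 'I_n -> 'I_n -> 'I_m -> 'I_m -> V) :
  \sum_r \sum_s \sum_i \sum_j F r s i j = \sum_i \sum_j \sum_s \sum_r F r s i j.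
Proof.
transitivity (\sum_r \sum_i \sum_s \sum_j F r s i j).
  by apply: eq_bigr => r _; exact: exchange_big.
rewrite exchange_big; apply: eq_bigr => i _ /=.
transitivity (\sum_r \sum_j \sum_s F r s i j).
  by apply: eq_bigr => r _; exact: exchange_big.
by rewrite exchange_big; apply: eq_bigr => j _; exact: exchange_big.
Qed.

(** * Perturbed hermitian parts of scalar matrices, acting on vectors of H *)

Section HermitianPart.
Variables (R : realType) (H : hilbert R).
Local Notation C := R[i].
Let ipP := semi_inner_hilbert H.
Variable d : R.

(** The blocks to which this is applied need not be hermitian, as only the real part of a form is
    known to be positive; the summand [d] makes the hermitian part positive definite. *)
Definition hpart (a : nat -> nat -> C) i j : C :=
  (2^-1)%:C%C * (a i j + (a j i)^*) + if i == j then d%:C%C else 0.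

Lemma hpartC (a : nat -> nat -> C) i j : hpart a j i = (hpart a i j)^*.
Proof.
rewrite /hpart rmorphD rmorphM rmorphD /= conjCK conj_real [a j i + _]addrC.
by rewrite eq_sym; case: ifP => _; rewrite ?conj_real ?conjC0.
Qed.

Lemma Re_hpart_diag (a : nat -> nat -> C) i : Re (hpart a i i) = Re (a i i) + d.
Proof. by rewrite /hpart eqxx cReD cRe_realM cReD cRe_conj /=; lra. Qed.

Lemma hpart_form n (a : nat -> nat -> C) (xi : nat -> H) :
  Re (\sum_(i < n) \sum_(j < n) inner H (hpart a i j *: xi j) (xi i)) =
  Re (\sum_(i < n) \sum_(j < n) inner H (a i j *: xi j) (xi i)) +
  d * \sum_(i < n) sqn (inner H) (xi i).
Proof.
have -> : \sum_(i < n) \sum_(j < n) inner H (hpart a i j *: xi j) (xi i) =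
    (2^-1)%:C%C * (\sum_(i < n) \sum_(j < n) inner H (a i j *: xi j) (xi i) +
    (\sum_(i < n) \sum_(j < n) inner H (a i j *: xi j) (xi i))^*) +
    d%:C%C * \sum_(i < n) inner H (xi i) (xi i).
  have -> : (\sum_(i < n) \sum_(j < n) inner H (a i j *: xi j) (xi i))^* =
      \sum_(i < n) \sum_(j < n) (inner H (a j i *: xi i) (xi j))^*.
    rewrite exchange_big rmorph_sum; apply: eq_bigr => i _ /=.
    by rewrite rmorph_sum; apply: eq_bigr.
  rewrite -big_split /= !mulr_sumr -big_split; apply: eq_bigr => i _ /=.
  have -> : d%:C%C * inner H (xi i) (xi i) =
      \sum_(j < n) (if i == j then d%:C%C else 0) * inner H (xi j) (xi i).
    by rewrite (bigD1 i)//= eqxx big1 ?addr0// => j; rewrite eq_sym => /negbTE ->; rewrite mul0r.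
  rewrite -big_split /= mulr_sumr -big_split; apply: eq_bigr => j _ /=.
  rewrite !(ipZl ipP) rmorphM /= -(ipC ipP) /hpart mulrDl; congr (_ + _).
  by rewrite -mulrDl mulrA.
have <- : Re (\sum_(i < n) inner H (xi i) (xi i)) = \sum_(i < n) sqn (inner H) (xi i).
  exact: cRe_sum.
by rewrite cReD !cRe_realM cReD cRe_conj; lra.
Qed.

(** Scalar vectors c are tested as the vectors with entries [c i *: e0]; this is the purpose of the
    unit vector [e0]. *)
Lemma hpart_pos n (a : nat -> nat -> C) (e0 : H) : inner H e0 e0 = 1 ->
  (forall xi : nat -> H,
     0 <= Re (\sum_(i < n) \sum_(j < n) inner H (a i j *: xi j) (xi i))) ->
  forall c : 'I_n -> C, d * \sum_i normc (c i) ^+ 2 <=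
    Re (\sum_(i < n) \sum_(j < n) hpart a i j * c j * (c i)^*).
Proof.
move=> e0_unit apos c; pose c' (i : nat) : C := if insub i is Some k then c k else 0.
have c'E (i : 'I_n) : c' i = c i by rewrite /c' valK.
have := hpart_form n a (fun i => c' i *: e0).
have -> : \sum_(i < n) \sum_(j < n) inner H (hpart a i j *: (c' j *: e0)) (c' i *: e0) =
   \sum_(i < n) \sum_(j < n) hpart a i j * c j * (c i)^*.
  apply: eq_bigr => i _; apply: eq_bigr => j _.
  by rewrite !(ipZl ipP) (ipZr ipP) e0_unit !c'E mulr1 mulrA.
move=> ->; have -> : \sum_(i < n) sqn (inner H) (c' i *: e0) = \sum_i normc (c i) ^+ 2.
  by apply: eq_bigr => i _; rewrite (sqnZ ipP) c'E /sqn e0_unit mulr1.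
by rewrite lerDr; exact: (apos (fun i => c' i *: e0)).
Qed.

(** The squared Hilbert-Schmidt norm is the trace of W^* W; this ties the estimates for [f] to the
    trace in [psn_fun]. *)
Lemma hs2_hpart n (W : Minf C^o) (a : nat -> nat -> C) : mbnd n W ->
  (forall i j : 'I_n, gram W i j = hpart a i j) ->
  hs2 W = \sum_(i < n) Re (a i i) + n%:R * d.
Proof.
move=> nW gW; rewrite (hs2E nW) exchange_big.
have -> : n%:R * d = \sum_(i < n) d by rewrite sumr_const card_ord mulr_natl.
rewrite -big_split; apply: eq_bigr => i _ /=.
rewrite -Re_hpart_diag -gW (gramE _ _ nW) cRe_sum; apply: eq_bigr => r _.
by rewrite mulrC sqr_normc_mulc.
Qed.

Lemma gram_vec m (W : Minf C^o) (a : nat -> nat -> C) (xi : nat -> H) :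
  mbnd m W -> (forall i j : 'I_m, gram W i j = a i j) ->
  \sum_(i < m) \sum_(j < m) inner H (a i j *: xi j) (xi i) =
  (\sum_(r < m) sqn (inner H) (\sum_(j < m) W r j *: xi j))%:C%C.
Proof.
move=> mW Wa; rewrite rmorph_sum /=.
transitivity (\sum_(r < m) \sum_(j < m) \sum_(i < m) inner H (W r j *: xi j) (W r i *: xi i)).
  rewrite [LHS]exchange_big [RHS]exchange_big; apply: eq_bigr => j _ /=.
  rewrite [RHS]exchange_big; apply: eq_bigr => i _ /=.
  rewrite -Wa (gramE _ _ mW) (ipZl ipP) mulr_suml; apply: eq_bigr => r _.
  rewrite (ipZl ipP) (ipZr ipP); ring.
by apply: eq_bigr => r _; rewrite -(ip_sqn ipP) (ip_sum2 _ _ _ _ ipP).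
Qed.

Lemma cancel_vec n (W Wi : Minf C^o) (u : nat -> H) (r : 'I_n) :
  mbnd n W -> mbnd n Wi -> mmul W Wi = mone R n ->
  \sum_(j < n) W r j *: (\sum_(s < n) Wi j s *: u s) = u r.
Proof.
move=> nW nWi WWi.
have -> : \sum_(j < n) W r j *: (\sum_(s < n) Wi j s *: u s) =
    \sum_(s < n) (mmul W Wi r s : C) *: u s.
  transitivity (\sum_(j < n) \sum_(s < n) (W r j * Wi j s) *: u s).
    apply: eq_bigr => j _; rewrite scaler_sumr; apply: eq_bigr => s _.
    by rewrite scalerA.
  rewrite exchange_big; apply: eq_bigr => s _ /=.
  by rewrite -scaler_suml (@mmulE _ n); last by left.
rewrite WWi (bigD1 r)//= moneE eqxx ltn_ord scale1r big1 ?addr0// => s sr.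
by rewrite moneE -[_ == s :> nat]/(r == s) eq_sym (negbTE sr) scale0r.
Qed.

End HermitianPart.

(** * Extension from Paulsen's operator system and the positive matrix it yields *)

Section PaulsenExtension.
Variables (R : realType) (X : mos_data R) (H : hilbert R).
Local Notation C := R[i].
Variable rho : X -> lop H.
Hypothesis smosX : is_smos X.
Hypothesis rho_lin : linear rho.
Hypothesis rho_star : forall (x : X) (u v : H),
  inner H ((rho x : bounded_op H) u) v = inner H u ((rho (star x) : bounded_op H) v).

Let op (x : X) : H -> H := (rho x : bounded_op H).
Let ipP := semi_inner_hilbert H.

Lemma bounded_op_linear (T : bounded_op H) : linear T.
Proof. by case: T => T /= /asboolP[]. Qed.

Lemma bounded_op_bound (T : bounded_op H) :
  exists2 M : R, 0 <= M & forall u w, normc (inner H (T u) w) <=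
     M * (Num.sqrt (sqn (inner H) u) * Num.sqrt (sqn (inner H) w)).
Proof.
have [K KP] : exists K : R, forall u, `|T u| <= K%:C%C * `|u|.
  by case: T => T /= /asboolP[].
have nE (u : H) : `|u| = (Num.sqrt (sqn (inner H) u))%:C%C.
  have : (`|u| : C) ^+ 2 = (sqn (inner H) u)%:C%C.
    by rewrite -(ip_sqn ipP); case: H u => h ip ipE u /=.
  move=> E; have u0 : 0 <= `|u| by exact: normr_ge0.
  rewrite (ge0_complexE u0) in E *; congr (_%:C)%C.
  have : (Re `|u|) ^+ 2 = sqn (inner H) u.
    by apply: complexI; rewrite rmorphXn.
  by move=> <-; rewrite sqrtr_sqr ger0_norm// ge0_Re.
exists `|K| => // u w; apply: le_trans (cauchy_schwarz ipP _ _) _.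
rewrite mulrA ler_wpM2r ?sqrtr_ge0//.
have := KP u; rewrite !nE -rmorphM lecR => /le_trans; apply.
by rewrite ler_wpM2r ?sqrtr_ge0// ler_norm.
Qed.

Lemma op_sumx (I : Type) (s : seq I) (P : pred I) (F : I -> X) u :
  op (\sum_(i <- s | P i) F i) u = \sum_(i <- s | P i) op (F i) u.
Proof. by apply: (big_morph (op^~ u)) => [x y|]; rewrite /op ?lin_D ?lin_0. Qed.

Lemma opD (x y : X) u : op (x + y) u = op x u + op y u.
Proof. by rewrite /op (lin_D rho_lin). Qed.

Lemma opZ (c : C) (x : X) u : op (c *: x) u = c *: op x u.
Proof. by rewrite /op (lin_Z rho_lin). Qed.

Lemma op0 u : op 0 u = 0.
Proof. by rewrite /op (lin_0 rho_lin). Qed.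

Lemma op_lin (x : X) : linear (op x).
Proof. exact: bounded_op_linear. Qed.

Lemma amp_rhoE (k : Minf X) i j : amp rho k i j = rho (k i j).
Proof. by apply: ampE; exact: lin_0. Qed.

Definition op_form (n : nat) (k : nat -> nat -> X) (h h' : nat -> H) : C :=
  \sum_(i < n) \sum_(j < n) inner H (op (k i j) (h j)) (h' i).

Definition vsqn (n : nat) (h : nat -> H) : R := \sum_(i < n) sqn (inner H) (h i).

Lemma vsqn_ge0 n h : 0 <= vsqn n h.
Proof. by apply: sumr_ge0 => i _; exact: sqn_ge0. Qed.

Lemma op_supp n (k : Minf X) : mbnd n k ->
  opmx_supp (iota 0 n) (fun i j => amp rho k i j : H -> H).
Proof.
move=> nk; split=> [|p q u pq|p q c u|p q u v]; rewrite ?iota_uniq ?amp_rhoE//.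
- have -> : k p q = 0.
    by apply: nk; rewrite negb_and; rewrite !mem_iota !add0n /= in pq.
  by rewrite (lin_0 rho_lin).
- exact: (lin_Z (@op_lin (k p q))).
- exact: (lin_D (@op_lin (k p q))).
Qed.

Lemma op_form_opmx n (k : Minf X) h h' :
  opmx_form (inner H) (iota 0 n) (fun i j => amp rho k i j : H -> H) h h' =
  op_form n k h h'.
Proof.
rewrite /opmx_form sum_iota; apply: eq_bigr => i _; rewrite sum_iota.
by apply: eq_bigr => j _; rewrite amp_rhoE.
Qed.

Lemma vsqn_fam n h : fam_sqn (inner H) (iota 0 n) h = vsqn n h.
Proof. by rewrite /fam_sqn sum_iota. Qed.

Lemma mnorm_op_le n (k : Minf X) t : mbnd n k -> 0 <= t ->
  (forall h h', normc (op_form n k h h') <=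
     t * (Num.sqrt (vsqn n h) * Num.sqrt (vsqn n h'))) ->
  mnorm (amp rho k) <= t.
Proof.
move=> nk t0 ht; apply: (opmx_norm_le ipP (op_supp nk) t0) => h h'.
by rewrite op_form_opmx !vsqn_fam.
Qed.

Lemma op_bounded n (k : Minf X) : exists2 t, 0 <= t & forall h h',
  normc (opmx_form (inner H) (iota 0 n) (fun i j => amp rho k i j : H -> H) h h') <=
  t * (Num.sqrt (fam_sqn (inner H) (iota 0 n) h) *
       Num.sqrt (fam_sqn (inner H) (iota 0 n) h')).
Proof.
by apply: opmx_bounded => // p q; exact: bounded_op_bound.
Qed.

Lemma op_form_le n (k : Minf X) h h' : mbnd n k ->
  normc (op_form n k h h') <=
  mnorm (amp rho k) * (Num.sqrt (vsqn n h) * Num.sqrt (vsqn n h')).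
Proof.
move=> nk; have [t t0 ht] := op_bounded n k.
have := opmx_norm_form ipP (op_supp nk) t0 ht h h'.
by rewrite op_form_opmx !vsqn_fam.
Qed.

Lemma mnorm_op_ge0 (k : Minf X) : 0 <= mnorm (amp rho k).
Proof.
have [t t0 ht] := op_bounded (mdim k) k.
exact: (opmx_norm_ge0 ipP (op_supp (mdimP k)) t0 ht).
Qed.

Lemma op_form_pos n (k : Minf X) h : mbnd n k -> mcone (amp rho k) ->
  0 <= op_form n k h h.
Proof.
by move=> nk /(opmx_posP ipP (op_supp nk)) => /(_ h); rewrite op_form_opmx.
Qed.

Lemma op_form_sandwich m n (x : Minf X) (a b : Minf C^o) h h' : mbnd m x ->
  op_form n (sandwich a x b) h h' =
  op_form m x (fun j => \sum_(s < n) b j s *: h s)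
              (fun i => \sum_(r < n) a i r *: h' r).
Proof.
move=> mx; transitivity (\sum_(r < n) \sum_(s < n) \sum_(i < m) \sum_(j < m)
   ((a i r : C)^* * b j s * inner H (op (x i j) (h s)) (h' r))).
  apply: eq_bigr => r _; apply: eq_bigr => s _.
  rewrite (sandwichE _ _ _ _ mx) op_sumx (ip_suml ipP); apply: eq_bigr => i _.
  rewrite op_sumx (ip_suml ipP); apply: eq_bigr => j _.
  by rewrite opZ (ipZl ipP).
rewrite exchange_big4; apply: eq_bigr => i _; apply: eq_bigr => j _.
rewrite (lin_sum (@op_lin (x i j))) (ip_sum2 _ _ _ _ ipP).
apply: eq_bigr => s _; apply: eq_bigr => r _.
rewrite (lin_Z (@op_lin (x i j))) (ipZl ipP) (ipZr ipP); ring.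
Qed.

Lemma op_formZ n (k : nat -> nat -> X) (s t : C) h h' :
  op_form n k (fun j => s *: h j) (fun i => t *: h' i) = s * t^* * op_form n k h h'.
Proof.
rewrite /op_form mulr_sumr; apply: eq_bigr => i _; rewrite mulr_sumr.
apply: eq_bigr => j _.
by rewrite (lin_Z (@op_lin (k i j))) (ipZl ipP) (ipZr ipP) mulrA.
Qed.

Lemma vsqnZ n (s : C) h : vsqn n (fun i => s *: h i) = normc s ^+ 2 * vsqn n h.
Proof. by rewrite /vsqn mulr_sumr; apply: eq_bigr => i _; rewrite (sqnZ ipP). Qed.

(* [X + C 1], acting on [H] *)
Local Notation X1 := (X * C^o)%type.
Let op1 (y : X1) (u : H) : H := op y.1 u + y.2 *: u.
Local Notation V := (nat -> nat -> X1).

(** Order on [V] is measured by this form alone: it sees only the upper left N x N corner, and does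
    not separate elements of X + C 1 that act alike on H. *)
Definition psn_form (N : nat) (y : V) (h : nat -> H) : C :=
  \sum_(p < N) \sum_(q < N) inner H (op1 (y p q) (h q)) (h p).

Lemma psn_form_lin N c (y z : V) h :
  psn_form N (c *: y + z) h = c * psn_form N y h + psn_form N z h.
Proof.
rewrite /psn_form mulr_sumr -big_split; apply: eq_bigr => p _.
rewrite mulr_sumr -big_split; apply: eq_bigr => q _ /=.
rewrite -(ipZl ipP) -(ipDl ipP); congr (inner H _ _).
rewrite /op1 !fctE /= opD opZ scalerDr scalerDl scalerA addrACA.
by [].
Qed.

Lemma psn_formD N (y z : V) h : psn_form N (y + z) h = psn_form N y h + psn_form N z h.
Proof. by rewrite -[y]scale1r psn_form_lin scale1r mul1r. Qed.

Lemma psn_form0 N h : psn_form N 0 h = 0.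
Proof. by apply: (addrI (psn_form N 0 h)); rewrite -psn_formD !addr0. Qed.

Lemma psn_formZ N c (y : V) h : psn_form N (c *: y) h = c * psn_form N y h.
Proof. by rewrite -[c *: y]addr0 psn_form_lin psn_form0 addr0. Qed.

Lemma psn_formN N (y : V) h : psn_form N (- y) h = - psn_form N y h.
Proof. by rewrite -scaleN1r psn_formZ mulN1r. Qed.

Lemma psn_form_bounded N (y : V) : exists2 t, 0 <= t & forall h,
  Re (psn_form N y h) <= t * \sum_(p < N) sqn (inner H) (h p).
Proof.
have hb p q : exists2 M, 0 <= M & forall u w, normc (inner H (op1 (y p q) u) w) <=
     M * (Num.sqrt (sqn (inner H) u) * Num.sqrt (sqn (inner H) w)).
  have [M M0 MP] := bounded_op_bound (rho (y p q).1).
  exists (M + normc (y p q).2); first by rewrite addr_ge0 ?normc_ge0.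
  move=> u w; rewrite /op1 (ipDl ipP); apply: le_trans (le_normcD _ _) _.
  rewrite mulrDl lerD//; first exact: MP.
  rewrite (ipZl ipP) ComplexField.Normc.normcM ler_wpM2l ?normc_ge0//.
  exact: cauchy_schwarz.
have [t t0 ht] := @opmx_bounded R _ (inner H) nat ipP (iota 0 N) _ hb.
exists t => // h; have := ht h h.
have -> : opmx_form (inner H) (iota 0 N) (fun p q u => op1 (y p q) u) h h =
    psn_form N y h.
  by rewrite /opmx_form sum_iota; apply: eq_bigr => p _; rewrite sum_iota.
move=> le; apply: le_trans (Re_le_normc _) (le_trans le _).
by rewrite -expr2 sqr_sqrtr ?fam_sqn_ge0// /fam_sqn sum_iota.
Qed.

Definition psn_star (y : V) : V := fun p q => (star (y q p).1, ((y q p).2 : C)^*).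

Lemma psn_form_star N (y : V) h : psn_form N (psn_star y) h = (psn_form N y h)^*.
Proof.
rewrite /psn_form exchange_big rmorph_sum; apply: eq_bigr => p _.
rewrite rmorph_sum; apply: eq_bigr => q _ /=.
rewrite -(ipC ipP) /op1 /= (ipDl ipP) (ipDr ipP) (ipZl ipP) (ipZr ipP).
by rewrite /op rho_star (starK smosX).
Qed.

Section Functional.
Variables (n : nat) (f : Minf (functional X)).
Hypothesis nf : mbnd n f.
Hypothesis f1 : forall (k : Minf X) (v w : Minf C^o),
  normc (pair f (sandwich w k v)) <= mnorm (amp rho k) * (hs v * hs w).
Variable e0 : H.
Hypothesis e0_unit : inner H e0 e0 = 1.

Let N := (n + n)%N.

(* Paulsen's operator system: scalar diagonal blocks, the upper right corner
   with entries in [X]. *)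
Definition psn_sys (z : V) : Prop :=
  forall p q, (p < N)%N -> (q < N)%N ->
    [/\ (p < n)%N && (n <= q)%N = false -> (z p q).1 = 0,
        (p < n)%N (+) (q < n)%N -> (z p q).2 = 0 &
        True].

(** The trace on the diagonal blocks is what dominates [f]: the value f(A^* k B) is bounded by |k|
    times the Hilbert-Schmidt norms of A and B, whose squares are the traces of A^* A and B^* B. *)
Definition psn_fun (z : V) : C :=
  \sum_(p < N) (z p p).2 + \sum_(i < n) \sum_(j < n) f i j (z i (n + j)%N).1.

Lemma psn_fun_lin c (y z : V) : psn_fun (c *: y + z) = c * psn_fun y + psn_fun z.
Proof.
rewrite /psn_fun mulrDr addrACA; congr (_ + _).
  by rewrite mulr_sumr -big_split.
rewrite mulr_sumr -big_split; apply: eq_bigr => i _ /=.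
rewrite mulr_sumr -big_split; apply: eq_bigr => j _ /=.
by rewrite fapplD fapplZ.
Qed.

Lemma psn_funD (y z : V) : psn_fun (y + z) = psn_fun y + psn_fun z.
Proof. by rewrite -[y in LHS]scale1r psn_fun_lin mul1r. Qed.

Lemma psn_sys_lin c (y z : V) : psn_sys y -> psn_sys z -> psn_sys (c *: y + z).
Proof.
move=> sy sz p q pN qN; have [y1 y2 _] := sy p q pN qN; have [z1 z2 _] := sz p q pN qN.
split=> // pq; rewrite !fctE /=.
  by rewrite (y1 pq) (z1 pq) scaler0 addr0.
by rewrite (y2 pq) (z2 pq) scaler0 addr0.
Qed.

Lemma psn_sys0 : psn_sys 0.
Proof. by []. Qed.

Lemma psn_fun0 : psn_fun 0 = 0.
Proof.
rewrite /psn_fun big1// add0r; apply: big1 => i _; apply: big1 => j _.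
by rewrite fapp0.
Qed.

Lemma sum_block (W : nmodType) (F : nat -> W) :
  \sum_(p < N) F p = \sum_(i < n) F i + \sum_(i < n) F (n + i)%N.
Proof. by rewrite big_split_ord. Qed.

Definition vec_block (xi eta : nat -> H) (p : nat) : H :=
  if (p < n)%N then xi p else eta (p - n)%N.

Lemma psn_form_block (z : V) xi eta : psn_sys z ->
  psn_form N z (vec_block xi eta) =
  \sum_(i < n) \sum_(j < n) inner H ((z i j).2 *: xi j) (xi i) +
  \sum_(i < n) \sum_(j < n) inner H ((z (n + i)%N (n + j)%N).2 *: eta j) (eta i) +
  op_form n (fun i j => (z i (n + j)%N).1) eta xi.
Proof.
move=> sz; rewrite /psn_form (sum_block
  (fun p => \sum_(q < N) inner H (op1 (z p q) (vec_block xi eta q)) (vec_block xi eta p))).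
have vl (i : 'I_n) : vec_block xi eta i = xi i by rewrite /vec_block ltn_ord.
have vr (i : 'I_n) : vec_block xi eta (n + i)%N = eta i.
  by rewrite /vec_block ltnNge leq_addr /= addKn.
have lN (i : 'I_n) : (i < N)%N by rewrite ltn_addr.
have rN (i : 'I_n) : (n + i < N)%N by rewrite ltn_add2l.
have rn (i : 'I_n) : (n + i < n)%N = false by rewrite ltnNge leq_addr.
rewrite addrAC; congr (_ + _).
  rewrite -big_split; apply: eq_bigr => i _ /=.
  rewrite (sum_block (fun q => inner H (op1 (z i q) (vec_block xi eta q)) (vec_block xi eta i))).
  congr (_ + _); apply: eq_bigr => j _; rewrite vl /op1.
    have [z1 _ _] := sz i j (lN i) (lN j).
    by rewrite z1 ?op0 ?add0r ?vl// [(n <= j)%N]leqNgt (ltn_ord j) andbF.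
  have [_ z2 _] := sz i (n + j)%N (lN i) (rN j).
  by rewrite z2 ?scale0r ?addr0 ?vr// ltn_ord rn.
apply: eq_bigr => i _.
rewrite (sum_block (fun q => inner H (op1 (z (n + i)%N q) (vec_block xi eta q)) (vec_block xi eta (n + i)%N))).
rewrite big1 ?add0r => [|j _]; last first.
  have [z1 z2 _] := sz (n + i)%N j (rN i) (lN j).
  by rewrite /op1 z1 ?z2 ?op0 ?scale0r ?addr0 ?(ip0l ipP)// rn ?ltn_ord.
apply: eq_bigr => j _; rewrite vr /op1.
have [z1 _ _] := sz (n + i)%N (n + j)%N (rN i) (rN j).
by rewrite z1 ?op0 ?add0r ?vr// rn.
Qed.

(* If [Q_z >= 0] then [x = A^* k B] where [A^*A], [B^*B] are the (perturbed)
   diagonal blocks and [|k| <= 2]; hence [|f(x)| <= tr A^*A + tr B^*B]. *)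
Lemma psn_fun_ge0 (z : V) : psn_sys z ->
  (forall h, 0 <= Re (psn_form N z h)) -> 0 <= Re (psn_fun z).
Proof.
move=> sz zpos; apply/ler_addgt0Pr => e egt0.
(* Each diagonal block is perturbed by [d], which changes the two traces by 2 n d <= e in total. *)
pose d := e / (2 * n%:R + 1).
have den : 0 < 2 * n%:R + 1 :> R by rewrite ltr_wpDl// mulr_ge0.
have d0 : 0 < d by rewrite divr_gt0.
have dn : 2 * n%:R * d <= e.
  rewrite /d mulrA ler_pdivrMr// [e * _]mulrC ler_wpM2r//; first exact: ltW.
  by rewrite lerDl.
pose al i j : C := (z i j).2; pose be i j : C := (z (n + i)%N (n + j)%N).2.
pose x i j := (z i (n + j)%N).1.
have blockpos (xi eta : nat -> H) : 0 <= Re (\sum_(i < n) \sum_(j < n) inner H (al i j *: xi j) (xi i)) +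
   Re (\sum_(i < n) \sum_(j < n) inner H (be i j *: eta j) (eta i)) +
   Re (op_form n x eta xi).
  by have := zpos (vec_block xi eta); rewrite (psn_form_block _ _ sz) !cReD.
have form0r (eta : nat -> H) : op_form n x eta (fun=> 0) = 0.
  by apply: big1 => i _; apply: big1 => j _; rewrite (ip0r ipP).
have form0l (xi : nat -> H) : op_form n x (fun=> 0) xi = 0.
  by apply: big1 => i _; apply: big1 => j _; rewrite (lin_0 (@op_lin _)) (ip0l ipP).
have scal0 (a : nat -> nat -> C) :
    \sum_(i < n) \sum_(j < n) inner H (a i j *: (0 : H)) 0 = 0.
  by apply: big1 => i _; apply: big1 => j _; rewrite (ip0r ipP).
have alpos (xi : nat -> H) : 0 <= Re (\sum_(i < n) \sum_(j < n) inner H (al i j *: xi j) (xi i)).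
  by have := blockpos xi (fun=> 0); rewrite scal0 form0l !addr0.
have bepos (eta : nat -> H) : 0 <= Re (\sum_(i < n) \sum_(j < n) inner H (be i j *: eta j) (eta i)).
  by have := blockpos (fun=> 0) eta; rewrite scal0 form0r add0r addr0.
have [A [Ai [nA nAi AAi AiA gA]]] :=
  hermitian_sqrt d0 (hpartC d al) (hpart_pos d e0_unit alpos).
have [B [Bi [nB nBi BBi BiB gB]]] :=
  hermitian_sqrt d0 (hpartC d be) (hpart_pos d e0_unit bepos).
pose xm : Minf X := mxinf (fun i j => if (i < n)%N && (j < n)%N then x i j else 0).
have xmE i j : xm i j = if (i < n)%N && (j < n)%N then x i j else 0.
  by apply: (@mxinfE _ _ n) => p q /negbTE ->.
have nx : mbnd n xm by move=> i j /negbTE ij; rewrite xmE ij.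
have formxm h h' : op_form n xm h h' = op_form n x h h'.
  by apply: eq_bigr => i _; apply: eq_bigr => j _; rewrite xmE !ltn_ord.
pose k := sandwich Ai xm Bi.
have nk : mbnd n k by exact: mbnd_sandwich.
(* The form of [z] at the pair (- Ai g', Bi g) is positive, which bounds the corner term by the
   diagonal ones; there [A] and [B] cancel their inverses. *)
have bound (g g' : nat -> H) : Re (op_form n k g g') <= vsqn n g + vsqn n g'.
  rewrite (op_form_sandwich _ _ _ _ _ nx) formxm.
  set eta := fun j => _; set xi := fun i => _.
  have := blockpos (fun i => - xi i) eta.
  have -> : op_form n x eta (fun i => - xi i) = - op_form n x eta xi.
    rewrite /op_form -[RHS]sumrN; apply: eq_bigr => i _; rewrite -[RHS]sumrN.
    by apply: eq_bigr => j _; rewrite (ipNr ipP).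
  have -> : \sum_(i < n) \sum_(j < n) inner H (al i j *: - xi j) (- xi i) =
            \sum_(i < n) \sum_(j < n) inner H (al i j *: xi j) (xi i).
    apply: eq_bigr => i _; apply: eq_bigr => j _.
    by rewrite scalerN (ipNl ipP) (ipNr ipP) opprK.
  have Exi := hpart_form d n al xi; have Eeta := hpart_form d n be eta.
  rewrite (gram_vec xi nA gA) /= in Exi; rewrite (gram_vec eta nB gB) /= in Eeta.
  have vA : \sum_(r < n) sqn (inner H) (\sum_(j < n) A r j *: xi j) = vsqn n g'.
    by apply: eq_bigr => r _; rewrite (cancel_vec _ _ nA nAi).
  have vB : \sum_(r < n) sqn (inner H) (\sum_(j < n) B r j *: eta j) = vsqn n g.
    by apply: eq_bigr => r _; rewrite (cancel_vec _ _ nB nBi).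
  rewrite vA in Exi; rewrite vB in Eeta; rewrite Exi Eeta cReN.
  have xi0 : 0 <= d * vsqn n xi by rewrite mulr_ge0 ?(ltW d0) ?vsqn_ge0.
  have eta0 : 0 <= d * vsqn n eta by rewrite mulr_ge0 ?(ltW d0) ?vsqn_ge0.
  move: xi0 eta0; rewrite /vsqn; lra.
have k2 : mnorm (amp rho k) <= 2.
  apply: (mnorm_op_le nk) => // h h'.
  (* Scaling the two vectors by s and t brings [bound] into the shape required by [normc_le_sqrt],
     with both squared lengths doubled; this is the origin of the constant 2. *)
  have : normc (op_form n k h h') <=
      Num.sqrt (2 * vsqn n h) * Num.sqrt (2 * vsqn n h').
    apply: normc_le_sqrt => [||s t]; rewrite ?mulr_ge0 ?vsqn_ge0//.
    rewrite -op_formZ; apply: le_trans (bound _ _) _.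
    by rewrite !vsqnZ; lra.
  by rewrite !sqrtrM// mulrACA -expr2 sqr_sqrtr.
have xk : xm = sandwich A k B by rewrite /k sandwich_mmul AiA BiB sandwich_mone.
have fx : psn_fun z = \sum_(i < n) al i i + \sum_(i < n) be i i + pair f xm.
  rewrite /psn_fun (sum_block (fun p => (z p p).2 : C)) (pairE (or_introl nf)).
  congr (_ + _); apply: eq_bigr => i _; apply: eq_bigr => j _.
  by rewrite xmE !ltn_ord.
(* The constant 2 is absorbed by 2 |A| |B| <= |A|^2 + |B|^2. *)
have bd : normc (pair f xm) <= hs2 A + hs2 B.
  rewrite xk; apply: le_trans (f1 _ _ _) _.
  apply: (@le_trans _ _ (2 * (hs B * hs A))).
    by rewrite ler_wpM2r ?mulr_ge0 ?hs_ge0.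
  by rewrite -!sqr_hs; have := sqr_ge0 (hs A - hs B); rewrite sqrrB; lra.
rewrite fx !cReD [Re (\sum_(i < n) al i i)]cRe_sum [Re (\sum_(i < n) be i i)]cRe_sum.
rewrite (hs2_hpart nA gA) (hs2_hpart nB gB) in bd.
have : - Re (pair f xm) <= normc (pair f xm) by rewrite -cReN -normcN Re_le_normc.
by move: dn bd; lra.
Qed.

Lemma psn_sum_sqn N' (h : nat -> H) t :
  Re (psn_form N' (fun p q => (0, if p == q then t%:C%C else 0)) h) = t * vsqn N' h.
Proof.
rewrite /psn_form cRe_sum mulr_sumr; apply: eq_bigr => p _.
rewrite (bigD1 p)//= [X in _ + X]big1 ?addr0 => [|q qp]; last first.
  by rewrite /op1 /= op0 add0r -[_ == _ :> nat]/(p == q) eq_sym (negbTE qp) scale0r (ip0l ipP).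
by rewrite /op1 /= op0 add0r eqxx (ipZl ipP) cRe_realM.
Qed.

(** The sublinear functional is the infimum of [Re (psn_fun z)] over the [z] of the system lying
    above [y]. Multiples of the identity majorize every [y], by [psn_form_bounded], and
    [psn_fun_ge0] bounds the infimum from below. The extension is positive because 0 is a majorant
    of [- y] when [y] is positive. *)
Lemma psn_extension : exists m : V -> R,
  [/\ forall y z, m (y + z) = m y + m z,
      forall (t : R) y, m (t%:C%C *: y) = t * m y,
      forall y, (forall h, 0 <= Re (psn_form N y h)) -> 0 <= m y &
      forall z, psn_sys z -> m z = Re (psn_fun z)].
Proof.
pose S (y : V) : set R := [set a | exists z, [/\ psn_sys z,
  forall h, Re (psn_form N y h) <= Re (psn_form N z h) & a = Re (psn_fun z)]].
have S0 y : S y !=set0.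
  have [t t0 ht] := psn_form_bounded N y.
  pose z : V := fun p q => (0, if p == q then t%:C%C else 0).
  exists (Re (psn_fun z)), z; split=> // [p q pN qN|h].
    split=> //= pq; case: eqP => // E; move: pq; rewrite E.
    by rewrite addbb.
  by rewrite psn_sum_sqn; exact: ht.
have Sge y y' a a' : (forall h, 0 <= Re (psn_form N y h) + Re (psn_form N y' h)) ->
    S y a -> S y' a' -> 0 <= a + a'.
  move=> yy' [z [sz zy ->]] [z' [sz' zy' ->]].
  have -> : Re (psn_fun z) + Re (psn_fun z') = Re (psn_fun (z + z')).
    by rewrite psn_funD [RHS]cReD.
  apply: psn_fun_ge0; first by rewrite -[z]scale1r; exact: psn_sys_lin.
  move=> h; rewrite psn_formD cReD.
  by have := yy' h; have := zy h; have := zy' h; lra.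
have S00 : S 0 0.
  by exists 0; split; [exact: psn_sys0| |rewrite psn_fun0].
have Sopp y a : S y a -> forall a', S (- y) a' -> - a' <= a.
  move=> Sa a' Sa'; suff : 0 <= a + a' by lra.
  by apply: (Sge y (- y)) => // h; rewrite psn_formN cReN subrr.
have Sb y : has_lbound (S y).
  have [a' Sa'] := S0 (- y); exists (- a') => a Sa; exact: Sopp Sa _ Sa'.
have sp : sublinear (fun y => inf (S y)).
  apply: sublinear_inf => //.
  - move=> y y' _ _ [z [sz zy ->]] [z' [sz' zy' ->]].
    exists (Re (psn_fun (z + z'))).
      exists (z + z'); split=> //; first by rewrite -[z]scale1r; exact: psn_sys_lin.
      by move=> h; rewrite !psn_formD !cReD lerD.
    by rewrite psn_funD cReD.
  - move=> t y _ t0 [z [sz zy ->]]; exists (Re (psn_fun (t%:C%C *: z))).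
      exists (t%:C%C *: z); split=> //.
        by rewrite -[t%:C%C *: z]addr0; apply: psn_sys_lin => //; exact: psn_sys0.
      by move=> h; rewrite !psn_formZ !cRe_realM ler_wpM2l// ltW.
    by rewrite -[t%:C%C *: z]addr0 psn_fun_lin psn_fun0 addr0 cRe_realM.
  - move=> a Sa; rewrite -[a]addr0; apply: (Sge 0 0) => // h.
    by rewrite psn_form0 addr0.
have [m [mD mZ mp]] := hahn_banach sp.
have mN y : m (- y) = - m y.
  have := mZ (-1) y; rewrite rmorphN rmorph1 scaleN1r mulN1r; exact.
exists m; split=> // [y ypos|z sz].
  rewrite -oppr_le0 -mN; apply: le_trans (mp _) _; apply: ge_inf => //.
  exists 0; split=> [|h|]; first exact: psn_sys0; last by rewrite psn_fun0.
  by rewrite psn_formN psn_form0 cReN oppr_le0.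
have le z' : psn_sys z' -> m z' <= Re (psn_fun z').
  by move=> sz'; apply: le_trans (mp _) _; apply: ge_inf => //; exists z'.
apply/eqP; rewrite eq_le le//= -lerN2 -mN.
have -> : - Re (psn_fun z) = Re (psn_fun (- z)).
  have := psn_fun_lin (-1) z 0; rewrite scaleN1r psn_fun0 !addr0 mulN1r => ->.
  by rewrite cReN.
apply: le; rewrite -[- z]addr0 -scaleN1r; apply: psn_sys_lin => //; exact: psn_sys0.
Qed.

(** The complexification m(y) - i m(i y). Being positive, m depends only on the real part of the
    form ([mext]); hence M is real on elements with real form and commutes with [psn_star]. *)
Lemma psn_complex_extension : exists M : V -> C,
  [/\ forall c y z, M (c *: y + z) = c * M y + M z,
      forall y, (forall h, 0 <= psn_form N y h) -> 0 <= M y,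
      forall y, (forall h, 0 <= Re (psn_form N y h)) -> 0 <= Re (M y),
      forall y, M (psn_star y) = (M y)^* &
      forall z, psn_sys z -> M z = psn_fun z].
Proof.
have [m [mD mZ mpos msys]] := psn_extension.
have mN y : m (- y) = - m y.
  have := mZ (-1) y; rewrite rmorphN rmorph1 scaleN1r mulN1r; exact.
have mext y z : (forall h, Re (psn_form N y h) = Re (psn_form N z h)) -> m y = m z.
  move=> yz; apply/eqP; rewrite eq_le -[m y <= _]subr_ge0 -[m z <= _]subr_ge0 -!mN -!mD.
  by apply/andP; split; apply: mpos => h; rewrite psn_formD psn_formN cReD cReN yz subrr.
pose M y : C := (m y +i* - m ('i%C *: y))%C.
have iE (c : C) : c = (Re c)%:C%C + (Im c)%:C%C * 'i%C.
  by case: c => a b; apply/eqP; rewrite eq_complex /= !(mul0r,mulr0,mulr1,subr0,addr0,add0r) !eqxx.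
have MD y z : M (y + z) = M y + M z.
  by apply/eqP; rewrite eq_complex /= scalerDr !mD opprD !eqxx.
have Mr (t : R) y : M (t%:C%C *: y) = t%:C%C * M y.
  apply/eqP; rewrite eq_complex /= scalerA [_ * t%:C%C]mulrC -scalerA !mZ.
  by rewrite !mul0r subr0 addr0 mulrN !eqxx.
have Mi y : M ('i%C *: y) = 'i%C * M y.
  have ii : 'i%C * 'i%C = (-1)%:C%C :> C by rewrite -expr2 sqr_i rmorphN rmorph1.
  apply/eqP; rewrite eq_complex /= scalerA ii mZ.
  by rewrite !(mul0r,mul1r,mulN1r,opprK,add0r,sub0r) !eqxx.
exists M; split.
- move=> c y z; rewrite MD; congr (_ + _).
  by rewrite {1}[c]iE scalerDl -scalerA MD !Mr Mi mulrA -mulrDl -iE.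
- move=> y ypos; have pIm h : Re (psn_form N ('i%C *: y) h) = 0.
    by rewrite psn_formZ (ge0_complexE (ypos h)) mulrC cRe_realM /= mulr0.
  rewrite lecE /= (_ : m ('i%C *: y) = 0) ?oppr0 ?eqxx /=.
    by apply: mpos => h; exact: ge0_Re.
  have -> : m ('i%C *: y) = m 0 by apply: mext => h; rewrite pIm psn_form0.
  by rewrite -(scale0r 0) -[0 in LHS]/(0%:C%C) mZ mul0r.
- by move=> y ypos; exact: mpos.
- move=> y; apply/eqP; rewrite eq_complex /=; apply/andP; split; apply/eqP.
    by apply: mext => h; rewrite psn_form_star cRe_conj.
  rewrite opprK -mN; apply: mext => h.
  rewrite psn_formN !psn_formZ psn_form_star cReN.
  by case: (psn_form N y h) => a b /=; ring.
- move=> z sz; apply/eqP; rewrite eq_complex /= msys// eqxx /=.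
  rewrite msys; last first.
    by rewrite -['i%C *: z]addr0; apply: psn_sys_lin => //; exact: psn_sys0.
  rewrite -['i%C *: z]addr0 psn_fun_lin psn_fun0 addr0.
  by case: (psn_fun z) => a b /=; rewrite mul0r mul1r sub0r opprK.
Qed.

Definition psn_unit (p q : nat) (x : X1) : V :=
  fun i j => if (i == p) && (j == q) then x else 0.

Lemma psn_unit_lin p q c (x y : X1) :
  psn_unit p q (c *: x + y) = c *: psn_unit p q x + psn_unit p q y.
Proof.
apply/funext => i; apply/funext => j; rewrite /psn_unit !fctE.
by case: ifP; rewrite // scaler0 addr0.
Qed.

Lemma psn_form_unit (p q : 'I_N) (x : X1) h :
  psn_form N (psn_unit p q x) h = inner H (op1 x (h q)) (h p).
Proof.
have z (u : H) : op1 0 u = 0 by rewrite /op1 op0 scale0r addr0.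
rewrite /psn_form (bigD1 p)//= (bigD1 q)//= /psn_unit !eqxx /=.
rewrite big1 ?addr0 => [|j jq]; last first.
  by rewrite -[_ == _ :> nat]/(j == q) (negbTE jq) z (ip0l ipP).
rewrite big1 ?addr0// => i ip; apply: big1 => j _.
by rewrite -[(i == p :> nat)]/(i == p) (negbTE ip) z (ip0l ipP).
Qed.

Section Core.
Variable M : V -> C.
Hypothesis M_lin : forall c y z, M (c *: y + z) = c * M y + M z.
Hypothesis M_pos : forall y, (forall h, 0 <= psn_form N y h) -> 0 <= M y.
Hypothesis M_Re : forall y, (forall h, 0 <= Re (psn_form N y h)) -> 0 <= Re (M y).
Hypothesis M_star : forall y, M (psn_star y) = (M y)^*.
Hypothesis M_sys : forall z, psn_sys z -> M z = psn_fun z.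
Variable K : R.
Hypothesis rhoK : forall k : Minf X, mnorm (amp rho k) <= K * mnorm k.

Let MD y z : M (y + z) = M y + M z.
Proof. by rewrite -[y in LHS]scale1r M_lin mul1r. Qed.

Let M0 : M 0 = 0.
Proof. by apply: (addrI (M 0)); rewrite -MD !addr0. Qed.

Let MZ c y : M (c *: y) = c * M y.
Proof. by rewrite -[c *: y]addr0 M_lin M0 addr0. Qed.

Let MN y : M (- y) = - M y.
Proof. by rewrite -scaleN1r MZ mulN1r. Qed.

Let Mext y z : (forall h, psn_form N y h = psn_form N z h) -> M y = M z.
Proof.
move=> yz; apply/eqP; rewrite -subr_eq0 -MN -MD; apply/eqP/le_anti.
rewrite -[in X in X && _]oppr_ge0 -MN.
by apply/andP; split; apply: M_pos => h; rewrite ?psn_formN psn_formD psn_formN yz subrr ?oppr0.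
Qed.

Let G (p q : nat) (x : X1) : C := M (psn_unit p q x).

Let GE y : M y = \sum_(p < N) \sum_(q < N) G p q (y p q).
Proof.
have E : M (\sum_(p < N) \sum_(q < N) psn_unit p q (y p q)) =
    \sum_(p < N) \sum_(q < N) G p q (y p q).
  rewrite (big_morph M MD M0); apply: eq_bigr => p _.
  by rewrite (big_morph M MD M0).
rewrite -E; apply: Mext => h.
have pD : {morph (fun y => psn_form N y h) : y z / y + z} by move=> ? ?; exact: psn_formD.
rewrite (big_morph _ pD (psn_form0 N h)); apply: eq_bigr => p _.
rewrite (big_morph _ pD (psn_form0 N h)); apply: eq_bigr => q _.
by rewrite psn_form_unit.
Qed.

(** The density matrix of [M] on scalar matrices. Its diagonal blocks are identities, since
    [psn_fun] is the trace there ([T_diag]); its other two blocks are not determined by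
    [psn_fun]. *)
Let T p q : C := G p q (0, 1).

Let GT p q t : G p q (0, t) = t * T p q.
Proof.
have -> : ((0, t) : X1) = (t : C) *: ((0, 1) : X1) + 0.
  by rewrite addr0; congr (_, _); rewrite ?scaler0 // /GRing.scale /= mulr1.
rewrite /G psn_unit_lin M_lin (_ : psn_unit p q 0 = 0) ?M0 ?addr0//.
by apply/funext => i; apply/funext => j; rewrite /psn_unit; case: ifP.
Qed.

(** The scalar matrix v^* v formed from the first [m] rows of [v]; [Tq] is the value of [M] on
    it. *)
Let psn_vec (m : nat) (v : Minf C^o) : V :=
  fun p q => (0, \sum_(i < m) v i q * (v i p)^*).

Let psn_vec_form m (v : Minf C^o) h :
  psn_form N (psn_vec m v) h = (vsqn m (fun i => \sum_(q < N) v i q *: h q))%:C%C.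
Proof.
rewrite /vsqn rmorph_sum /=.
under [RHS]eq_bigr => i _ do rewrite -(ip_sqn ipP) (ip_sum2 _ _ _ _ ipP).
rewrite /psn_form [LHS]exchange_big /= [RHS]exchange_big; apply: eq_bigr => q _.
rewrite [RHS]exchange_big; apply: eq_bigr => p _ /=.
rewrite /op1 /= op0 add0r (ipZl ipP) mulr_suml; apply: eq_bigr => i _.
by rewrite (ipZl ipP) (ipZr ipP) mulrA.
Qed.

Let Tq m (v : Minf C^o) : C := \sum_(i < m) \sum_(p < N) \sum_(q < N) T p q * v i q * (v i p)^*.

Let Tq_M m v : M (psn_vec m v) = Tq m v.
Proof.
rewrite GE /Tq [RHS]exchange_big; apply: eq_bigr => p _ /=.
rewrite [RHS]exchange_big; apply: eq_bigr => q _ /=.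
by rewrite GT mulr_suml; apply: eq_bigr => i _; ring.
Qed.

Let Tq_ge0 m v : 0 <= Tq m v.
Proof.
rewrite -Tq_M; apply: M_pos => h; rewrite psn_vec_form ler0c; exact: vsqn_ge0.
Qed.

Let pair0_lin c (x y : X) : ((c *: x + y, 0) : X1) = c *: ((x, 0) : X1) + ((y, 0) : X1).
Proof.
by rewrite -[RHS]/((c *: x + y, c *: (0 : C^o) + 0) : X1) scaler0 addr0.
Qed.

Let psn_mx (y : Minf X) : V := fun p q => (y p q, 0).

Let psn_mx_form (y : Minf X) h : psn_form N (psn_mx y) h = op_form N y h h.
Proof.
apply: eq_bigr => p _; apply: eq_bigr => q _.
by rewrite /op1 /= scale0r addr0.
Qed.

Let M_sandwich_pos (k : Minf X) v : mcone (amp rho k) ->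
  0 <= M (psn_mx (sandwich v k v)).
Proof.
move=> ck; apply: M_pos => h; rewrite psn_mx_form.
by rewrite (op_form_sandwich _ _ _ _ _ (mdimP k)) op_form_pos//; exact: mdimP.
Qed.

(** A Cauchy-Schwarz inequality for [M]: with r the norm of rho(k), the element |s|^2 r v^* v +
    |t|^2 r w^* w - 2 s t^* w^* k v has a form with nonnegative real part, to which [M_Re] applies.
    The vectors are measured by the density matrix instead of the Hilbert-Schmidt norm. *)
Let M_sandwich_bound m (k : Minf X) v w : mbnd m k ->
  normc (M (psn_mx (sandwich w k v))) <=
  mnorm (amp rho k) * (Num.sqrt (Re (Tq m v)) * Num.sqrt (Re (Tq m w))).
Proof.
move=> mk; set r := mnorm _; have r0 : 0 <= r by exact: mnorm_op_ge0.
have : normc (M (psn_mx (sandwich w k v))) <=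
    Num.sqrt (r * Re (Tq m v)) * Num.sqrt (r * Re (Tq m w)).
  apply: normc_le_sqrt => [||s t]; rewrite ?mulr_ge0 ?ge0_Re//.
  pose z : V := (normc s ^+ 2 * r)%:C%C *: psn_vec m v + ((normc t ^+ 2 * r)%:C%C *: psn_vec m w
       + (- (2 * (s * t^*))) *: psn_mx (sandwich w k v)).
  have : 0 <= Re (M z).
    apply: M_Re => h; rewrite !psn_formD !psn_formZ !psn_vec_form psn_mx_form.
    rewrite (op_form_sandwich _ _ _ _ _ mk) mulNr !cReD cReN -!rmorphM /=.
    set a := fun j => \sum_(q < N) v j q *: h q; set b := fun i => \sum_(q < N) w i q *: h q.
    have := op_form_le (fun j => s *: a j) (fun i => t *: b i) mk.
    rewrite op_formZ !vsqnZ -/r => le.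
    have {le} : Re (s * t^* * op_form m k a b) <= r * ((normc s ^+ 2 * vsqn m a + normc t ^+ 2 * vsqn m b) / 2).
      apply: le_trans (Re_le_normc _) (le_trans le _); rewrite ler_wpM2l//.
      set x := Num.sqrt _; set y := Num.sqrt _.
      have -> : normc s ^+ 2 * vsqn m a = x ^+ 2.
        by rewrite sqr_sqrtr// mulr_ge0 ?sqr_ge0 ?vsqn_ge0.
      have -> : normc t ^+ 2 * vsqn m b = y ^+ 2.
        by rewrite sqr_sqrtr// mulr_ge0 ?sqr_ge0 ?vsqn_ge0.
      by have := sqr_ge0 (x - y); rewrite sqrrB; lra.
    have -> : Re (2 * (s * t^*) * op_form m k a b) = 2 * Re (s * t^* * op_form m k a b).
      by rewrite -mulrA cRe_mul2.
    lra.
  rewrite !MD !MZ !Tq_M mulNr !cReD cReN !cRe_realM.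
  have -> : Re (2 * (s * t^*) * M (psn_mx (sandwich w k v))) =
      2 * Re (s * t^* * M (psn_mx (sandwich w k v))).
    by rewrite -mulrA cRe_mul2.
  lra.
by rewrite !sqrtrM// mulrACA -expr2 sqr_sqrtr.
Qed.

Let G0_functional p q : (p < N)%N -> (q < N)%N ->
  (fun x : X => G p q (x, 0) : C^o) \in @is_functional R X.
Proof.
move=> pN qN; apply/asboolP; split=> [c x y|].
  rewrite -[RHS]/(c * G p q (x, 0) + G p q (y, 0)) /G -M_lin -psn_unit_lin.
  by rewrite pair0_lin.
pose B := Num.sqrt (Re (Tq 1 (unitmxinf R 0 q))) * Num.sqrt (Re (Tq 1 (unitmxinf R 0 p))).
exists (K * B) => x.
have -> : G p q (x, 0) = M (psn_mx (sandwich (unitmxinf R 0 p) (mx1 x) (unitmxinf R 0 q))).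
  rewrite /G; congr M; apply/funext => i; apply/funext => j.
  rewrite /psn_mx (sandwichE _ _ _ _ (@mbnd_mx1 _ _ x)) !big_ord1 mx1E !unitmxinfE /psn_unit /=.
  case: eqP => _ /=; last by rewrite conjC0 mul0r scale0r.
  by case: eqP => _ /=; rewrite ?mulr0 ?scale0r// conjC1 mulr1 scale1r.
apply: le_trans (M_sandwich_bound _ _ (@mbnd_mx1 _ _ x)) _.
rewrite -/B mulrAC ler_wpM2r ?mulr_ge0 ?sqrtr_ge0//; exact: rhoK.
Qed.

Let G0_bnd : mbnd N (fun p q =>
  if insub p is Some a then if insub q is Some b then
    MkFunctional (G0_functional (ltn_ord (a : 'I_N)) (ltn_ord (b : 'I_N))) else 0 else 0).
Proof. by move=> p q; case: insubP => // a -> _; case: insubP => // b ->. Qed.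

Let G0 : Minf (functional X) := mxinf (fun p q =>
  if insub p is Some a then if insub q is Some b then
    MkFunctional (G0_functional (ltn_ord (a : 'I_N)) (ltn_ord (b : 'I_N))) else 0 else 0).

Let mbnd_G0 : mbnd N G0.
Proof. by move=> p q pq; rewrite /G0 (mxinfE G0_bnd) G0_bnd. Qed.

Let G0E (p q : 'I_N) x : G0 p q x = G p q (x, 0).
Proof. by rewrite /G0 (mxinfE G0_bnd) !valK. Qed.

Let pair_G0 y : pair G0 y = M (psn_mx y).
Proof.
rewrite (pairE (or_introl mbnd_G0)) GE; apply: eq_bigr => p _; apply: eq_bigr => q _.
by rewrite G0E.
Qed.

Let mstar_G0 : mstar (G0 : Minf (dual X)) = G0.
Proof.
apply: Minf_eq => p q; rewrite (dual_mstarE smosX).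
apply: functional_eq => x; rewrite (dual_starE smosX).
rewrite -[LHS](_ : (pair G0 (mstar (sandwich (unitmxinf R 0 p) (mx1 x) (unitmxinf R 0 q))))^* = _); last first.
  by rewrite (mstar_sandwich smosX) (mstar_mx1 smosX) pair_unit.
rewrite -(pair_unit _ x p q) !pair_G0 -M_star; congr M.
apply/funext => i; apply/funext => j; rewrite /psn_star /psn_mx /=.
by rewrite (mstarE smosX) starK// conjC0.
Qed.

Let T_herm (p q : nat) : T q p = (T p q)^*.
Proof.
rewrite /T /G -M_star; congr M; apply/funext => i; apply/funext => j.
rewrite /psn_star /psn_unit andbC; case: ifP => _ /=.
  by rewrite (star0 smosX) conjC1.
by rewrite (star0 smosX) conjC0.
Qed.

Let T_diag (p q : 'I_N) : (p < n)%N = (q < n)%N -> T p q = if p == q then 1 else 0.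
Proof.
move=> pq; rewrite /T /G M_sys; last first.
  move=> i j iN jN; rewrite /psn_unit; split=> // [_|].
    by case: ifP.
  by case: ifP => // /andP[/eqP -> /eqP ->]; rewrite pq addbb.
rewrite /psn_fun [X in _ + X]big1 ?addr0 => [|i _]; last first.
  apply: big1 => j _; rewrite /psn_unit; case: ifP => /=; by rewrite fapp0.
case: (eqVneq p q) => [<-|npq].
  rewrite (bigD1 p)//= /psn_unit !eqxx /= big1 ?addr0// => i ip.
  by rewrite -[(i == p :> nat)]/(i == p) (negbTE ip).
apply: big1 => i _; rewrite /psn_unit; case: ifP => // /andP[/eqP E /eqP E'].
by move: npq; rewrite -val_eqE /= -E -E' eqxx.
Qed.

Let G_corner (i j : 'I_n) x : G i (n + j)%N (x, 0) = f i j x.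
Proof.
rewrite /G M_sys; last first.
  move=> p q pN qN; rewrite /psn_unit; split=> //; last by case: ifP.
  case: ifP => // /andP[/eqP -> /eqP ->].
  by rewrite ltn_ord leq_addr.
rewrite /psn_fun big1 ?add0r => [|p _]; last by rewrite /psn_unit; case: ifP.
rewrite (bigD1 i)//= (bigD1 j)//= /psn_unit !eqxx /=.
rewrite big1 ?addr0 => [|q qj]; last first.
  by rewrite eqn_add2l -[(q == j :> nat)]/(q == j) (negbTE qj) fapp0.
rewrite big1 ?addr0// => p pi; apply: big1 => q _.
by rewrite -[(p == i :> nat)]/(p == i) (negbTE pi) fapp0.
Qed.

(** [G0], the restriction of [M] to entries from X, has the corner [f] but is bounded only relative
    to the density [T]. Write T + e = W^* W with W invertible: then g = Wi^* G0 Wi is bounded by the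
    norm of rho(k), and f = a^* g b with a = W P1 and b = W P2, where P1 and P2 embed C^n as the two
    halves of C^N. Since the diagonal blocks of [T] are identities, a^* a and b^* b both equal 1 + e
    on C^n. *)
Lemma psn_core e : 0 < e -> exists (g : Minf (dual X)) (a b : Minf C^o),
  [/\ mstar g = g,
      forall (k : Minf X) v, mcone (amp rho k) -> 0 <= pair g (sandwich v k v),
      forall (k : Minf X) v w, normc (pair g (sandwich w k v)) <=
        mnorm (amp rho k) * (hs v * hs w),
      f = sandwich a g b &
      forall v, hs2 (mmul a v) <= (1 + e) * hs2 v /\
                hs2 (mmul b v) <= (1 + e) * hs2 v].
Proof.
move=> egt0; pose Te (p q : nat) : C := T p q + if p == q then e%:C%C else 0.
have TeC (p q : 'I_N) : Te q p = (Te p q)^*.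
  rewrite /Te rmorphD /= -T_herm eq_sym; congr (_ + _).
  by case: ifP; rewrite ?conj_real ?conjC0.
have Te_vec (c : 'I_N -> C) : \sum_(i < N) \sum_(j < N) Te i j * c j * (c i)^* =
    \sum_(i < N) \sum_(j < N) T i j * c j * (c i)^* + (e * \sum_i normc (c i) ^+ 2)%:C%C.
  rewrite rmorphM rmorph_sum /= mulr_sumr -big_split; apply: eq_bigr => i _ /=.
  rewrite -sqr_normc_mulc.
  have -> : e%:C%C * (c i * (c i)^*) = \sum_(j < N) (if i == j then e%:C%C else 0) * c j * (c i)^*.
    rewrite (bigD1 i)//= eqxx big1 ?addr0 ?mulrA// => j; rewrite eq_sym => /negbTE ->.
    by rewrite !mul0r.
  by rewrite -big_split; apply: eq_bigr => j _ /=; rewrite /Te !mulrDl.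
(* A vector as a one-row matrix, so that [Tq_ge0] gives the positivity of [T]. *)
pose vm (c : 'I_N -> C) : Minf C^o :=
  mxinf (fun i q => if insub q is Some k then if i == 0%N then c k else 0 else 0).
have vmE c (k : 'I_N) : vm c 0%N k = c k.
  rewrite /vm (@mxinfE _ _ N.+1) ?valK// => i q.
  case: insubP => // k' qN _; case: eqP => // ->.
  by rewrite ltn0Sn ltnS (ltnW qN).
have Te_pos (c : 'I_N -> C) : e * \sum_i normc (c i) ^+ 2 <=
    Re (\sum_(i < N) \sum_(j < N) Te i j * c j * (c i)^*).
  rewrite Te_vec cReD /= lerDr; apply: ge0_Re.
  have := Tq_ge0 1 (vm c); rewrite /Tq big_ord1.
  congr (is_true (0 <= _)); apply: eq_bigr => p _; apply: eq_bigr => q _.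
  by rewrite -!(vmE c).
have [W [Wi [nW nWi WWi WiW gW]]] := hermitian_sqrt egt0 TeC Te_pos.
pose g := sandwich Wi G0 Wi.
pose P1 : Minf C^o := mone R n.
pose P2 : Minf C^o := mxinf (fun p j => if (j < n)%N && (p == n + j)%N then 1 else 0).
have nP2 : mbnd N (fun p j => if (j < n)%N && (p == n + j)%N then 1 else 0 : C^o).
  move=> p j; case: ifP => // /andP[jn /eqP ->].
  by rewrite /N ltn_add2l jn (leq_trans jn (leq_addr _ _)).
have P2E p j : P2 p j = if (j < n)%N && (p == n + j)%N then 1 else 0 by exact: mxinfE nP2 p j.
have P1E p j : P1 p j = if (p == j) && (p < n)%N then 1 else 0 by exact: moneE.
have mP2 : mbnd N P2 by move=> p j pj; rewrite P2E nP2.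
have mP1 : mbnd N P1.
  by apply: mbnd_le (@mbnd_mone R n); rewrite leq_addr.
exists g, (mmul W P1), (mmul W P2); split.
- have := @mstar_sandwich R (dual X) (dual_smos smosX) Wi (G0 : Minf (dual X)) Wi.
  by rewrite mstar_G0.
- move=> k v ck; rewrite pair_sandwich sandwich_mmul pair_G0.
  exact: M_sandwich_pos.
- move=> k v w; rewrite pair_sandwich sandwich_mmul pair_G0.
  have [m [mk mv mw]] := mbnd_common3 k v w.
  pose m' := maxn m N.
  (* Because T <= T + e = W^* W, the length measured by [T] is at most the Hilbert-Schmidt norm
     after multiplication by the transpose of [W]. As W Wi is the identity of size N, that product
     is a truncation of [u]. *)
  have le (u : Minf C^o) : mbnd m u -> Num.sqrt (Re (Tq m' (mmul u (mtr Wi)))) <= hs u.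
    move=> mu; rewrite ler_wsqrtr//.
    have mu' : mbnd m' u by apply: mbnd_le mu; rewrite leq_maxl.
    have mWi : mbnd m' (mtr Wi).
      by apply: mbnd_le (mbnd_mtr nWi); rewrite leq_maxr.
    have mW : mbnd m' W by apply: mbnd_le nW; rewrite leq_maxr.
    apply: (@le_trans _ _ (hs2 (mmul (mmul u (mtr Wi)) (mtr W)))); last first.
      rewrite mmulA -mtr_mmul WWi mtr_mone; exact: hs2_mmul_mone.
    set v' := mmul u (mtr Wi); have mv' : mbnd m' v' by exact: mbnd_mmul.
    rewrite (hs2E (mbnd_mmul mv' (mbnd_mtr mW))) /Tq cRe_sum; apply: ler_sum => i _.
    have := Te_vec (fun q => v' i q).
    have -> : \sum_(p < N) \sum_(q < N) Te p q * v' i q * (v' i p)^* =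
        scal_form N (gram W) (v' i) (v' i).
      by apply: eq_bigr => p _; apply: eq_bigr => q _; rewrite gW.
    rewrite (scal_form_gram _ nW) => /(congr1 (@complex.Re R)).
    rewrite cReD /= => /(congr1 (fun r => r - e * \sum_(q < N) normc (v' i q) ^+ 2)).
    rewrite addrK => <-; apply: (@le_trans _ _ (\sum_(r < N) normc (\sum_(j < N) (W r j : C) * v' i j) ^+ 2)).
      rewrite gerBl mulr_ge0 ?(ltW egt0)// sumr_ge0// => q _; exact: sqr_ge0.
    rewrite -(@sum_ord_widen _ N m' (fun r => normc (\sum_(j < N) (W r j : C) * v' i j) ^+ 2)); last 2 first.
    + by rewrite leq_maxr.
    + move=> p Np; rewrite big1 ?ComplexField.Normc.normc0 ?expr0n// => j _.
      by rewrite (mbnd_row _ nW)// mul0r.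
    apply: ler_sum => r _; rewrite (@mmulE _ N); last first.
      by left; exact: mbnd_mtr.
    suff -> : \sum_(q < N) (v' i q : C) * mtr W q r = \sum_(q < N) (W r q : C) * v' i q.
      by [].
    by apply: eq_bigr => q _; rewrite mtrE mulrC.
  apply: le_trans (M_sandwich_bound _ _ (mbnd_le (leq_maxl m N) mk)) _.
  rewrite ler_wpM2l ?mnorm_op_ge0//; apply: ler_pM; rewrite ?sqrtr_ge0//; exact: le.
- rewrite -sandwich_mmul /g [in X in sandwich P1 X P2]sandwich_mmul WiW (sandwich_mone mbnd_G0).
  apply: Minf_eq => i j.
  have [/andP[ilt jlt]|ij] := boolP ((i < n)%N && (j < n)%N); last first.
    rewrite nf// (sandwichE _ _ _ _ mbnd_G0) big1// => p _; apply: big1 => q _.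
    rewrite P1E P2E; case: eqP => [pi|_]; last by rewrite conjC0 mul0r scale0r.
    rewrite andTb; case: ifP => // pn; last by rewrite conjC0 mul0r scale0r.
    case: ifP => [/andP[jn _]|_]; last by rewrite mulr0 scale0r.
    by move: ij; rewrite jn -pi pn.
  apply: functional_eq => x; rewrite -(G_corner (Ordinal ilt) (Ordinal jlt)).
  have iN : (i < N)%N by rewrite ltn_addr.
  have jN : (n + j < N)%N by rewrite ltn_add2l.
  rewrite (sandwichE _ _ _ _ mbnd_G0) (bigD1 (Ordinal iN))//= (bigD1 (Ordinal jN))//=.
  rewrite P1E P2E !eqxx ilt jlt /= conjC1 mulr1 scale1r.
  rewrite big1 ?addr0 => [|q qj]; last first.
    by rewrite P2E jlt -[(q == n + j :> nat)%N]/(q == Ordinal jN) (negbTE qj) mulr0 scale0r.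
  rewrite big1 ?addr0 => [|p pi]; last first.
    apply: big1 => q _.
    by rewrite P1E -[(p == i :> nat)]/(p == Ordinal iN) (negbTE pi) conjC0 mul0r scale0r.
  by rewrite (G0E (Ordinal iN) (Ordinal jN)).
move=> v.
(* Common to both halves: [P] is the matrix of the embedding [s], along which [Te] is 1 + e times
   the identity. *)
have bnd (P : Minf C^o) (s : 'I_n -> 'I_N) : mbnd N P ->
    (forall (p : 'I_N) (j : 'I_n), P p j = if p == s j then 1 else 0) ->
    (forall p j, (n <= j)%N -> P p j = 0) ->
    (forall i j : 'I_n, Te (s i) (s j) = if i == j then (1 + e)%:C%C else 0) ->
    hs2 (mmul (mmul W P) v) <= (1 + e) * hs2 v.
  move=> mP PE P0 Ts; pose m := maxn N (mdim v).
  have mv : mbnd m v by apply: mbnd_le (mdimP v); rewrite leq_maxr.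
  have mWP : mbnd m (mmul W P) by apply: mbnd_le (mbnd_mmul nW mP); rewrite leq_maxl.
  rewrite (hs2E (mbnd_mmul mWP mv)) (hs2E mv) exchange_big [X in _ <= _ * X]exchange_big mulr_sumr.
  apply: ler_sum => c _ /=.
  have NM : (N <= m)%N by rewrite leq_maxl.
  pose u (j : 'I_n) : C := v j c.
  pose cu (p : 'I_N) : C := \sum_(j < n) (P p j : C) * u j.
  have -> : \sum_(r < m) normc (mmul (mmul W P) v r c) ^+ 2 =
      \sum_(r < N) normc (\sum_(p < N) (W r p : C) * cu p) ^+ 2.
    rewrite (@sum_ord_widen _ N m (fun r => normc (mmul (mmul W P) v r c) ^+ 2)) => //; last first.
      move=> p Np; rewrite (@mmulE _ m); last by left.
      rewrite big1 ?ComplexField.Normc.normc0 ?expr0n// => q _.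
      by rewrite (mbnd_row _ (mbnd_mmul nW mP))// mul0r.
    apply: eq_bigr => r _; congr (normc _ ^+ 2).
    rewrite mmulA (@mmulE _ N); last by right.
    apply: eq_bigr => p _; congr (_ * _).
    rewrite (@mmulE _ m); last by left.
    apply: (@sum_ord_widen _ n m (fun k => (P p k : C) * v k c)).
      by apply: leq_trans NM; rewrite leq_addr.
    by move=> q nq; rewrite P0// mul0r.
  pose cu' (q : nat) : C := if insub q is Some k then cu k else 0.
  have cu'E (q : 'I_N) : cu' q = cu q by rewrite /cu' valK.
  have := scal_form_gram cu' nW.
  under [in RHS]eq_bigr => r _ do under eq_bigr => p _ do rewrite cu'E.
  move=> /(congr1 (@complex.Re R)) /= <-.
  have -> : scal_form N (gram W) cu' cu' = \sum_(i < n) \sum_(j < n) Te (s i) (s j) * u j * (u i)^*.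
    rewrite /scal_form.
    under eq_bigr => p _ do under eq_bigr => q _ do rewrite gW !cu'E.
    have cuE (L : 'I_N -> C) : \sum_(p < N) L p * cu p = \sum_(j < n) L (s j) * u j.
      rewrite /cu; under eq_bigr => p _ do rewrite mulr_sumr.
      rewrite exchange_big; apply: eq_bigr => j _ /=.
      rewrite (bigD1 (s j))//= PE eqxx mul1r big1 ?addr0// => p ps.
      by rewrite PE (negbTE ps) mul0r mulr0.
    transitivity (\sum_(p < N) (\sum_(j < n) Te p (s j) * u j) * (cu p)^*).
      by apply: eq_bigr => p _; rewrite -(cuE (fun q : 'I_N => Te p q)) mulr_suml.
    have cuC (L : 'I_N -> C) : \sum_(p < N) L p * (cu p)^* = \sum_(j < n) L (s j) * (u j)^*.
      rewrite -[LHS]conjCK rmorph_sum /=.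
      under eq_bigr => p _ do rewrite rmorphM /= conjCK.
      rewrite (cuE (fun p => (L p)^*)) rmorph_sum /=; apply: eq_bigr => j _.
      by rewrite rmorphM /= conjCK.
    rewrite (cuC (fun p : 'I_N => \sum_(j < n) Te p (s j) * u j)).
    by apply: eq_bigr => i _; rewrite mulr_suml.
  have -> : \sum_(i < n) \sum_(j < n) Te (s i) (s j) * u j * (u i)^* =
      ((1 + e) * \sum_(i < n) normc (u i) ^+ 2)%:C%C.
    rewrite rmorphM rmorph_sum mulr_sumr /=; apply: eq_bigr => i _.
    rewrite (bigD1 i)//= Ts eqxx big1 ?addr0 -?mulrA ?sqr_normc_mulc// => j ji.
    by rewrite Ts eq_sym (negbTE ji) !mul0r.
  rewrite /= ler_wpM2l ?addr_ge0 ?(ltW egt0)//.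
  rewrite [leRHS](_ : _ = \sum_(i < n) normc (v i c) ^+ 2 + \sum_(n <= i < m) normc (v i c) ^+ 2); last first.
    rewrite -!(big_mkord xpredT (fun i => normc (v i c) ^+ 2)).
    rewrite (@big_cat_nat _ _ _ n)//=.
    by apply: leq_trans NM; rewrite leq_addr.
  by rewrite lerDl sumr_ge0// => i _; exact: sqr_ge0.
split.
  apply: (bnd P1 (lshift n)) => //.
  - move=> p j; rewrite P1E -val_eqE /=; case: eqP => //= ->.
    by rewrite ltn_ord.
  - by move=> p j nj; rewrite P1E; case: eqP => // ->; rewrite ltnNge nj.
  - move=> i j; rewrite /Te T_diag /= ?ltn_ord// -val_eqE /=.
    by rewrite -[(i == j :> nat)]/(i == j); case: eqP; rewrite ?rmorphD ?addr0 ?rmorph1.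
apply: (bnd P2 (@rshift n n)) => //.
- by move=> p j; rewrite P2E ltn_ord -val_eqE.
- by move=> p j nj; rewrite P2E ltnNge nj.
move=> i j; rewrite /Te T_diag /=; last by rewrite !ltnNge !leq_addr.
rewrite -val_eqE /= eqn_add2l.
by rewrite -[(i == j :> nat)]/(i == j); case: eqP; rewrite ?rmorphD ?addr0 ?rmorph1.
Qed.

End Core.

End Functional.
End PaulsenExtension.

(** * The Hilbert space of square summable families *)

Section UnconditionalSums.
Variables (R : realType) (I : choiceType).
Local Notation C := R[i].
Implicit Types a b : I -> C.

(** Convergence along finite subsets, since the index set of the universal representation need not
    be countable. *)
Definition is_sum a (z : C) : Prop := forall e, 0 < e ->
  exists2 s0 : seq I, uniq s0 & forall s, uniq s -> {subset s0 <= s} ->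
    normc (\sum_(i <- s) a i - z) <= e.

Lemma is_sum_common a b z w e : is_sum a z -> is_sum b w -> 0 < e ->
  exists2 s : seq I, uniq s & normc (\sum_(i <- s) a i - z) <= e /\
                             normc (\sum_(i <- s) b i - w) <= e.
Proof.
move=> az bw e0; have [s1 us1 h1] := az e e0; have [s2 us2 h2] := bw e e0.
exists (undup (s1 ++ s2)); first exact: undup_uniq.
by split; [apply: h1|apply: h2]; rewrite ?undup_uniq// => i iin;
  rewrite mem_undup mem_cat iin ?orbT.
Qed.

Lemma normc_eq0_approx (z : C) (K : R) :
  (forall e, 0 < e -> normc z <= e * K) -> z = 0.
Proof.
move=> h; apply: ComplexField.Normc.eq0_normc; apply/eqP.
rewrite eq_le normc_ge0 andbT; apply/ler_addgt0Pr => e e0; rewrite add0r.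
have K0 : 0 < `|K| + 1 by rewrite ltr_wpDl.
apply: le_trans (h _ (divr_gt0 e0 K0)) _.
rewrite mulrAC ler_pdivrMr// ler_wpM2l ?(ltW e0)//.
by apply: le_trans (ler_norm _) _; rewrite lerDl.
Qed.

Lemma is_sum_unique a z w : is_sum a z -> is_sum a w -> z = w.
Proof.
move=> az aw; apply/eqP; rewrite -subr_eq0; apply/eqP.
apply: (@normc_eq0_approx _ 2) => e e0.
have [s us [h1 h2]] := is_sum_common az aw e0.
have -> : z - w = (\sum_(i <- s) a i - w) - (\sum_(i <- s) a i - z).
  by rewrite opprB [RHS]addrC addrA subrK.
by apply: le_trans (le_normcD _ _) _; rewrite normcN; lra.
Qed.

Lemma is_sumD a b z w : is_sum a z -> is_sum b w ->
  is_sum (fun i => a i + b i) (z + w).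
Proof.
move=> az bw e e0; have e20 : 0 < e / 2 by rewrite divr_gt0.
have [s1 us1 h1] := az _ e20; have [s2 us2 h2] := bw _ e20.
exists (undup (s1 ++ s2)); first exact: undup_uniq.
move=> s us sub; rewrite big_split /= opprD addrACA.
apply: le_trans (le_normcD _ _) _; rewrite [e]splitr lerD//.
  by apply: h1 => // i is1; apply: sub; rewrite mem_undup mem_cat is1.
by apply: h2 => // i is2; apply: sub; rewrite mem_undup mem_cat is2 orbT.
Qed.

Lemma is_sumZ c a z : is_sum a z -> is_sum (fun i => c * a i) (c * z).
Proof.
move=> az e e0; have c0 : 0 < normc c + 1 by rewrite ltr_wpDl ?normc_ge0.
have [s0 us0 h] := az _ (divr_gt0 e0 c0); exists s0 => // s us sub.
rewrite -mulr_sumr -mulrBr ComplexField.Normc.normcM.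
apply: (@le_trans _ _ (normc c * (e / (normc c + 1)))).
  by rewrite ler_wpM2l ?normc_ge0//; exact: h.
by rewrite mulrCA ler_piMr ?(ltW e0)// ler_pdivrMr// mul1r lerDl.
Qed.

Lemma is_sum_conj a z : is_sum a z -> is_sum (fun i => (a i)^*) z^*.
Proof.
move=> az e e0; have [s0 us0 h] := az e e0; exists s0 => // s us sub.
by rewrite -rmorph_sum -rmorphB normc_conj; exact: h.
Qed.

Lemma is_sum_supp (r : seq I) a : uniq r -> (forall i, i \notin r -> a i = 0) ->
  is_sum a (\sum_(i <- r) a i).
Proof.
move=> ur a0 e e0; exists r => // s us rs.
have -> : \sum_(i <- s) a i = \sum_(i <- r) a i.
  rewrite -!(@fsbig_seq_supp _ _)//.
  by move=> i ns; apply: a0; apply: contra ns; exact: rs.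
by rewrite subrr -[X in normc X]/(0 : C) ComplexField.Normc.normc0 ltW.
Qed.

Lemma is_sum_sup (a : I -> R) (M : R) : (forall i, 0 <= a i) ->
  (forall s, uniq s -> \sum_(i <- s) a i <= M) ->
  is_sum (fun i => (a i)%:C%C)
    (sup [set \sum_(i <- s) a i | s in [set s : seq I | uniq s]])%:C%C.
Proof.
move=> a0 aM e e0; set S := [set _ | _ in _].
have Sub : has_ubound S by exists M => _ [s us <-]; exact: aM.
have hS : has_sup S by split=> //; exists (\sum_(i <- [::]) a i); exists [::].
have [_ [s0 us0 <-] lt0] := sup_adherent e0 hS.
exists s0 => // s us sub.
have le : \sum_(i <- s0) a i <= \sum_(i <- s) a i.
  have E : \sum_(i <- s | i \in s0) a i = \sum_(i <- s0) a i.
    rewrite -[LHS]big_filter; apply: perm_big; apply: uniq_perm => //.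
      exact: filter_uniq.
    by move=> i; rewrite mem_filter; case: (boolP (i \in s0)) => // /sub ->.
  by rewrite [leRHS](bigID (fun i => i \in s0)) /= E lerDl sumr_ge0.
have le' : \sum_(i <- s) a i <= sup S by apply: ub_le_sup => //; exists s.
rewrite -rmorph_sum -rmorphB normc_real ler0_norm ?subr_le0//.
by move: lt0; lra.
Qed.

End UnconditionalSums.

Section Ell2.
Variables (R : realType) (I : choiceType).
Local Notation C := R[i].
Local Notation l2sqn s v := (fam_sqn (@scal_ip R) s v).

Definition ell2_pred : {pred I -> C^o} :=
  fun x => `[< exists M : R, forall s, uniq s -> l2sqn s x <= M >].

Lemma ell2_pred_submod : submod_closed ell2_pred.
Proof.
split.
  apply/asboolP; exists 0 => s _; rewrite /fam_sqn big1// => i _.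
  by rewrite sqn_scal -[X in normc X]/(0 : C) ComplexField.Normc.normc0 expr0n.
move=> c x y /asboolP[M xM] /asboolP[L yL]; apply/asboolP.
exists (2 * (normc c ^+ 2 * M) + 2 * L) => s us.
apply: (@le_trans _ _ (2 * (normc c ^+ 2 * l2sqn s x) + 2 * l2sqn s y)).
  rewrite /fam_sqn !mulr_sumr -big_split; apply: ler_sum => i _ /=.
  rewrite !sqn_scal -exprMn -ComplexField.Normc.normcM !fctE /=.
  rewrite -[c *: x i]/((c : C) * x i); set a := (c : C) * x i; set b : C := y i.
  have := le_normcD a b; have := normc_ge0 a; have := normc_ge0 b.
  have := normc_ge0 (a + b); have := sqr_ge0 (normc a - normc b); nra.
by rewrite lerD// ler_wpM2l// ?ler_wpM2l ?sqr_ge0 ?xM ?yL.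
Qed.

HB.instance Definition _ :=
  GRing.isSubmodClosed.Build C (I -> C^o) ell2_pred ell2_pred_submod.

Record ell2 := MkEll2 { ell2_fun :> I -> C^o; _ : ell2_fun \in ell2_pred }.

HB.instance Definition _ := [isSub for ell2_fun].
HB.instance Definition _ := [Choice of ell2 by <:].
HB.instance Definition _ := [SubChoice_isSubLmodule of ell2 by <:].

Implicit Types x y : ell2.

Lemma ell2D x y i : (x + y) i = (x i : C) + y i. Proof. by []. Qed.
Lemma ell2N x i : (- x) i = - (x i : C). Proof. by []. Qed.
Lemma ell2Z c x i : (c *: x) i = c * (x i : C). Proof. by []. Qed.
Lemma ell2_eq x y : (forall i, x i = y i) -> x = y.
Proof. by move=> xy; apply: val_inj; apply/funext. Qed.

Lemma ell2_bound x : exists M : R, forall s, uniq s -> l2sqn s x <= M.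
Proof. by case: x => x /= /asboolP. Qed.

Definition ell2_sqn x : R := sup [set l2sqn s x | s in [set s : seq I | uniq s]].

Lemma ell2_sqn_ge s x : uniq s -> l2sqn s x <= ell2_sqn x.
Proof.
move=> us; have [M xM] := ell2_bound x; apply: ub_le_sup; last by exists s.
by exists M => _ [r ur <-]; exact: xM.
Qed.

Lemma ell2_sqn_le x (t : R) : (forall s, uniq s -> l2sqn s x <= t) -> ell2_sqn x <= t.
Proof.
move=> h; apply: ge_sup; first by exists (l2sqn [::] x); exists [::].
by move=> _ [s us <-]; exact: h.
Qed.

Lemma ell2_sqn_ge0 x : 0 <= ell2_sqn x.
Proof.
apply: le_trans (@ell2_sqn_ge [::] x isT).
by rewrite /fam_sqn big_nil.
Qed.

Definition ell2_norm x : C := (Num.sqrt (ell2_sqn x))%:C%C.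

Lemma sqn_triangle (E : lmodType C) (ip : E -> E -> C) (ipP : semi_inner ip) u v :
  Num.sqrt (sqn ip (u + v)) <= Num.sqrt (sqn ip u) + Num.sqrt (sqn ip v).
Proof.
set a := Num.sqrt (sqn ip u); set b := Num.sqrt (sqn ip v).
have ab0 : 0 <= a + b by rewrite addr_ge0 ?sqrtr_ge0.
rewrite -[leRHS]ger0_norm// -sqrtr_sqr ler_wsqrtr//.
have := le_trans (Re_le_normc _) (cauchy_schwarz ipP u v); rewrite -/a -/b => h.
have -> : sqn ip (u + v) = sqn ip u + sqn ip v + 2 * Re (ip u v).
  rewrite /sqn (ipDl ipP) !(ipDr ipP) !cReD (ipC ipP v u) cRe_conj; lra.
have -> : sqn ip u = a ^+ 2 by rewrite sqr_sqrtr// sqn_ge0.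
have -> : sqn ip v = b ^+ 2 by rewrite sqr_sqrtr// sqn_ge0.
by rewrite sqrrD; move: h; lra.
Qed.

Lemma l2sqn_triangle s (x y : I -> C^o) :
  Num.sqrt (l2sqn s (x + y)) <= Num.sqrt (l2sqn s x) + Num.sqrt (l2sqn s y).
Proof.
have := sqn_triangle (semi_inner_sum s (semi_inner_scal R)) x y.
by rewrite !sqn_fam.
Qed.

Lemma l2sqn_ge0 s (x : I -> C^o) : 0 <= l2sqn s x.
Proof. exact: fam_sqn_ge0 (semi_inner_scal R) s x. Qed.

Lemma ell2_normD x y : ell2_norm (x + y) <= ell2_norm x + ell2_norm y.
Proof.
rewrite -rmorphD lecR.
have xy0 : 0 <= Num.sqrt (ell2_sqn x) + Num.sqrt (ell2_sqn y).
  by rewrite addr_ge0 ?sqrtr_ge0.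
rewrite -[leRHS]ger0_norm// -sqrtr_sqr ler_wsqrtr//.
apply: ell2_sqn_le => s us; rewrite -[leLHS]sqr_sqrtr ?l2sqn_ge0//.
rewrite ler_pXn2r ?nnegrE ?sqrtr_ge0//.
apply: le_trans (l2sqn_triangle s x y) _.
by rewrite lerD// ler_wsqrtr// ell2_sqn_ge.
Qed.

Lemma ell2_sqnZ_le c x : ell2_sqn (c *: x) <= normc c ^+ 2 * ell2_sqn x.
Proof.
apply: ell2_sqn_le => s us.
rewrite -[l2sqn s _]/(l2sqn s (c *: (x : I -> C^o))) (fam_sqnZ (semi_inner_scal R)).
by rewrite ler_wpM2l ?sqr_ge0// ell2_sqn_ge.
Qed.

Lemma ell2_sqnZ c x : ell2_sqn (c *: x) = normc c ^+ 2 * ell2_sqn x.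
Proof.
have [->|c0] := eqVneq c 0.
  have := ell2_sqnZ_le 0 x; rewrite ComplexField.Normc.normc0 expr0n mul0r => h.
  by apply/eqP; rewrite eq_le h ell2_sqn_ge0.
apply/eqP; rewrite eq_le ell2_sqnZ_le /=.
have nc0 : 0 < normc c ^+ 2.
  rewrite exprn_gt0// lt_def normc_ge0 andbT; apply: contra_neq c0.
  exact: ComplexField.Normc.eq0_normc.
have := ell2_sqnZ_le c^-1 (c *: x).
rewrite scalerA mulVf// scale1r ComplexField.Normc.normcV exprVn.
by rewrite mulrC ler_pdivlMr// mulrC.
Qed.

Lemma ell2_normZ c x : ell2_norm (c *: x) = `|c| * ell2_norm x.
Proof.
rewrite /ell2_norm ell2_sqnZ sqrtrM ?sqr_ge0// sqrtr_sqr ger0_norm ?normc_ge0//.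
by rewrite rmorphM normC_normc.
Qed.

Lemma ell2_coord x i : normc (x i) <= Num.sqrt (ell2_sqn x).
Proof.
rewrite -[leLHS]ger0_norm ?normc_ge0// -sqrtr_sqr ler_wsqrtr//.
apply: le_trans (@ell2_sqn_ge [:: i] x isT).
by rewrite /fam_sqn big_seq1 sqn_scal.
Qed.

Lemma ell2_norm0_eq0 x : ell2_norm x = 0 -> x = 0.
Proof.
move=> /(congr1 (@complex.Re R)) /= x0; apply: ell2_eq => i.
apply: ComplexField.Normc.eq0_normc; apply/eqP; rewrite eq_le normc_ge0 andbT.
by rewrite -x0 ell2_coord.
Qed.

HB.instance Definition _ :=
  Lmodule_isNormed.Build C ell2 ell2_normD ell2_normZ ell2_norm0_eq0.

Lemma ell2_normE x : `|x| = ell2_norm x. Proof. by []. Qed.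

(** The intervals of centre [a n] and radius [r n] meet pairwise, and the supremum of their lower
    ends lies in all of them. *)
Lemma seq_approx (a r : nat -> R) : (forall n m, a n - a m <= r n + r m) ->
  exists l, forall n, `|l - a n| <= r n.
Proof.
move=> h; pose S := range (fun n => a n - r n).
have ub m : ubound S (a m + r m) by move=> _ [n _ <-]; have := h n m; lra.
exists (sup S) => n; rewrite ler_norml.
have l1 : a n - r n <= sup S.
  by apply: ub_le_sup; [exists (a n + r n); exact: ub|exists n].
have l2 : sup S <= a n + r n.
  by apply: ge_sup; [exists (a 0%N - r 0%N); exists 0%N|exact: ub].
by apply/andP; split; lra.
Qed.

Lemma normc_le_ReIm (z : C) : normc z <= `|Re z| + `|Im z|.
Proof.
case: z => a b /=; have ab0 : 0 <= `|a| + `|b| by rewrite addr_ge0.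
rewrite -[leRHS]ger0_norm// -sqrtr_sqr ler_wsqrtr// sqrrD.
rewrite !real_normK ?num_real//.
by have := mulr_ge0 (normr_ge0 a) (normr_ge0 b); lra.
Qed.

Lemma ReIm_le_normc (z : C) : Re z <= normc z /\ Im z <= normc z.
Proof.
split; first exact: Re_le_normc.
case: z => a b /=; apply: le_trans (ler_norm _) _.
by rewrite -sqrtr_sqr ler_wsqrtr// lerDr sqr_ge0.
Qed.

Lemma exists_inv_lt (a e : R) : 0 <= a -> 0 < e -> exists n : nat, n.+1%:R^-1 * a < e.
Proof.
move=> a0 e0; exists (Num.bound (a / e)).
rewrite mulrC ltr_pdivrMr// -ltr_pdivrMl// mulrC.
by apply: lt_le_trans (archi_boundP _) _; rewrite ?divr_ge0 ?(ltW e0)// ler_nat.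
Qed.

Lemma ell2_complete (F : set_system ell2) : ProperFilter F -> cauchy F -> cvg F.
Proof.
move=> FF /cauchyP Fc; pose r n : R := n.+1%:R^-1.
have r0 n : 0 < r n by rewrite invr_gt0.
(* The Cauchy filter is replaced by centres with explicit radii [r n]; their coordinates then
   converge at a known rate. *)
have /choice[x xP] : forall n, exists x : ell2, F (ball x (r n)%:C%C).
  by move=> n; apply: Fc; rewrite ltcR.
have ballE (z y : ell2) (e : R) : ball z e%:C%C y -> Num.sqrt (ell2_sqn (z - y)) < e.
  by rewrite -ball_normE /ball_ /= ell2_normE /ell2_norm ltcR.
have xx n m : Num.sqrt (ell2_sqn (x n - x m)) <= r n + r m.
  have /filter_ex[z [zn zm]] : F (ball (x n) (r n)%:C%C `&` ball (x m) (r m)%:C%C).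
    exact: filterI (xP n) (xP m).
  have := ell2_normD (x n - z) (z - x m).
  rewrite addrA subrK -rmorphD lecR => /le_trans; apply.
  rewrite lerD// ltW//; first exact: ballE.
  have := ballE _ _ _ zm; rewrite -opprB -scaleN1r ell2_sqnZ normcN.
  by rewrite ComplexField.Normc.normc1 expr1n mul1r.
have /choice[y yP] : forall i, exists y : C, forall n, normc (y - x n i) <= 2 * r n.
  move=> i; have le n m : normc ((x n i : C) - x m i) <= r n + r m.
    by apply: le_trans (xx n m); exact: (ell2_coord (x n - x m) i).
  have [a aP] : exists a, forall n, `|a - Re (x n i)| <= r n.
    apply: (@seq_approx (fun n => Re (x n i))) => n m; apply: le_trans (le n m).
    by rewrite -cReB; exact: Re_le_normc.
  have [b bP] : exists b, forall n, `|b - Im (x n i)| <= r n.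
    apply: (@seq_approx (fun n => Im (x n i))) => n m; apply: le_trans (le n m).
    apply: le_trans (ReIm_le_normc _).2.
    by case: (x n i) => ? ?; case: (x m i) => ? ?.
  exists (a +i* b)%C => n; apply: le_trans (normc_le_ReIm _) _.
  have := aP n; have := bP n; case: (x n i) => p q /=; lra.
(* On a finite set [s] pass through a later centre [x m]: each coordinate of [y - x m] is at most
   [2 * r m], and [m] is chosen after the size of [s]. *)
have yx n s : uniq s -> Num.sqrt (l2sqn s (y - (x n : I -> C^o))) <= r n.
  move=> us; apply/ler_addgt0Pr => e e0.
  pose S : R := (size s)%:R.
  have K0 : 0 < Num.sqrt (4 * S) + 1 by rewrite ltr_wpDl ?sqrtr_ge0.
  have [m mlt] : exists m, r m * (Num.sqrt (4 * S) + 1) < e.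
    by apply: exists_inv_lt => //; exact: ltW.
  have -> : y - (x n : I -> C^o) = (y - (x m : I -> C^o)) + ((x m - x n : ell2) : I -> C^o).
    by apply/funext => i; rewrite !fctE ell2D ell2N addrA subrK.
  apply: le_trans (l2sqn_triangle _ _ _) _.
  have le1 : Num.sqrt (l2sqn s (y - (x m : I -> C^o))) <= r m * Num.sqrt (4 * S).
    rewrite -[r m]ger0_norm ?(ltW (r0 _))// -sqrtr_sqr -sqrtrM ?sqr_ge0// ler_wsqrtr//.
    have -> : r m ^+ 2 * (4 * S) = \sum_(i <- s) 4 * r m ^+ 2.
      by rewrite big_const_seq count_predT iter_addr addr0 -mulr_natr /S; ring.
    apply: ler_sum => i _; rewrite sqn_scal.
    have := yP i m; have := normc_ge0 (y i - x m i); rewrite !fctE => n0 n2.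
    have := r0 m; nra.
  have le2 : Num.sqrt (l2sqn s (x m - x n : ell2)) <= r m + r n.
    by apply: le_trans (xx m n); rewrite ler_wsqrtr// ell2_sqn_ge.
  by move: le1 le2 mlt; lra.
have yin n : y - (x n : I -> C^o) \in ell2_pred.
  apply/asboolP; exists (r n ^+ 2) => s us.
  rewrite -[leLHS]sqr_sqrtr ?l2sqn_ge0// ler_pXn2r ?nnegrE ?sqrtr_ge0 ?(ltW (r0 _))//.
  exact: yx.
have yl : (y : I -> C^o) \in ell2_pred.
  have -> : (y : I -> C^o) = 1 *: (y - (x 0%N : I -> C^o)) + (x 0%N : I -> C^o).
    by rewrite scale1r subrK.
  by case: ell2_pred_submod => _; apply => //; case: (x 0%N).
pose Y : ell2 := MkEll2 yl.
have Yx n : Num.sqrt (ell2_sqn (Y - x n)) <= r n.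
  rewrite -[leRHS]ger0_norm ?(ltW (r0 _))// -sqrtr_sqr ler_wsqrtr//.
  apply: ell2_sqn_le => s us; rewrite -[leLHS]sqr_sqrtr ?l2sqn_ge0//.
  by rewrite ler_pXn2r ?nnegrE ?sqrtr_ge0 ?(ltW (r0 _))//; exact: yx.
apply/cvg_ex; exists Y; apply/cvgrPdist_lt => e e0.
have eE : e = (Re e)%:C%C by apply: ge0_complexE; exact: ltW.
have Re0 : 0 < Re e by rewrite -ltcR -eE.
have [n] := exists_inv_lt (ler0n R 2) Re0; rewrite -/(r n) mulrC => rn.
near=> z; have zn : ball (x n) (r n)%:C%C z by near: z; exact: xP.
rewrite eE ell2_normE /ell2_norm ltcR.
have := ell2_normD (Y - x n) (x n - z).
rewrite addrA subrK -rmorphD lecR => /le_lt_trans; apply.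
apply: le_lt_trans rn; have := ballE _ _ _ zn; have := Yx n; lra.
Unshelve. all: by end_near. Qed.

HB.instance Definition _ := Uniform_isComplete.Build ell2 ell2_complete.

Definition ell2_ip x y : C :=
  xget 0 [set z | is_sum (fun i => (x i : C) * (y i)^*) z].

Lemma is_sum_sqn x : is_sum (fun i => (x i : C) * (x i)^*) (ell2_sqn x)%:C%C.
Proof.
have [M xM] := ell2_bound x.
have := @is_sum_sup R I (fun i => normc (x i) ^+ 2) M.
have -> : (fun i => (normc (x i) ^+ 2)%:C%C) = (fun i => (x i : C) * (x i)^*).
  by apply/funext => i; rewrite sqr_normc_mulc.
have E s : \sum_(i <- s) normc (x i) ^+ 2 = l2sqn s x.
  by apply: eq_bigr => i _; rewrite sqn_scal.
have -> : [set \sum_(i <- s) normc (x i) ^+ 2 | s in [set s : seq I | uniq s]] =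
  [set l2sqn s x | s in [set s : seq I | uniq s]].
  by apply/seteqP; split=> _ [s us <-]; exists s; rewrite ?E.
by apply=> [i|s us]; [exact: sqr_ge0|rewrite E; exact: xM].
Qed.

(** The sum exists by polarization: for [x = y] it is a supremum of finite sums of nonnegative
    terms. *)
Lemma ell2_ip_sum x y : is_sum (fun i => (x i : C) * (y i)^*) (ell2_ip x y).
Proof.
apply: (@xgetPex _ 0 [set z | is_sum (fun i => (x i : C) * (y i)^*) z]).
pose q (c : C) := (ell2_sqn (x + c *: y))%:C%C : C.
have h c := is_sum_sqn (x + c *: y).
have := is_sumZ (4^-1) (is_sumD (is_sumD (h 1) (is_sumZ (-1) (h (-1))))
  (is_sumZ 'i%C (is_sumD (h 'i%C) (is_sumZ (-1) (h (- 'i%C)))))).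
set z := 4^-1 * _ => hz; exists z; move: hz; congr (is_sum _ z).
apply/funext => i; rewrite !ell2D !ell2Z !rmorphD !rmorphM !rmorphN rmorph1 /=.
have -> : ('i%C : C)^* = - 'i%C by apply/eqP; rewrite eq_complex /= oppr0 !eqxx.
have i2 : ('i%C : C) * 'i%C = -1 by rewrite -expr2 sqr_i.
have f4 : (4 : C) != 0 by rewrite pnatr_eq0.
apply: (mulfI f4); rewrite mulVKf//.
set a : C := x i; set b : C := y i; set a' := a^*; set b' := b^*.
have -> : 'i%C * ((a + 'i%C * b) * (a' + - 'i%C * b') +
   -1 * ((a + - 'i%C * b) * (a' + - - 'i%C * b'))) =
   - 2 * ('i%C * 'i%C) * (a * b') + 2 * ('i%C * 'i%C) * (b * a') by ring.
rewrite i2; ring.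
Qed.

Lemma ell2_ip_eq x y z : is_sum (fun i => (x i : C) * (y i)^*) z -> ell2_ip x y = z.
Proof. by move=> h; apply: is_sum_unique h; exact: ell2_ip_sum. Qed.

Lemma ell2_ip_norm x : ell2_ip x x = `|x| ^+ 2.
Proof.
rewrite (ell2_ip_eq (is_sum_sqn x)) ell2_normE /ell2_norm -rmorphXn /=.
by rewrite sqr_sqrtr// ell2_sqn_ge0.
Qed.

Lemma ell2_ipC x y : ell2_ip x y = (ell2_ip y x)^*.
Proof.
apply: ell2_ip_eq; have := is_sum_conj (ell2_ip_sum y x).
by congr (is_sum _ _); apply/funext => i; rewrite rmorphM /= conjCK mulrC.
Qed.

Lemma ell2_ip_linl a x y z : ell2_ip (a *: x + y) z = a * ell2_ip x z + ell2_ip y z.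
Proof.
apply: ell2_ip_eq; have := is_sumD (is_sumZ a (ell2_ip_sum x z)) (ell2_ip_sum y z).
by congr (is_sum _ _); apply/funext => i; rewrite ell2D ell2Z mulrDl mulrA.
Qed.

Lemma ell2_ip_bilinear :
  bilinear_for ( *%R : C -> C -> C) (Num.conj \; *%R : C -> C -> C) ell2_ip.
Proof.
split=> [z a x y|z a x y /=]; first exact: ell2_ip_linl.
rewrite ell2_ipC ell2_ip_linl rmorphD rmorphM /=.
by rewrite -!(ell2_ipC z).
Qed.

HB.instance Definition _ := bilinear_isBilinear.Build C ell2 ell2 C
  ( *%R) (Num.conj \; *%R) ell2_ip ell2_ip_bilinear.

Lemma ell2_ip_herm x y : ell2_ip x y = (-1) ^+ false * Num.conj (ell2_ip y x).
Proof. by rewrite expr0 mul1r; exact: ell2_ipC. Qed.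

HB.instance Definition _ := isHermitianSesquilinear.Build C ell2
  false Num.conj ell2_ip ell2_ip_herm.

Lemma ell2_ip_gt0 x : x != 0 -> 0 < ell2_ip x x.
Proof. by move=> x0; rewrite ell2_ip_norm exprn_gt0// normr_gt0. Qed.

HB.instance Definition _ := isDotProduct.Build C ell2 ell2_ip ell2_ip_gt0.

Definition ell2_hilbert : hilbert R :=
  @Hilbert R ell2 (ell2_ip : {dot ell2 for Num.conj}) ell2_ip_norm.

End Ell2.

Lemma inner_normE (R : realType) (H : hilbert R) (u : H) : inner H u u = `|u| ^+ 2.
Proof. by case: H u. Qed.

(** * Matrices over X^* as corners of positive ones *)

Section CornerRepresentation.
Variables (R : realType) (X : mos_data R) (H : hilbert R) (rho : X -> lop H).
Local Notation C := R[i].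
Variables (c K : R).
Hypothesis smosX : is_smos X.
Hypothesis rho_lin : linear rho.
Hypothesis rho_star : forall (x : X) (u v : H),
  inner H ((rho x : bounded_op H) u) v = inner H u ((rho (star x) : bounded_op H) v).
Hypothesis rho_cone : forall k : Minf X, mcone k -> mcone (amp rho k).
Hypothesis c_gt0 : 0 < c.
Hypothesis K_gt0 : 0 < K.
Hypothesis rho_lb : forall k : Minf X, mnorm k <= c * mnorm (amp rho k).
Hypothesis rho_ub : forall k : Minf X, mnorm (amp rho k) <= K * mnorm k.

Lemma dual_coneZ (t : R) (g : Minf (dual X)) : 0 <= t -> mcone g -> mcone (t%:C%C *: g).
Proof.
move=> t0 /(dual_coneP smosX)[sg pg]; apply/(dual_coneP smosX); split.
  by rewrite (mstarZ (dual_smos smosX)) conj_real sg.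
by move=> x v cx; rewrite pairZl mulr_ge0 ?ler0c// pg.
Qed.

(** The constant [c] turns the norm of X into that of rho(X), so [c^-1] times [f] satisfies the
    hypothesis of the extension; dividing the resulting matrix by [K] brings it into the unit ball
    of X^*. *)
Lemma corner_repr (f : Minf (dual X)) e : mnorm f <= 1 -> 0 < e ->
  exists (g : Minf (dual X)) (a b : Minf C^o),
  [/\ mcone g, mnorm g <= 1, f = (c * K)%:C%C *: sandwich a g b &
      forall v, hs2 (mmul a v) <= (1 + e) * hs2 v /\
                hs2 (mmul b v) <= (1 + e) * hs2 v].
Proof.
move=> f1 e0; have smosD := dual_smos smosX.
have z0 : mmul (0 : Minf C^o) = fun=> 0.
  apply/funext => v; apply: Minf_eq => i j.
  by rewrite (@mmulE _ 0) ?big_ord0//; right.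
have hs0 : hs2 (0 : Minf C^o) = 0.
  by rewrite (@hs2E _ 0) ?big_ord0.
(* The extension needs a unit vector of H. A nonzero value of [f] at [x] forces [x], and by the
   lower bound also [rho x], to be nonzero; for [f = 0] the space H may be trivial. *)
have [->|f0] := eqVneq f 0.
  exists 0, 0, 0; split.
  - apply/(dual_coneP smosX); split.
      by have := mstarZ smosD 0 (0 : Minf (dual X)); rewrite !scale0r conjC0 scale0r.
    by move=> x v _; rewrite pair0l.
  - by rewrite (mnorm0 smosD).
  - have -> : sandwich (0 : Minf C^o) (0 : Minf (dual X)) 0 = 0.
      by apply: Minf_eq => i j; rewrite (@sandwichE _ _ 0)// big_ord0.
    by rewrite scaler0.
  - by move=> v; rewrite z0 hs0 mulr_ge0 ?addr_ge0 ?hs2_ge0 ?(ltW e0).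
have [k [l [x fx]]] : exists k l x, (f k l : functional X) x != 0.
  apply: contrapT => nf; move/eqP: f0; apply; apply: Minf_eq => k l.
  apply: functional_eq => x; apply/eqP; apply: contrapT => /negP ne.
  by apply: nf; exists k, l, x.
have x0 : x != 0 by apply: contraNneq fx => ->; rewrite fapp0.
have rx0 : rho x != 0.
  apply: contraNneq x0 => rx0; apply/eqP.
  suff : mx1 x = 0 by move=> /(congr1 (fun y : Minf X => y 0%N 0%N)); rewrite mx1E.
  apply: (mnorm0_eq0 smosX); apply/eqP; rewrite eq_le (mnorm_ge0 smosX) andbT.
  apply: le_trans (rho_lb _) _; rewrite (amp_mx1 _ (lin_0 rho_lin)) rx0.
  have -> : mx1 (0 : lop H) = amp rho 0.
    by apply: Minf_eq => i j; rewrite (ampE _ _ _ (lin_0 rho_lin)) mx1E (lin_0 rho_lin); case: ifP.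
  by apply: le_trans (ler_wpM2l (ltW c_gt0) (rho_ub 0)) _; rewrite (mnorm0 smosX) !mulr0.
have [u ru] : exists u, (rho x : bounded_op H) u != 0.
  apply: contrapT => nu; move/eqP: rx0; apply; apply: val_inj; apply/funext => u /=.
  by apply/eqP; apply: contrapT => /negP ne; apply: nu; exists u.
have ipP := semi_inner_hilbert H.
pose h := (rho x : bounded_op H) u.
have h0 : 0 < sqn (inner H) h.
  rewrite lt_def sqn_ge0// andbT; apply: contraNneq ru => h0.
  have := ip_sqn ipP h; rewrite h0 => hh.
  by move/eqP: hh; rewrite inner_normE expf_eq0 normr_eq0.
pose r := Num.sqrt (sqn (inner H) h).
have r0 : 0 < r by rewrite sqrtr_gt0.
pose e1 := (r^-1)%:C%C *: h.
have e1u : inner H e1 e1 = 1.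
  rewrite (ip_sqn ipP) (sqnZ ipP) normc_real ger0_norm ?invr_ge0 ?(ltW r0)//.
  have -> : sqn (inner H) h = r ^+ 2 by rewrite sqr_sqrtr// ltW.
  by rewrite -exprMn mulVf ?gt_eqF// expr1n.
pose f' : Minf (dual X) := (c^-1)%:C%C *: f.
have f'1 (k' : Minf X) v w : normc (pair f' (sandwich w k' v)) <=
    mnorm (amp rho k') * (hs v * hs w).
  rewrite pairZl ComplexField.Normc.normcM normc_real ger0_norm ?invr_ge0 ?(ltW c_gt0)//.
  rewrite ler_pdivrMl//; apply: le_trans (pair_le_mnorm smosX _ _ _ _) _.
  rewrite [leRHS]mulrA ler_wpM2r ?mulr_ge0 ?hs_ge0//.
  apply: le_trans (rho_lb k'); rewrite ler_piMl// mnorm_ge0//.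
have nf' : mbnd (mdim f') f' by exact: mdimP.
have [M [M1 M2 M3 M4 M5]] := psn_complex_extension smosX rho_lin rho_star nf' f'1 e1u.
have [g [a [b [sg pg ng fE hsab]]]] :=
  psn_core smosX rho_lin nf' M1 M2 M3 M4 M5 rho_ub e0.
exists ((K^-1)%:C%C *: g), a, b; split; last exact: hsab.
- apply: dual_coneZ; first by rewrite invr_ge0 ltW.
  apply/(dual_coneP smosX); split=> // y v cy; apply: pg; exact: rho_cone.
- apply: (dual_mnorm_le smosX) => // y v w y1; rewrite mul1r pairZl.
  rewrite ComplexField.Normc.normcM normc_real ger0_norm ?invr_ge0 ?(ltW K_gt0)//.
  rewrite ler_pdivrMl//; apply: le_trans (ng _ _ _) _.
  rewrite ler_wpM2r ?mulr_ge0 ?hs_ge0//; apply: le_trans (rho_ub _) _.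
  by rewrite ler_piMr// ltW.
rewrite sandwichZ scalerA -rmorphM mulfK ?gt_eqF// -fE /f' scalerA -rmorphM mulfV ?gt_eqF//.
by rewrite scale1r.
Qed.

End CornerRepresentation.

Section SequenceSums.
Variable R : realType.
Local Notation C := R[i].

Lemma ler_sum_sub (I : choiceType) (s r : seq I) (F : I -> R) : uniq s -> uniq r ->
  {subset s <= r} -> (forall i, 0 <= F i) ->
  \sum_(i <- s) F i <= \sum_(i <- r) F i.
Proof.
move=> us ur sr F0.
have E : \sum_(i <- r | i \in s) F i = \sum_(i <- s) F i.
  rewrite -[LHS]big_filter; apply: perm_big; apply: uniq_perm => //.
    exact: filter_uniq.
  by move=> i; rewrite mem_filter; case: (boolP (i \in s)) => // /sr ->.
by rewrite [leRHS](bigID (fun i => i \in s)) /= E lerDl sumr_ge0.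
Qed.

Lemma cauchy_schwarz_seq (I : Type) (s : seq I) (P : pred I) (a b : I -> R) :
  (forall i, 0 <= a i) -> (forall i, 0 <= b i) ->
  \sum_(i <- s | P i) Num.sqrt (a i) * Num.sqrt (b i) <=
  Num.sqrt (\sum_(i <- s | P i) a i) * Num.sqrt (\sum_(i <- s | P i) b i).
Proof.
move=> a0 b0; rewrite -!(big_filter s P).
have := @cauchy_schwarz_sum R _ (@scal_ip R) _ (seq.filter P s)
  (fun i => (Num.sqrt (a i))%:C%C) (fun i => (Num.sqrt (b i))%:C%C) (semi_inner_scal R).
have sq (d : I -> R) : (forall i, 0 <= d i) ->
    fam_sqn (@scal_ip R) (seq.filter P s) (fun i => (Num.sqrt (d i))%:C%C) =
    \sum_(i <- seq.filter P s) d i.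
  move=> d0; apply: eq_bigr => i _.
  by rewrite sqn_scal normc_real real_normK ?num_real// sqr_sqrtr.
rewrite !sq//; apply: le_trans.
have -> : \sum_(i <- seq.filter P s) scal_ip (Num.sqrt (a i))%:C%C (Num.sqrt (b i))%:C%C =
    (\sum_(i <- seq.filter P s) Num.sqrt (a i) * Num.sqrt (b i))%:C%C.
  by rewrite rmorph_sum; apply: eq_bigr => i _; rewrite rmorphM /scal_ip conj_real.
by rewrite normc_real ler_norm.
Qed.

End SequenceSums.

(** * The universal representation of the bidual *)

Section UniversalMap.
Variables (R : realType) (X : mos_data R).
Local Notation C := R[i].
Hypothesis smosX : is_smos X.
Local Notation Y := (dual X).
Local Notation D := (dual (dual X)).
Let smosY : is_smos Y := dual_smos smosX.
Let smosD : is_smos D := dual_smos smosY.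

(** All matrices over X^* serve as labels of blocks; inadmissible ones carry the zero operator. *)
Definition uidx : choiceType := (Minf Y * nat)%type.
Local Notation E := (ell2 R uidx).
Local Notation H := (ell2_hilbert R uidx).
Local Notation l2sqn s v := (fam_sqn (@scal_ip R) s v).

Definition admissible (g : Minf Y) : Prop := mcone g /\ mnorm g <= 1.

(* The direct sum, over the admissible [g], of the matrices [F(g)] *)
Definition umap_fun (F : functional Y) (x : uidx -> C^o) : uidx -> C^o := fun p =>
  if `[<admissible p.1>] then \sum_(l < mdim p.1) (F (p.1 p.2 l) : C) * x (p.1, l : nat)
  else 0.

Lemma umap_funE m F x g k : admissible g -> (mdim g <= m)%N ->
  umap_fun F x (g, k) = \sum_(l < m) (F (g k l) : C) * x (g, l : nat).
Proof.
move=> ag gm; rewrite /umap_fun /=; case: asboolP => // _; apply/esym.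
apply: (@sum_ord_widen _ _ _ (fun l => (F (g k l) : C) * x (g, l))) => // l gl.
by rewrite (mbnd_col _ (mdimP g))// fapp0 mul0r.
Qed.

Lemma umap_fun0 F x g k : ~ admissible g -> umap_fun F x (g, k) = 0.
Proof. by move=> ng; rewrite /umap_fun /=; case: asboolP. Qed.

Lemma umap_fun_lin F a (x y : uidx -> C^o) :
  umap_fun F (a *: x + y) = a *: umap_fun F x + umap_fun F y.
Proof.
apply/funext => -[g k]; rewrite !fctE.
have [ag|ng] := pselect (admissible g); last first.
  by rewrite !umap_fun0// scaler0 addr0.
rewrite !(umap_funE _ _ _ ag (leqnn _)) -[a *: _]/(a * _) mulr_sumr -big_split.
apply: eq_bigr => l _ /=; rewrite mulrDr -[a *: x _]/(a * (x _ : C)) mulrCA; done.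
Qed.

Lemma umap_fun_linl a (F G : functional Y) (x : uidx -> C^o) :
  umap_fun (a *: F + G) x = a *: umap_fun F x + umap_fun G x.
Proof.
apply/funext => -[g k]; rewrite !fctE.
have [ag|ng] := pselect (admissible g); last first.
  by rewrite !umap_fun0// scaler0 addr0.
rewrite -[RHS]/(a * (umap_fun F x (g, k) : C) + umap_fun G x (g, k)).
rewrite !(umap_funE _ _ _ ag (leqnn _)) mulr_sumr -big_split.
by apply: eq_bigr => l _ /=; rewrite -[X in X * _]/(a * (F (g k l) : C) + G (g k l)) mulrDl mulrA.
Qed.

(** When [m] bounds the sizes of the labels in [S], this finite set contains their blocks entirely,
    so that sums over it split into pairings with whole matrices; [good_box] asks for this and for
    covering a given finite set. *)
Definition box (S : seq (Minf Y)) (m : nat) : seq uidx :=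
  [seq (g, k) | g <- S, k <- iota 0 m].

Lemma uniq_box S m : uniq S -> uniq (box S m).
Proof.
by move=> uS; apply: allpairs_uniq; rewrite ?iota_uniq// => -[a b] [d e] _ _ /= [-> ->].
Qed.

Lemma mem_box S m p : (p \in box S m) = (p.1 \in S) && (p.2 < m)%N.
Proof.
case: p => g k; apply/allpairsP/idP => /= [[[g' k'] /= [] + + [-> ->]]|/andP[gS klt]].
  by rewrite mem_iota add0n /= => -> ->.
by exists (g, k); split; rewrite //= mem_iota.
Qed.

Lemma sum_box (V : nmodType) S m (F : uidx -> V) :
  \sum_(p <- box S m) F p = \sum_(g <- S) \sum_(k < m) F (g, k : nat).
Proof.
rewrite /box big_allpairs; apply: eq_bigr => g _; exact: sum_iota.
Qed.

Definition good_box n (s : seq uidx) S m : Prop :=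
  [/\ uniq S, {subset s <= box S m}, (n <= m)%N & forall g, g \in S -> (mdim g <= m)%N].

Lemma good_box_ex n s : exists S m, good_box n s S m.
Proof.
pose S := undup [seq p.1 | p <- s].
pose m := maxn n (maxn (\max_(p <- s) p.2.+1) (\max_(g <- S) mdim g)).
exists S, m; split; rewrite ?undup_uniq ?leq_maxl//.
  move=> p ps; rewrite mem_box mem_undup map_f//=.
  apply: (@leq_trans (\max_(q <- s) q.2.+1)); first exact: (@leq_bigmax_seq _ _ _ (fun q : uidx => q.2.+1) p).
  by rewrite leq_max leq_maxl orbT.
move=> g gS; apply: (@leq_trans (\max_(g <- S) mdim g)).
  exact: (@leq_bigmax_seq _ _ _ (fun g : Minf Y => mdim g) g).
by rewrite leq_max [X in _ || X]leq_max leqnn !orbT.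
Qed.

(** Column [i] is the part of the vector [v i] in the block [g]; the part of the form of F living in
    that block is then the pairing of F with w^* g v. *)
Definition slice n m (v : nat -> uidx -> C^o) (g : Minf Y) : Minf C^o :=
  mxinf (fun k i => if (k < m)%N && (i < n)%N then v i (g, k) else 0).

Lemma sliceE n m v g k i : (n <= m)%N ->
  slice n m v g k i = if (k < m)%N && (i < n)%N then v i (g, k) else 0.
Proof.
move=> nm; apply: (@mxinfE _ _ m) => p q; case: ifP => // /andP[-> qn].
by rewrite (leq_trans qn nm).
Qed.

Lemma mbnd_slice n m v g : (n <= m)%N -> mbnd m (slice n m v g).
Proof.
move=> nm p q pq; rewrite sliceE//; case: ifP => // /andP[pm qn].
by move: pq; rewrite pm (leq_trans qn nm).
Qed.

Lemma hs2_slice n m v g : (n <= m)%N ->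
  hs2 (slice n m v g) = \sum_(k < m) \sum_(i < n) normc (v i (g, k : nat)) ^+ 2.
Proof.
move=> nm; rewrite (hs2E (mbnd_slice v g nm)); apply: eq_bigr => k _.
rewrite (@sum_ord_widen _ n m (fun i => normc (slice n m v g k i) ^+ 2)) => //; last first.
  move=> p np; rewrite sliceE// [(p < n)%N]ltnNge np andbF.
  by rewrite ComplexField.Normc.normc0 expr0n.
by apply: eq_bigr => i _; rewrite sliceE// !ltn_ord.
Qed.

Lemma sum_hs2_slice n S m v : (n <= m)%N ->
  \sum_(g <- S) hs2 (slice n m v g) = \sum_(i < n) l2sqn (box S m) (v i).
Proof.
move=> nm; under eq_bigr => g _ do rewrite hs2_slice// exchange_big /=.
rewrite exchange_big; apply: eq_bigr => i _ /=.
rewrite /fam_sqn sum_box; apply: eq_bigr => g _; apply: eq_bigr => k _.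
by rewrite sqn_scal.
Qed.

Lemma umap_box n S m (F : Minf D) (v w : nat -> uidx -> C^o) s :
  mbnd n F -> good_box n s S m ->
  \sum_(i < n) \sum_(j < n) \sum_(p <- box S m) umap_fun (F i j) (v j) p * (w i p)^* =
  \sum_(g <- S | `[<admissible g>])
    pair (F : Minf (functional Y)) (sandwich (slice n m w g) g (slice n m v g)).
Proof.
move=> nF [uS _ nm Sm].
transitivity (\sum_(g <- S) \sum_(i < n) \sum_(j < n) \sum_(k < m)
    umap_fun (F i j) (v j) (g, k : nat) * (w i (g, k : nat))^*).
  rewrite [RHS]exchange_big; apply: eq_bigr => i _ /=.
  rewrite [RHS]exchange_big; apply: eq_bigr => j _ /=; exact: sum_box.
rewrite [RHS]big_mkcond /= !big_seq; apply: eq_bigr => g gS.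
case: asboolP => ag; last first.
  apply: big1 => i _; apply: big1 => j _; apply: big1 => k _.
  by rewrite umap_fun0// mul0r.
have mg : mbnd m g by apply: mbnd_le (mdimP g); exact: Sm.
rewrite (pairE (or_introl nF)); apply: eq_bigr => i _; apply: eq_bigr => j _.
rewrite (sandwichE _ _ _ _ mg) fappl_sum; apply: eq_bigr => k _.
rewrite fappl_sum (umap_funE _ _ _ ag (Sm _ gS)) mulr_suml; apply: eq_bigr => l _.
rewrite fapplZ !sliceE// !ltn_ord /=; ring.
Qed.

(** Cauchy-Schwarz over the labels; as |g| <= 1 the constant does not depend on how many blocks
    occur. *)
Lemma pair_slice_le n S m (F : Minf D) (v w : nat -> uidx -> C^o) : (n <= m)%N ->
  normc (\sum_(g <- S | `[<admissible g>])
    pair (F : Minf (functional Y)) (sandwich (slice n m w g) g (slice n m v g))) <=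
  mnorm F * (Num.sqrt (\sum_(i < n) l2sqn (box S m) (v i)) *
             Num.sqrt (\sum_(i < n) l2sqn (box S m) (w i))).
Proof.
move=> nm; apply: le_trans (normc_sum _ _ _) _.
apply: (@le_trans _ _ (mnorm F * \sum_(g <- S | `[<admissible g>])
   Num.sqrt (hs2 (slice n m v g)) * Num.sqrt (hs2 (slice n m w g)))).
  rewrite mulr_sumr; apply: ler_sum => g /asboolP[cg g1].
  apply: le_trans (pair_le_mnorm smosY _ _ _ _) _.
  rewrite ler_wpM2r ?mulr_ge0 ?hs_ge0// ler_piMr// dual_mnorm_ge0//.
rewrite ler_wpM2l ?(dual_mnorm_ge0 smosY)//.
apply: le_trans (cauchy_schwarz_seq _ _ (fun g => hs2_ge0 _) (fun g => hs2_ge0 _)) _.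
rewrite -!(sum_hs2_slice _ _ nm).
by apply: ler_pM; rewrite ?sqrtr_ge0// ler_wsqrtr// [leRHS](bigID (fun g => `[<admissible g>])) /=
  lerDl sumr_ge0// => g _; exact: hs2_ge0.
Qed.

Lemma umap_fun_l2sqn (F : D) (x : E) s : uniq s ->
  l2sqn s (umap_fun F x) <= xnorm F ^+ 2 * ell2_sqn x.
Proof.
move=> us; have [S [m gb]] := good_box_ex 1 s; have [uS sS nm Sm] := gb.
apply: (@le_trans _ _ (l2sqn (box S m) (umap_fun F x))).
  by apply: ler_sum_sub => // [|i]; rewrite ?uniq_box// sqn_scal sqr_ge0.
set q := l2sqn _ _; have q0 : 0 <= q by exact: l2sqn_ge0.
have xF0 : 0 <= xnorm F by exact: mnorm_ge0.
(* The image vector is tested against itself on a finite box, since its square summability is yet to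
   be established. *)
have bq : q <= xnorm F * (Num.sqrt (l2sqn (box S m) x) * Num.sqrt q).
  have n1F := @mbnd_mx1 R D F.
  have := umap_box (fun=> x : uidx -> C^o) (fun=> umap_fun F x) n1F gb.
  rewrite !big_ord1 mx1E /= => E.
  have := pair_slice_le S (mx1 F) (fun=> x : uidx -> C^o) (fun=> umap_fun F x) nm.
  rewrite -E !big_ord1; apply: le_trans.
  apply: le_trans (Re_le_normc _); rewrite cRe_sum; apply: ler_sum => p _.
  by rewrite sqr_normc_mulc sqn_scal.
have lx : l2sqn (box S m) x <= ell2_sqn x by apply: ell2_sqn_ge; exact: uniq_box.
have {bq} : Num.sqrt q <= xnorm F * Num.sqrt (l2sqn (box S m) x).
  have [q00|q00] := eqVneq (Num.sqrt q) 0; first by rewrite q00 mulr_ge0 ?sqrtr_ge0.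
  have sq0 : 0 < Num.sqrt q by rewrite lt_def q00 sqrtr_ge0.
  by rewrite -(ler_pM2r sq0) -expr2 sqr_sqrtr// -mulrA.
move=> le; rewrite -[q]sqr_sqrtr//.
apply: (@le_trans _ _ ((xnorm F * Num.sqrt (l2sqn (box S m) x)) ^+ 2)).
  by rewrite ler_pXn2r ?nnegrE ?mulr_ge0 ?sqrtr_ge0.
by rewrite exprMn sqr_sqrtr ?l2sqn_ge0// ler_wpM2l ?sqr_ge0.
Qed.

Lemma umap_fun_ell2 (F : D) (x : E) : umap_fun F x \in @ell2_pred R uidx.
Proof.
by apply/asboolP; exists (xnorm F ^+ 2 * ell2_sqn x) => s us; exact: umap_fun_l2sqn.
Qed.

Definition umap_vec (F : D) (x : E) : E := MkEll2 (umap_fun_ell2 F x).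

Lemma umap_vec_sqn F x : ell2_sqn (umap_vec F x) <= xnorm F ^+ 2 * ell2_sqn x.
Proof. by apply: ell2_sqn_le => s us; exact: umap_fun_l2sqn. Qed.

Lemma umap_bounded_op F : (umap_vec F : H -> H) \in @is_bounded_op R H.
Proof.
have xF0 : 0 <= xnorm F by exact: mnorm_ge0.
apply/asboolP; split=> [a x y|].
  by apply: val_inj; exact: umap_fun_lin.
exists (xnorm F) => x; rewrite !ell2_normE /ell2_norm -rmorphM lecR.
rewrite -[xnorm F]ger0_norm// -sqrtr_sqr -sqrtrM ?sqr_ge0// ler_wsqrtr//.
exact: umap_vec_sqn.
Qed.

Definition umap (F : D) : lop H := MkBoundedOp (umap_bounded_op F) : bounded_op H.

Lemma umapE F (x : E) p : ((umap F : bounded_op H) x : E) p = umap_fun F x p.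
Proof. by []. Qed.

Lemma umap_linear : linear umap.
Proof.
move=> a F G; apply: val_inj; apply/funext => x; apply: val_inj.
exact: umap_fun_linl.
Qed.

Definition uform n (F : nat -> nat -> D) (v w : nat -> E) : C :=
  \sum_(i < n) \sum_(j < n) inner H ((umap (F i j) : bounded_op H) (v j)) (w i).

Lemma is_sum_ord (I : choiceType) n (a : 'I_n -> I -> C) (z : 'I_n -> C) :
  (forall i, is_sum (a i) (z i)) -> is_sum (fun p => \sum_i a i p) (\sum_i z i).
Proof.
elim: n a z => [|n IH] a z h.
  under [X in is_sum X _]eq_fun do rewrite big_ord0.
  rewrite big_ord0 => e e0; exists [::] => // s us _; rewrite big1// subrr.
  by rewrite -[X in normc X]/(0 : C) ComplexField.Normc.normc0 ltW.
under [X in is_sum X _]eq_fun do rewrite big_ord_recl.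
by rewrite big_ord_recl; apply: is_sumD => //; apply: IH.
Qed.

(** Carries inequalities and identities from finite box sums over to forms on the Hilbert space. *)
Lemma uform_approx n (F : Minf D) (v w : nat -> E) e : mbnd n F -> 0 < e ->
  exists s0 : seq uidx, forall S m (s : seq uidx), {subset s0 <= s} -> good_box n s S m ->
    normc (\sum_(g <- S | `[<admissible g>])
      pair (F : Minf (functional Y))
        (sandwich (slice n m (fun i => w i : uidx -> C^o) g) g
                  (slice n m (fun i => v i : uidx -> C^o) g)) - uform n F v w) <= e.
Proof.
move=> nF e0.
have h : is_sum (fun p => \sum_(i < n) \sum_(j < n)
    umap_fun (F i j) (v j) p * (w i p : C)^*) (uform n F v w).
  apply: is_sum_ord => i; apply: is_sum_ord => j.
  exact: (ell2_ip_sum (umap_vec (F i j) (v j)) (w i)).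
have [s0 us0 hs0] := h e e0; exists s0 => S m s s0s gb.
rewrite -(umap_box _ _ nF gb); have [uS sS nm Sm] := gb.
have := hs0 (box S m) (uniq_box m uS) (fun p ps => sS p (s0s p ps)).
rewrite exchange_big; under eq_bigr => i _ do rewrite exchange_big.
exact.
Qed.

Lemma inner_sqn (x : E) : sqn (inner H) x = ell2_sqn x.
Proof.
rewrite /sqn -[inner H x x]/(ell2_ip x x) ell2_ip_norm ell2_normE /ell2_norm.
by rewrite -rmorphXn /= sqr_sqrtr ?ell2_sqn_ge0.
Qed.

Lemma uform_le n (F : Minf D) (v w : nat -> E) : mbnd n F ->
  normc (uform n F v w) <=
  mnorm F * (Num.sqrt (vsqn n (v : nat -> H)) * Num.sqrt (vsqn n (w : nat -> H))).
Proof.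
move=> nF; apply/ler_addgt0Pr => e e0.
have [s0 h] := uform_approx v w nF e0.
have [S [m gb]] := good_box_ex n s0; have [uS sS nm Sm] := gb.
have {h} := h S m s0 (fun p ps => ps) gb; set A := \sum_(g <- S | _) _ => h.
have -> : uform n F v w = A - (A - uform n F v w) by rewrite opprB addrC subrK.
apply: le_trans (le_normcD _ _) _; rewrite normcN lerD//.
apply: le_trans (pair_slice_le S F _ _ nm) _.
rewrite ler_wpM2l ?(dual_mnorm_ge0 smosY)//.
have le (u : nat -> E) : Num.sqrt (\sum_(i < n) l2sqn (box S m) (u i)) <=
    Num.sqrt (vsqn n (u : nat -> H)).
  rewrite ler_wsqrtr//; apply: ler_sum => i _; rewrite inner_sqn.
  by apply: ell2_sqn_ge; exact: uniq_box.
by apply: ler_pM; rewrite ?sqrtr_ge0.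
Qed.

Lemma uform_pos n (F : Minf D) (v : nat -> E) : mbnd n F -> mcone F ->
  0 <= uform n F v v.
Proof.
move=> nF /(dual_coneP smosY)[_ Fp]; apply: (@ge0_approx _ _ 1) => e e0.
have [s0 h] := uform_approx v v nF e0.
have [S [m gb]] := good_box_ex n s0.
exists (\sum_(g <- S | `[<admissible g>])
      pair (F : Minf (functional Y))
        (sandwich (slice n m (fun i => v i : uidx -> C^o) g) g
                  (slice n m (fun i => v i : uidx -> C^o) g))).
  by apply: sumr_ge0 => g /asboolP[cg _]; exact: Fp.
by rewrite mulr1 -normcN opprB; exact: (h S m s0 (fun p ps => ps) gb).
Qed.

Lemma mnorm_umap_le (F : Minf D) : mnorm (amp umap F) <= mnorm F.
Proof.
apply: (mnorm_op_le umap_linear (mdimP F)); first exact: dual_mnorm_ge0.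
by move=> v w; exact: (uform_le v w (mdimP F)).
Qed.

Definition uvec_fun (g : Minf Y) (m : nat) (c : nat -> C) : uidx -> C^o :=
  fun p => if (p.1 == g) && (p.2 < m)%N then c p.2 else 0.

Lemma finsupp_ell2 (r : seq uidx) (x : uidx -> C^o) :
  (forall p, p \notin r -> x p = 0) -> x \in @ell2_pred R uidx.
Proof.
move=> x0; apply/asboolP; exists (l2sqn (undup r) x) => s us.
have -> : l2sqn s x = l2sqn (seq.filter (fun p => p \in r) s) x.
  rewrite /fam_sqn big_filter [LHS](bigID (fun p => p \in r)) /=.
  rewrite [X in _ + X]big1 ?addr0// => p /x0 ->.
  by rewrite sqn_scal ComplexField.Normc.normc0 expr0n.
apply: ler_sum_sub; rewrite ?filter_uniq ?undup_uniq//.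
  by move=> p; rewrite mem_filter mem_undup => /andP[].
by move=> i; rewrite sqn_scal sqr_ge0.
Qed.

Lemma uvec_fun_supp g m c p : p \notin box [:: g] m -> uvec_fun g m c p = 0.
Proof. by rewrite mem_box inE /uvec_fun => /negbTE ->. Qed.

Definition uvec g m c : E := MkEll2 (finsupp_ell2 (@uvec_fun_supp g m c)).

Lemma sum_uvec (x : E) g m c :
  inner H x (uvec g m c) = \sum_(k < m) (x (g, k : nat) : C) * (c k)^*.
Proof.
have -> : inner H x (uvec g m c) = \sum_(p <- box [:: g] m) (x p : C) * (uvec g m c p)^*.
  apply: ell2_ip_eq; apply: is_sum_supp; first exact: uniq_box.
  by move=> p /uvec_fun_supp; rewrite /uvec /= => ->; rewrite conjC0 mulr0.
rewrite sum_box big_seq1; apply: eq_bigr => k _.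
by rewrite /= /uvec_fun eqxx ltn_ord.
Qed.

Lemma ell2_sqn_uvec g m c : ell2_sqn (uvec g m c) = \sum_(k < m) normc (c k) ^+ 2.
Proof.
have := sum_uvec (uvec g m c) g m c; rewrite -inner_sqn /sqn => ->.
rewrite cRe_sum; apply: eq_bigr => k _.
by rewrite /= /uvec_fun eqxx ltn_ord /= sqr_normc_mulc.
Qed.

Lemma umap_uvec F g m c d : admissible g -> (mdim g <= m)%N ->
  inner H ((umap F : bounded_op H) (uvec g m c)) (uvec g m d) =
  \sum_(k < m) \sum_(l < m) ((F : functional Y) (g k l) : C) * c l * (d k)^*.
Proof.
move=> ag gm; rewrite sum_uvec; apply: eq_bigr => k _.
rewrite umapE (umap_funE _ _ _ ag gm) mulr_suml; apply: eq_bigr => l _.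
by rewrite /= /uvec_fun eqxx ltn_ord.
Qed.

(** Vectors concentrated in the block of [g] turn each pairing into a coefficient of the
    representation; the lower bound and the reflection of positivity rest on this. *)
Lemma pair_uform n m (F : Minf D) g v w : admissible g -> (mdim g <= m)%N ->
  mbnd n F ->
  pair (F : Minf (functional Y)) (sandwich w g v) =
  uform n F (fun j => uvec g m (fun l => v l j)) (fun i => uvec g m (fun k => w k i)).
Proof.
move=> ag gm nF; rewrite (pairE (or_introl nF)); apply: eq_bigr => i _.
apply: eq_bigr => j _; rewrite umap_uvec//.
have mg : mbnd m g by apply: mbnd_le (mdimP g).
rewrite (sandwichE _ _ _ _ mg) fappl_sum; apply: eq_bigr => k _.
rewrite fappl_sum; apply: eq_bigr => l _; rewrite fapplZ; ring.
Qed.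

Lemma pair_le_umap (F : Minf D) g v w : admissible g ->
  normc (pair (F : Minf (functional Y)) (sandwich w g v)) <=
  mnorm (amp umap F) * (hs v * hs w).
Proof.
move=> ag; have [n [nF nv nw]] := mbnd_common3 F v w.
pose m := maxn (mdim g) n.
rewrite (pair_uform v w ag (leq_maxl _ n) nF).
apply: le_trans (op_form_le umap_linear _ _ nF) _.
rewrite ler_wpM2l ?(mnorm_op_ge0 umap_linear)//.
have le (u : Minf C^o) : mbnd n u ->
    Num.sqrt (vsqn n (fun j => uvec g m (fun l => u l j) : H)) <= hs u.
  move=> nu; rewrite ler_wsqrtr//.
  have mu : mbnd m u by apply: mbnd_le nu; rewrite leq_maxr.
  rewrite /vsqn; under eq_bigr => j _ do rewrite inner_sqn ell2_sqn_uvec.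
  rewrite exchange_big (hs2E mu); apply: ler_sum => l _.
  rewrite -(@sum_ord_widen _ n m (fun j => normc (u l j) ^+ 2)) => //.
    by rewrite leq_maxr.
  by move=> p np; rewrite (mbnd_col _ nu)// ComplexField.Normc.normc0 expr0n.
by apply: ler_pM; rewrite ?sqrtr_ge0// le.
Qed.

Lemma umap_cone (F : Minf D) : mcone F -> mcone (amp umap F).
Proof.
move=> cF; apply/(opmx_posP (semi_inner_hilbert H) (op_supp umap_linear (mdimP F))) => v.
rewrite op_form_opmx//; first exact: (uform_pos v (mdimP F) cF).
exact: umap_linear.
Qed.

(** The dual cone is tested on positive [g] only, and every nonzero one is a positive multiple of an
    admissible matrix. *)
Lemma umap_cone_inv (F : Minf D) : msa F -> mcone (amp umap F) -> mcone F.
Proof.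
move=> sF cF; apply/(dual_coneP smosY); split=> // g v cg.
have [g0|g0] := eqVneq (mnorm g) 0.
  by rewrite (mnorm0_eq0 smosY g0) -(scale0r (0 : Minf Y)) sandwichZ pairZr mul0r.
have gpos : 0 < mnorm g by rewrite lt_def g0 mnorm_ge0.
pose g' := ((mnorm g)^-1)%:C%C *: g.
have ag : admissible g'.
  split; first by apply: dual_coneZ => //; rewrite invr_ge0 ltW.
  by rewrite (mnormZ smosY) normc_real ger0_norm ?invr_ge0 ?(ltW gpos)// mulVf.
have -> : g = (mnorm g)%:C%C *: g' by rewrite scalerA -rmorphM mulfV// scale1r.
rewrite sandwichZ pairZr mulr_ge0 ?ler0c ?(ltW gpos)//.
rewrite (pair_uform v v ag (leqnn _) (mdimP F)).
exact: (op_form_pos umap_linear _ (mdimP F) cF).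
Qed.

(** Admissible labels are self-adjoint, so on each block pairing F^* with w^* g v gives the
    conjugate of pairing F with v^* g w; the rest is approximation by box sums. *)
Lemma umap_star (F : D) (u v : E) :
  inner H ((umap F : bounded_op H) u) v =
  inner H u ((umap (star F) : bounded_op H) v).
Proof.
have ipP := semi_inner_hilbert H.
pose G (F : D) (x y : E) := uform 1 (mx1 F) (fun=> x) (fun=> y).
have GE F' x y : G F' x y = inner H ((umap F' : bounded_op H) x) y.
  by rewrite /G /uform !big_ord1 mx1E.
have sl (x y : E) (S : seq (Minf Y)) m g : admissible g ->
    pair (mx1 (star F) : Minf (functional Y))
      (sandwich (slice 1 m (fun=> y : uidx -> C^o) g) g
                (slice 1 m (fun=> x : uidx -> C^o) g)) =
    (pair (mx1 F : Minf (functional Y))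
      (sandwich (slice 1 m (fun=> x : uidx -> C^o) g) g
                (slice 1 m (fun=> y : uidx -> C^o) g)))^*.
  move=> [cg _]; have [sg _] := (dual_coneP smosX g).1 cg.
  have := pair_mstar smosY (mx1 (F : dual Y))
    (sandwich (slice 1 m (fun=> y : uidx -> C^o) g) g (slice 1 m (fun=> x : uidx -> C^o) g)).
  by rewrite (mstar_sandwich smosY) sg (mstar_mx1 smosD).
have : inner H ((umap F : bounded_op H) u) v -
       (inner H ((umap (star F) : bounded_op H) v) u)^* = 0.
  apply: (@normc_eq0_approx _ _ 2) => e e0.
  have n1 F' := @mbnd_mx1 R D F'.
  have [s1 h1] := uform_approx (fun=> u) (fun=> v) (n1 F) e0.
  have [s2 h2] := uform_approx (fun=> v) (fun=> u) (n1 (star F)) e0.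
  have [S [m gb]] := good_box_ex 1 (s1 ++ s2).
  have sub1 : {subset s1 <= s1 ++ s2} by move=> p ps; rewrite mem_cat ps.
  have sub2 : {subset s2 <= s1 ++ s2} by move=> p ps; rewrite mem_cat ps orbT.
  have {h1} := h1 S m _ sub1 gb; have {h2} := h2 S m _ sub2 gb.
  rewrite -/(G _ _ _) -/(G _ _ _) !GE.
  set A := \sum_(g <- S | _) _; set B := \sum_(g <- S | _) _ => hA hB.
  have BA : B = A^*.
    rewrite rmorph_sum; apply: eq_bigr => g /asboolP ag /=.
    by apply: (canRL (@conjCK _)); exact: (esym (sl v u S m g ag)).
  have -> : inner H ((umap F : bounded_op H) u) v -
       (inner H ((umap (star F) : bounded_op H) v) u)^* =
     (A - inner H ((umap (star F) : bounded_op H) v) u)^* -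
     (B - inner H ((umap F : bounded_op H) u) v).
    by rewrite BA rmorphB; ring.
  apply: le_trans (le_normcD _ _) _; rewrite normcN normc_conj.
  by rewrite mulr_natr mulr2n lerD.
by move=> /eqP; rewrite subr_eq0 => /eqP ->; rewrite -(ipC ipP).
Qed.

End UniversalMap.

(** * Lower bound and vector functionals of the universal representation *)

Section UniversalRepresentation.
Variables (R : realType) (X : mos_data R) (H0 : hilbert R) (rho : X -> lop H0).
Local Notation C := R[i].
Variables (c K : R).
Hypothesis smosX : is_smos X.
Hypothesis rho_lin : linear rho.
Hypothesis rho_star : forall (x : X) (u v : H0),
  inner H0 ((rho x : bounded_op H0) u) v = inner H0 u ((rho (star x) : bounded_op H0) v).
Hypothesis rho_cone : forall k : Minf X, mcone k -> mcone (amp rho k).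
Hypothesis c_gt0 : 0 < c.
Hypothesis K_gt0 : 0 < K.
Hypothesis rho_lb : forall k : Minf X, mnorm k <= c * mnorm (amp rho k).
Hypothesis rho_ub : forall k : Minf X, mnorm (amp rho k) <= K * mnorm k.

Local Notation Y := (dual X).
Local Notation D := (dual (dual X)).
Let smosY : is_smos Y := dual_smos smosX.
Let smosD : is_smos D := dual_smos smosY.
Local Notation I := (uidx X).
Local Notation E := (ell2 R I).
Local Notation H := (ell2_hilbert R I).
Local Notation umap := (umap smosX).
Let ipP : semi_inner (inner H) := semi_inner_hilbert H.
Let cK_gt0 : 0 < c * K := mulr_gt0 c_gt0 K_gt0.

(** An arbitrary [f] in the unit ball is a corner of an admissible [g]; pairing with [g] is
    controlled by the representation, and moving [a], [b] onto the vectors costs only a factor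
    tending to 1. *)
Lemma mnorm_le_umap (F : Minf D) : mnorm F <= c * K * mnorm (amp umap F).
Proof.
set m := mnorm (amp umap F).
have m0 : 0 <= m by exact: (mnorm_op_ge0 (umap_linear smosX)).
apply: (dual_mnorm_le smosY); first by rewrite mulr_ge0 ?(ltW cK_gt0).
move=> f v w f1; set B := c * K * m * (hs v * hs w).
have B0 : 0 <= B by rewrite !mulr_ge0 ?hs_ge0 ?(ltW cK_gt0) ?(ltW c_gt0) ?(ltW K_gt0).
apply/ler_addgt0Pr => e e0.
(* With this tolerance the factor [1 + e / (B + 1)] increases the bound [B] by at most [e]. *)
have e10 : 0 < e / (B + 1) by rewrite divr_gt0// ltr_wpDl.
have [g [a [b [cg g1 -> hab]]]] :=
  corner_repr smosX rho_lin rho_star rho_cone c_gt0 K_gt0 rho_lb rho_ub f1 e10.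
rewrite sandwichZ pairZr sandwich_mmul ComplexField.Normc.normcM normc_real.
rewrite (ger0_norm (ltW cK_gt0)).
set t := 1 + e / (B + 1) in hab *; have t0 : 0 <= t by rewrite addr_ge0// ltW.
apply: (@le_trans _ _ (B * t)); last first.
  rewrite /t mulrDr mulr1 lerD2l mulrA ler_pdivrMr ?ltr_wpDl//.
  by rewrite mulrC ler_wpM2l ?(ltW e0)// lerDl.
rewrite /B -!mulrA ler_wpM2l ?(ltW c_gt0)// ler_wpM2l ?(ltW K_gt0)//.
apply: le_trans (pair_le_umap smosX _ _ _ (conj cg g1)) _; rewrite -/m ler_wpM2l//.
have le (u v' : Minf C^o) : hs2 u <= t * hs2 v' -> hs u <= Num.sqrt t * hs v'.
  by move=> le; rewrite -sqrtrM// ler_wsqrtr.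
apply: (@le_trans _ _ ((Num.sqrt t * hs v) * (Num.sqrt t * hs w))).
  by apply: ler_pM; rewrite ?hs_ge0//; apply: le; case: (hab v) (hab w) => [? ?] [].
by rewrite mulrACA -expr2 sqr_sqrtr// mulrC mulrA.
Qed.

(** The entry (0, 0) of the corner decomposition of [mx1 f] is a coefficient at the first columns of
    [b] and [a], placed in the block [g]. Tolerance 1 makes their squared lengths at most 2, whence
    the constant; the estimate ensures in [umap_range_closed] that a limit functional is bounded. *)
Lemma functional_vector_form (f : Y) : exists u v : E,
  (forall F : D, (F : functional Y) f = inner H ((umap F : bounded_op H) u) v) /\
  Num.sqrt (ell2_sqn u) * Num.sqrt (ell2_sqn v) <= 2 * (c * K) * xnorm f.
Proof.
have xf0 : 0 <= xnorm f by exact: mnorm_ge0.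
have [f0|f0] := eqVneq (xnorm f) 0.
  have z : ell2_sqn (0 : E) = 0 by rewrite -inner_sqn /sqn (ip0l ipP).
  exists 0, 0; split; last by rewrite f0 mulr0 z sqrtr0 mul0r.
  move=> F; suff -> : f = 0 by rewrite fapp0 (ip0r ipP).
  have := mnorm0_eq0 smosY f0 => /(congr1 (fun y : Minf Y => y 0%N 0%N)).
  by rewrite mx1E.
have fpos : 0 < xnorm f by rewrite lt_def f0.
have f1 : mnorm (((xnorm f)^-1)%:C%C *: mx1 f) <= 1.
  by rewrite (mnormZ smosY) normc_real ger0_norm ?invr_ge0// mulVf.
have [g [a [b [cg g1 fE hab]]]] :=
  corner_repr smosX rho_lin rho_star rho_cone c_gt0 K_gt0 rho_lb rho_ub f1 ltr01.
pose m := maxn 1 (maxn (mdim g) (maxn (mdim a) (mdim b))).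
have m1 : (1 <= m)%N by rewrite leq_maxl.
have gm : (mdim g <= m)%N by rewrite /m !leq_max leqnn !orbT.
have ma : mbnd m a by apply: mbnd_le (mdimP a); rewrite /m !leq_max leqnn !orbT.
have mb : mbnd m b by apply: mbnd_le (mdimP b); rewrite /m !leq_max leqnn !orbT.
have h1 : hs2 (mone R 1) = 1.
  have -> : hs2 (mone R 1) = \sum_(i < 1) \sum_(j < 1) normc (mone R 1 i j) ^+ 2.
    exact: hs2E (@mbnd_mone _ _).
  by rewrite !big_ord1 moneE -[X in normc X]/((1 : R)%:C%C) normc_real normr1 expr1n.
(* Multiplication by [mone R 1] keeps just the first column of [d]. *)
have le (d : Minf C^o) : mbnd m d -> hs2 (mmul d (mone R 1)) <= (1 + 1) * hs2 (mone R 1) ->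
    ell2_sqn (uvec g m (fun k => d k 0%N)) <= 2.
  move=> md; rewrite h1 mulr1 ell2_sqn_uvec; apply: le_trans.
  have mm : mbnd m (mmul d (mone R 1)).
    by apply: mbnd_mmul => //; apply: mbnd_le (@mbnd_mone _ _).
  rewrite (hs2E mm); apply: ler_sum => k _.
  have E0 : mmul d (mone R 1) k 0%N = d k 0%N.
    rewrite (@mmulE _ 1 _ _ _ _ (or_introl (@mbnd_mone _ 1))) big_ord1 moneE.
    exact: mulr1.
  rewrite (bigD1 (Ordinal m1)) //= E0.
  by rewrite lerDl sumr_ge0// => j _; rewrite sqr_ge0.
exists ((xnorm f * (c * K))%:C%C *: uvec g m (fun k => b k 0%N)), (uvec g m (fun k => a k 0%N)).
split=> [F|].
  have fE2 : mx1 f = (xnorm f * (c * K))%:C%C *: sandwich a g b.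
    by rewrite rmorphM -scalerA -fE scalerA -rmorphM mulfV// scale1r.
  have f00 : (mx1 f : Minf Y) 0%N 0%N = f by rewrite mx1E.
  have := pair_mx1 (F : functional Y) (mx1 f); rewrite f00 => <-.
  rewrite [in X in X = _]fE2 pairZr (pair_uform smosX b a (conj cg g1) gm (@mbnd_mx1 R D F)).
  rewrite /uform !big_ord1 mx1E (lin_Z (bounded_op_linear (umap F))).
  by rewrite (ipZl ipP).
rewrite -inner_sqn (sqnZ ipP) inner_sqn normc_real.
have fcK : 0 <= xnorm f * (c * K) by rewrite mulr_ge0// ltW.
rewrite ger0_norm// sqrtrM ?sqr_ge0// sqrtr_sqr ger0_norm//.
have -> : 2 * (c * K) * xnorm f = xnorm f * (c * K) * 2 by ring.
rewrite -[leLHS]mulrA; apply: ler_wpM2l => //.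
apply: (@le_trans _ _ (Num.sqrt 2 * Num.sqrt 2)); last by rewrite -expr2 sqr_sqrtr.
apply: ler_pM; rewrite ?sqrtr_ge0// ler_wsqrtr//; apply: le => //.
  by case: (hab (mone R 1)).
by case: (hab (mone R 1)).
Qed.

Definition delta_fun (p : I) : I -> C^o := fun q => if q == p then 1 else 0.

Lemma delta_fun_supp p q : q \notin [:: p] -> delta_fun p q = 0.
Proof. by rewrite inE /delta_fun => /negbTE ->. Qed.

Definition delta p : E := MkEll2 (finsupp_ell2 (@delta_fun_supp p)).

Lemma inner_delta (x : E) p : inner H x (delta p) = x p.
Proof.
have -> : inner H x (delta p) = \sum_(q <- [:: p]) (x q : C) * (delta p q)^*.
  apply: ell2_ip_eq; apply: is_sum_supp => // q /delta_fun_supp.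
  by rewrite /delta /= => ->; rewrite conjC0 mulr0.
by rewrite big_seq1 /= /delta_fun eqxx conjC1 mulr1.
Qed.

Lemma umap_delta p q : exists h : Y, forall F : D,
  inner H ((umap F : bounded_op H) (delta q)) (delta p) = (F : functional Y) h.
Proof.
case: p q => g k [g' l].
have [[ag gg']|ng] := pselect (admissible g /\ g = g'); last first.
  exists 0 => F; rewrite inner_delta fapp0 /= /umap_fun /=.
  case: asboolP => // ag; apply: big1 => j _; rewrite /delta_fun xpair_eqE.
  by case: eqP => [gg|_]; [case: ng|rewrite mulr0].
exists (g k l) => F; rewrite -gg' inner_delta /=.
pose m := maxn (mdim g) l.+1.
have lm : (l < m)%N by rewrite leq_maxr.
rewrite (umap_funE _ _ _ ag (leq_maxl _ l.+1)) -/m (bigD1 (Ordinal lm)) //=.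
rewrite /delta_fun eqxx mulr1 big1 ?addr0// => j jl.
rewrite xpair_eqE eqxx /= ifN ?mulr0//.
Qed.

Definition trunc_fun (s : seq I) (x : I -> C^o) : I -> C^o :=
  fun p => if p \in s then x p else 0.

Lemma trunc_fun_supp s x p : p \notin s -> trunc_fun s x p = 0.
Proof. by rewrite /trunc_fun => /negbTE ->. Qed.

Definition trunc s (x : E) : E := MkEll2 (finsupp_ell2 (@trunc_fun_supp s x)).

Lemma trunc_delta s x : uniq s -> trunc s x = \sum_(p <- s) (x p : C) *: delta p.
Proof.
move=> us; apply: val_inj; apply/funext => q /=.
have -> : (\sum_(p <- s) (x p : C) *: delta p : E) q =
    \sum_(p <- s) (x p : C) * (delta p q : C).
  elim: s {us} => [|p s IH]; first by rewrite !big_nil.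
  by rewrite !big_cons -IH.
rewrite /trunc_fun; case: ifP => qs.
  rewrite (bigD1_seq q) //= /delta_fun eqxx mulr1 big1 ?addr0// => p pq.
  by rewrite eq_sym (negbTE pq) mulr0.
rewrite big_seq big1// => p ps; rewrite /= /delta_fun; case: eqP => [qp|]; last by rewrite mulr0.
by move: qs; rewrite qp ps.
Qed.

Lemma trunc_approx (x : E) e : 0 < e ->
  exists s, uniq s /\ ell2_sqn (x - trunc s x) <= e.
Proof.
move=> e0.
have [s us hs] : exists2 s, uniq s & ell2_sqn x - e <= fam_sqn (@scal_ip R) s x.
  apply: contrapT => ns; have : ell2_sqn x <= ell2_sqn x - e.
    apply: ell2_sqn_le => s us; rewrite leNgt; apply/negP => lt.
    by apply: ns; exists s => //; exact: ltW.
  by rewrite lerBrDl gerDr leNgt e0.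
exists s; split=> //; apply: ell2_sqn_le => r ur.
pose r' := seq.filter (fun p => p \notin s) r.
have -> : fam_sqn (@scal_ip R) r (x - trunc s x : E) = fam_sqn (@scal_ip R) r' x.
  rewrite /fam_sqn big_filter [LHS](bigID (fun p => p \in s)) /= big1 ?add0r; last first.
    move=> p ps; rewrite sqn_scal -[X in normc X]/((x p : C) - trunc_fun s x p).
    by rewrite /trunc_fun ps subrr ComplexField.Normc.normc0 expr0n.
  apply: eq_bigr => p ps; rewrite !sqn_scal -[X in normc X]/((x p : C) - trunc_fun s x p).
  by rewrite /trunc_fun (negbTE ps) subr0.
have : fam_sqn (@scal_ip R) (s ++ r') x <= ell2_sqn x.
  apply: ell2_sqn_ge; rewrite cat_uniq us filter_uniq// andbT /=.
  by apply/hasPn => p; rewrite mem_filter => /andP[].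
rewrite /fam_sqn big_cat /= -/(fam_sqn _ s x) -/(fam_sqn _ r' x).
by move: hs; lra.
Qed.

End UniversalRepresentation.

(** * Sigma-weak functionals *)

Section SigmaWeakFunctionals.
Variable R : realType.
Local Notation C := R[i].

(** Convergence together with a rate: the real and imaginary parts are limits with error [r n] each,
    which accounts for the factor 2. *)
Lemma limn_complex (z : nat -> C) (r : nat -> R) :
  (forall n m, normc (z n - z m) <= r n + r m) ->
  (forall e, 0 < e -> exists N, forall n, (N <= n)%N -> r n <= e) ->
  forall n, normc (limn (z : nat -> C^o) - z n) <= 2 * r n.
Proof.
move=> zr r0.
have [a ha] : exists a, forall n, `|a - Re (z n)| <= r n.
  by apply: seq_approx => n m; rewrite -cReB; apply: le_trans (ReIm_le_normc _).1 (zr n m).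
have [b hb] : exists b, forall n, `|b - Im (z n)| <= r n.
  apply: seq_approx => n m; apply: le_trans (zr n m).
  have -> : Im (z n) - Im (z m) = Im (z n - z m) by case: (z n) (z m) => ? ? [].
  exact: (ReIm_le_normc _).2.
pose l : C := Complex a b.
have hl n : normc (l - z n) <= 2 * r n.
  apply: le_trans (normc_le_ReIm _) _; rewrite mulr_natl mulr2n.
  apply: lerD; first by rewrite cReB; exact: ha.
  by have := hb n; rewrite /l; case: (z n) => p q /=.
suff -> : limn (z : nat -> C^o) = l by [].
apply: cvg_lim; first exact: norm_hausdorff.
apply/cvgrPdist_le => e e0.
have eE : e = (Re e)%:C%C by apply: ge0_complexE; exact: ltW.
have e1 : 0 < Re e / 2 by rewrite divr_gt0// -ltcR -eE.
have [N hN] := r0 _ e1; exists N => // n /= Nn.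
rewrite eE normC_normc lecR; apply: le_trans (hl n) _.
by rewrite mulrC -ler_pdivlMr// hN.
Qed.

Variable H : hilbert R.
Let ipP : semi_inner (inner H) := semi_inner_hilbert H.

Definition sqtail (u : nat -> H) (n : nat) : R :=
  limn (series (fun k => sqn (inner H) (u k))) - series (fun k => sqn (inner H) (u k)) n.

Lemma sqtail_ge0 u n : square_summable u -> 0 <= sqtail u n.
Proof.
move=> cu; rewrite subr_ge0; apply: nondecreasing_cvgn_le => //.
by apply: nondecreasing_series => k _ _; exact: sqn_ge0.
Qed.

Lemma sqtail_cvg0 u e : square_summable u -> 0 < e ->
  exists N, forall n, (N <= n)%N -> sqtail u n <= e.
Proof.
move=> /cvgrPdist_le h e0; have [N _ hN] := h e e0; exists N => n Nn.
by apply: le_trans (hN n Nn); exact: ler_norm.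
Qed.

Lemma sqtail_sub u n m : (n <= m)%N -> square_summable u ->
  \sum_(n <= k < m) sqn (inner H) (u k) <= sqtail u n.
Proof.
move=> nm cu; rewrite -sub_series_geq// lerB//.
by rewrite -subr_ge0; exact: sqtail_ge0.
Qed.

(** Each term is at most M/2 times the sum of the squared lengths, and the 1/2 cancels the factor 2
    of [limn_complex]. The estimate depends on [T] only through [M], so the partial sums converge in
    norm. *)
Lemma sigma_weak_tail (u v : nat -> H) (T : bounded_op H) (M : R) n :
  square_summable u -> square_summable v -> 0 <= M ->
  (forall x y, normc (inner H (T x) y) <=
     M * (Num.sqrt (sqn (inner H) x) * Num.sqrt (sqn (inner H) y))) ->
  normc (limn (series (fun k => inner H (T (u k)) (v k) : C^o)) -
         \sum_(0 <= k < n) inner H (T (u k)) (v k)) <=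
  M * (sqtail u n + sqtail v n).
Proof.
move=> su sv M0 TM; pose z n : C := \sum_(0 <= k < n) inner H (T (u k)) (v k).
pose r n := M / 2 * (sqtail u n + sqtail v n).
have M2 : 0 <= M / 2 by rewrite divr_ge0.
have r0 p : 0 <= r p by rewrite mulr_ge0// addr_ge0//; exact: sqtail_ge0.
have zr1 p q : (p <= q)%N -> normc (z q - z p) <= r p.
  move=> pq; rewrite /z (@big_cat_nat _ _ _ p)//= addrAC subrr add0r.
  apply: le_trans (normc_sum _ _ _) _.
  apply: (@le_trans _ _ (\sum_(p <= k < q)
      M / 2 * (sqn (inner H) (u k) + sqn (inner H) (v k)))).
    apply: ler_sum => k _; apply: le_trans (TM _ _) _.
    rewrite -mulrA ler_wpM2l// ler_pdivlMl//.
    set a := Num.sqrt _; set b := Num.sqrt _.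
    have -> : sqn (inner H) (u k) = a ^+ 2 by rewrite sqr_sqrtr ?(sqn_ge0 ipP).
    have -> : sqn (inner H) (v k) = b ^+ 2 by rewrite sqr_sqrtr ?(sqn_ge0 ipP).
    by have := sqr_ge0 (a - b); nra.
  rewrite -mulr_sumr big_split /= ler_wpM2l// lerD//; exact: sqtail_sub.
have -> : M * (sqtail u n + sqtail v n) = 2 * r n by rewrite /r; field.
apply: (@limn_complex z r) => [p q|e e0].
  have [pq|qp] := leqP p q.
    by rewrite -normcN opprB; apply: le_trans (zr1 _ _ pq) _; rewrite lerDl.
  by apply: le_trans (zr1 _ _ (ltnW qp)) _; rewrite lerDr.
have e1 : 0 < e / (M + 1) by rewrite divr_gt0// ltr_wpDl.
have [N1 h1] := sqtail_cvg0 su e1; have [N2 h2] := sqtail_cvg0 sv e1.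
exists (maxn N1 N2) => p; rewrite geq_max => /andP[/h1 a1 /h2 a2].
have M1 : 0 < M + 1 by rewrite ltr_wpDl.
apply: (@le_trans _ _ (M / 2 * (e / (M + 1) + e / (M + 1)))).
  by rewrite ler_wpM2l// lerD.
have -> : M / 2 * (e / (M + 1) + e / (M + 1)) = M * e / (M + 1) by field; rewrite gt_eqF.
by rewrite ler_pdivrMr// mulrDr mulr1 mulrC lerDl ltW.
Qed.

Lemma square_summable_single (u : H) :
  square_summable (fun k => if k == 0%N then u else 0).
Proof.
apply/cvg_ex; exists (sqn (inner H) u); apply: cvg_near_cst; exists 1%N => // n /= n1.
rewrite /series /= (@big_cat_nat _ _ _ 1)//= big_nat1 eqxx big_nat_cond big1 ?addr0//.
move=> k /andP[/andP[k1 _] _]; rewrite gtn_eqF//.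
by rewrite -[LHS]/(sqn (inner H) 0) /sqn (ip0l ipP).
Qed.

Lemma sigma_weak_single (u v : H) :
  sigma_weak_functionals (fun T : bounded_op H => inner H (T u) v).
Proof.
exists (fun k => if k == 0%N then u else 0), (fun k => if k == 0%N then v else 0).
split; [exact: square_summable_single|exact: square_summable_single|] => T.
apply/esym/lim_near_cst; first exact: norm_hausdorff.
exists 1%N => // n /= n1.
rewrite /series /= (@big_cat_nat _ _ _ 1)//= big_nat1 eqxx big_nat_cond big1 ?addr0//.
by move=> k /andP[/andP[k1 _] _]; rewrite gtn_eqF// (ip0r ipP).
Qed.

(** [adjoint] is a chosen solution; uniqueness identifies it with any solution at hand. *)
Lemma adjointP (T S : bounded_op H) :
  (forall x y, inner H (T x) y = inner H x (S y)) -> adjoint T = S.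
Proof.
move=> TS; apply: val_inj; apply/funext => y; apply/eqP; rewrite -subr_eq0 -normr_eq0.
have h := @xgetPex _ (0 : bounded_op H)
  [set S | forall u v, inner H (T u) v = inner H u (S v)] (ex_intro _ S TS).
have : inner H (adjoint T y - S y) (adjoint T y - S y) = 0.
  by rewrite [LHS](ipDr ipP) (ipNr ipP) -h -TS subrr.
by rewrite inner_normE => /eqP; rewrite expf_eq0.
Qed.

End SigmaWeakFunctionals.

(** * Forms of positive operator matrices *)

Section OperatorForms.
Variables (R : realType).
Local Notation C := R[i].

(* Polarization *)
Lemma semi_inner_pos (V : lmodType C) (B : V -> V -> C) :
  (forall a u v w, B (a *: u + v) w = a * B u w + B v w) ->
  (forall a u v w, B w (a *: u + v) = a^* * B w u + B w v) ->
  (forall u, 0 <= B u u) -> semi_inner B.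
Proof.
move=> Bl Br B0; split=> // u v.
have im0 z : 0 <= z -> Im z = 0 :> R by case: z => p q; rewrite lecE => /andP[/eqP ->].
have imD (z w : C) : Im (z + w) = Im z + Im w by case: z w => ? ? [].
have e1 : Im (B u v) + Im (B v u) = 0.
  have := im0 _ (B0 (1 *: u + v)).
  rewrite Bl !Br rmorph1 !mul1r !imD (im0 _ (B0 u)) (im0 _ (B0 v)).
  by rewrite add0r addr0.
have e2 : Re (B u v) = Re (B v u).
  have := im0 _ (B0 ('i%C *: u + v)).
  rewrite Bl !Br mulrDr !imD mulrA.
  have -> : 'i%C * 'i%C^* = 1 :> C by apply/eqP; rewrite eq_complex /= !(mul0r, mul1r, mulr1, mulr0, mulrN, opprK, add0r, addr0, subr0, sub0r, oppr0) !eqxx.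
  rewrite mul1r (im0 _ (B0 u)) (im0 _ (B0 v)) add0r addr0.
  case: (B u v) (B v u) => p q [p' q'] /=.
  by rewrite !(mul0r, mul1r) /= => h; lra.
move: e1 e2; case: (B u v) (B v u) => p q [p' q'] /= h ->.
by apply/eqP; rewrite eq_complex /= eqxx /=; apply/eqP; lra.
Qed.

Variables (X : mos_data R) (H : hilbert R) (rho : X -> lop H).
Hypothesis rho_lin : linear rho.
Let ipP : semi_inner (inner H) := semi_inner_hilbert H.

Lemma op_form_linl n (k : nat -> nat -> X) a (h h1 h' : nat -> H) :
  op_form rho n k (a *: h + h1) h' = a * op_form rho n k h h' + op_form rho n k h1 h'.
Proof.
rewrite /op_form mulr_sumr -big_split; apply: eq_bigr => i _ /=.
rewrite mulr_sumr -big_split; apply: eq_bigr => j _ /=.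
by rewrite (bounded_op_linear (rho (k i j))) (ipDl ipP) (ipZl ipP).
Qed.

Lemma op_form_linr n (k : nat -> nat -> X) a (h h1 h' : nat -> H) :
  op_form rho n k h' (a *: h + h1) = a^* * op_form rho n k h' h + op_form rho n k h' h1.
Proof.
rewrite /op_form mulr_sumr -big_split; apply: eq_bigr => i _ /=.
rewrite mulr_sumr -big_split; apply: eq_bigr => j _ /=.
by rewrite -[(_ + _ : nat -> H) i]/(a *: h i + h1 i) (ipDr ipP) (ipZr ipP).
Qed.

Lemma op_form_D n (k k' : Minf X) h h' :
  op_form rho n (k + k') h h' = op_form rho n k h h' + op_form rho n k' h h'.
Proof.
rewrite /op_form -big_split; apply: eq_bigr => i _ /=.
rewrite -big_split; apply: eq_bigr => j _ /=.
rewrite -[LHS]/(inner H ((rho (k i j + k' i j) : bounded_op H) (h j)) (h' i)).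
by rewrite (lin_D rho_lin) -(ipDl ipP).
Qed.

Lemma op_form_scale n a (k : Minf X) h h' :
  op_form rho n (a *: k) h h' = a * op_form rho n k h h'.
Proof.
rewrite /op_form mulr_sumr; apply: eq_bigr => i _ /=.
rewrite mulr_sumr; apply: eq_bigr => j _ /=.
rewrite -[LHS]/(inner H ((rho (a *: k i j) : bounded_op H) (h j)) (h' i)).
by rewrite (lin_Z rho_lin) -(ipZl ipP).
Qed.

Lemma op_form_semi_inner n (k : Minf X) : mbnd n k -> mcone (amp rho k) ->
  semi_inner (op_form rho n k).
Proof.
move=> nk ck; apply: semi_inner_pos.
- by move=> *; rewrite op_form_linl.
- by move=> *; rewrite op_form_linr.
- by move=> h; exact: op_form_pos.
Qed.

(** The form of [k] is a semi-inner product whose quadratic form vanishes, hence it is 0 by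
    Cauchy-Schwarz. *)
Lemma op_cone_antisym (k : Minf X) : mcone (amp rho k) -> mcone (amp rho (- k)) ->
  mnorm (amp rho k) <= 0.
Proof.
move=> ck cNk; have nk := mdimP k; set n := mdim k in nk.
have siP := op_form_semi_inner nk ck.
apply: (mnorm_op_le rho_lin nk) => // h h'; rewrite mul0r.
suff sq0 (u : nat -> H) : sqn (op_form rho n k) u = 0.
  by apply: le_trans (cauchy_schwarz siP h h') _; rewrite sq0 sqrtr0 mul0r.
apply/eqP; rewrite eq_le (sqn_ge0 siP) andbT.
have nNk : mbnd n (- k) by move=> i j /nk kij; rewrite mxN kij oppr0.
have := op_form_pos rho_lin u nNk cNk.
rewrite -scaleN1r op_form_scale mulN1r => h0.
by rewrite -oppr_ge0 /sqn -cReN; exact: ge0_Re.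
Qed.

End OperatorForms.

Lemma mcone_sub (R : realType) (X : mos_data R) (A : set X) (x : Minf (sub_mos A)) :
  mcone x = mcone (amp val (x : Minf (subsp A))).
Proof. by []. Qed.

(** * Weak-* properties of the universal representation *)

Section UniversalDual.
Variables (R : realType) (X : mos_data R).
Local Notation C := R[i].
Hypothesis smosX : is_smos X.
Variable kappa : R.
Local Notation Y := (dual X).
Local Notation D := (dual (dual X)).
Let smosY : is_smos Y := dual_smos smosX.
Let smosD : is_smos D := dual_smos smosY.
Local Notation I := (uidx X).
Local Notation E := (ell2 R I).
Local Notation H := (ell2_hilbert R I).
Local Notation umap := (umap smosX).
Local Notation A := (canonical_predual (dual X)).
Let ipP : semi_inner (inner H) := semi_inner_hilbert H.
Hypothesis kappa_gt0 : 0 < kappa.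
Hypothesis umap_lb : forall F : Minf D, mnorm F <= kappa * mnorm (amp umap F).
Hypothesis vecform : forall f : Y, exists u v : E,
  (forall F : D, (F : functional Y) f = inner H ((umap F : bounded_op H) u) v) /\
  Num.sqrt (ell2_sqn u) * Num.sqrt (ell2_sqn v) <= 2 * kappa * xnorm f.

Local Notation nrm u := (Num.sqrt (ell2_sqn u)).

Definition omega_fun (u v : E) : D -> C^o := fun F => inner H ((umap F : bounded_op H) u) v.

Lemma omega_bound u v (F : D) : normc (omega_fun u v F) <= xnorm F * (nrm u * nrm v).
Proof.
have := uform_le smosX (fun=> u) (fun=> v) (@mbnd_mx1 R D F).
by rewrite /uform !big_ord1 mx1E /vsqn !big_ord1 !inner_sqn.
Qed.

Lemma omega_functional u v : omega_fun u v \in @is_functional R D.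
Proof.
apply/asboolP; split; last first.
  by exists (nrm u * nrm v) => F; rewrite mulrC; exact: omega_bound.
move=> a F G; rewrite /omega_fun umap_linear.
rewrite -[LHS]/(inner H (a *: (umap F : bounded_op H) u + (umap G : bounded_op H) u) v).
by rewrite (ipDl ipP) (ipZl ipP).
Qed.

Definition omega u v : dual D := MkFunctional (omega_functional u v).

Lemma omega_le u v : xnorm (omega u v) <= nrm u * nrm v.
Proof.
apply: (xnorm_functional_le smosD) => [|F]; first by rewrite mulr_ge0 ?sqrtr_ge0.
by rewrite mulrC; exact: omega_bound.
Qed.

Lemma omegaDl a u u' v : omega (a *: u + u') v = a *: omega u v + omega u' v.
Proof.
apply: functional_eq => F.
rewrite -[LHS]/(inner H ((umap F : bounded_op H) (a *: u + u')) v).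
by rewrite (bounded_op_linear (umap F)) (ipDl ipP) (ipZl ipP).
Qed.

Lemma omegaDr a u v v' : omega u (a *: v + v') = a^* *: omega u v + omega u v'.
Proof.
apply: functional_eq => F.
rewrite -[LHS]/(inner H ((umap F : bounded_op H) u) (a *: v + v')).
by rewrite (ipDr ipP) (ipZr ipP).
Qed.

Let subA : is_subspace (A : set (dual D)) := canonical_predual_subspace smosX.
Let closedA : norm_closed (@xnorm R (dual D)) A := canonical_predual_closed smosX.

Lemma omega0l v : A (omega 0 v).
Proof.
have -> : omega 0 v = 0; last exact: subA.1.
by apply: functional_eq => F; rewrite /= /omega_fun (lin_0 (bounded_op_linear (umap F))) (ip0l ipP).
Qed.

Lemma omega0r u : A (omega u 0).
Proof.
have -> : omega u 0 = 0; last exact: subA.1.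
by apply: functional_eq => F; rewrite /= /omega_fun (ip0r ipP).
Qed.

Lemma omega_delta p q : A (omega (delta q) (delta p)).
Proof.
have [h hh] := umap_delta smosX p q; exists h => //.
by apply: functional_eq => F; rewrite (bidual_mapE smosY) -hh.
Qed.

Lemma omega_trunc s r x y : uniq s -> uniq r -> A (omega (trunc s x) (trunc r y)).
Proof.
move=> us ur; rewrite !trunc_delta//.
elim: r {ur} => [|p r IH]; rewrite ?big_nil ?big_cons; first exact: omega0r.
rewrite omegaDr; apply: subA.2 => //.
elim: s {us IH} => [|q s IH]; rewrite ?big_nil ?big_cons; first exact: omega0l.
by rewrite omegaDl; apply: subA.2 => //; exact: omega_delta.
Qed.

Lemma trunc_nrm_approx (x : E) (t e : R) : 0 <= t -> 0 < e ->
  exists s, uniq s /\ nrm (x - trunc s x) * t < e.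
Proof.
move=> t0 e0; pose d := e / (t + 1); have t1 : 0 < t + 1 by rewrite ltr_wpDl.
have d0 : 0 < d by rewrite divr_gt0.
have [s [us hs]] := trunc_approx x (exprn_gt0 2 d0); exists s; split=> //.
apply: (@le_lt_trans _ _ (d * t)).
  by rewrite ler_wpM2r// -[leRHS]ger0_norm ?(ltW d0)// -sqrtr_sqr ler_wsqrtr.
by rewrite /d mulrAC ltr_pdivrMr// ltr_pM2l// ltrDl.
Qed.

(** Matrix coefficients at finitely supported vectors are combinations of those at [delta], which
    are evaluations at elements of X^*. The predual is norm closed, and truncating one vector at a
    time gives norm approximations. *)
Lemma omega_predual u v : A (omega u v).
Proof.
have step r y : uniq r -> A (omega u (trunc r y)).
  move=> ur; apply: closedA => e e0.
  have [s [us hs]] := trunc_nrm_approx u (sqrtr_ge0 (ell2_sqn (trunc r y))) e0.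
  exists (omega (trunc s u) (trunc r y)); first exact: omega_trunc.
  apply: le_lt_trans hs; rewrite [X in xnorm X]addrC -scaleN1r -omegaDl.
  by rewrite scaleN1r [- _ + _]addrC; exact: omega_le.
apply: closedA => e e0.
have [s [us hs]] := trunc_nrm_approx v (sqrtr_ge0 (ell2_sqn u)) e0.
exists (omega u (trunc s v)); first exact: step.
apply: le_lt_trans hs; rewrite mulrC [X in xnorm X]addrC -scaleN1r.
have -> : -1 = (-1)^* :> C by rewrite rmorphN rmorph1.
by rewrite -omegaDr scaleN1r [- _ + _]addrC; exact: omega_le.
Qed.

Lemma predual_sum n (f : nat -> dual D) : (forall k, A (f k)) ->
  A (\sum_(0 <= k < n) f k).
Proof.
move=> Af; elim: n => [|n IH]; first by rewrite big_geq//; exact: subA.1.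
by rewrite big_nat_recr//= addrC -[f n]scale1r; apply: subA.2.
Qed.

Lemma sigma_weak_predual w : sigma_weak_functionals w ->
  exists2 a : dual D, A a & (fun F : D => w (umap F)) = fapp a.
Proof.
move=> [u [v [su sv wE]]].
pose S n : dual D := \sum_(0 <= k < n) omega (u k) (v k).
have SE n F : S n F = \sum_(0 <= k < n) inner H ((umap F : bounded_op H) (u k)) (v k).
  by rewrite /S fapp_sum.
pose t n := sqtail u n + sqtail v n.
have tail n F : normc (w (umap F) - S n F) <= xnorm F * t n.
  rewrite wE SE; apply: sigma_weak_tail => //; first exact: mnorm_ge0.
  by move=> x y; rewrite !inner_sqn; exact: omega_bound.
have t0 n : 0 <= t n by rewrite addr_ge0//; exact: sqtail_ge0.
have tlim e : 0 < e -> exists n, t n <= e.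
  move=> e0; have e2 : 0 < e / 2 by rewrite divr_gt0.
  have [N1 h1] := sqtail_cvg0 su e2; have [N2 h2] := sqtail_cvg0 sv e2.
  exists (maxn N1 N2); rewrite [e]splitr.
  by apply: lerD; [apply: h1; rewrite leq_maxl|apply: h2; rewrite leq_maxr].
have wf : (fun F : D => w (umap F)) \in @is_functional R D.
  apply/asboolP; split; last first.
    exists (t 0) => F; have := tail 0%N F.
    by rewrite SE big_geq// subr0 mulrC.
  move=> a F G; apply/eqP; rewrite -subr_eq0; apply/eqP.
  (* Since [w] is given as a limit of series, its linearity along [umap] is derived from that of the
     partial sums and the uniform tail estimate. *)
  apply: (@normc_eq0_approx _ _ (xnorm (a *: F + G) + normc a * xnorm F + xnorm G)) => e e0.
  have [n tn] := tlim e e0.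
  set z := w _; set x := w (umap F); set y := w (umap G).
  have -> : z - (a *: x + y) =
      (z - S n (a *: F + G)) + - (a * (x - S n F)) + - (y - S n G) :> C.
    have -> : S n (a *: F + G) = a * S n F + S n G :> C by exact: functional_linear.
    by rewrite -[a *: x]/(a * x); ring.
  apply: (@le_trans _ _ ((xnorm (a *: F + G) + normc a * xnorm F + xnorm G) * t n)).
    rewrite !mulrDl; apply: le_trans (le_normcD _ _) _; apply: lerD; last by rewrite normcN; exact: tail.
    apply: le_trans (le_normcD _ _) _; apply: lerD; first exact: tail.
    by rewrite normcN ComplexField.Normc.normcM -mulrA ler_wpM2l ?normc_ge0//; exact: tail.
  by rewrite mulrC ler_wpM2r// !addr_ge0 ?mulr_ge0 ?normc_ge0//; exact: mnorm_ge0.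
exists (MkFunctional wf) => //.
apply: closedA => e e0; have [n tn] := tlim _ (divr_gt0 e0 (ltr0n R 2)).
exists (S n); first by apply: predual_sum => k; exact: omega_predual.
apply: (@le_lt_trans _ _ (t n)); last by apply: le_lt_trans tn _; lra.
by apply: (xnorm_functional_le smosD) => // F; rewrite mulrC; exact: tail.
Qed.

Definition umap_range : set (lop H) := range umap.
Local Notation B := umap_range.

Lemma umap_range_subspace : is_subspace B.
Proof.
split; first by exists 0 => //; exact: (lin_0 (umap_linear smosX)).
by move=> a _ _ [F _ <-] [G _ <-]; exists (a *: F + G); rewrite ?umap_linear.
Qed.

Lemma adjoint_umap (F : D) : adjoint (umap F : bounded_op H) = umap (star F).
Proof. by apply: adjointP => x y; exact: umap_star. Qed.

Lemma umap_range_selfadjoint : selfadjoint_subspace B.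
Proof.
split; first exact: umap_range_subspace.
by move=> _ [F _ <-]; exists (star F); rewrite //= adjoint_umap.
Qed.

Definition uphi (F : D) : sub_mos B := insubd 0 (umap F).

Lemma val_uphi F : val (uphi F : subsp B) = umap F.
Proof. by apply: insubd_subsp; [exact: umap_range_subspace|exists F]. Qed.

Lemma uphi_linear : linear uphi.
Proof.
move=> a F G; apply: val_inj; rewrite valD_subsp valZ_subsp !val_uphi.
exact: umap_linear.
Qed.

Lemma amp_uphi (F : Minf D) : amp val (amp uphi F : Minf (subsp B)) = amp umap F :> Minf (lop H).
Proof.
have u0 := lin_0 uphi_linear; have um0 := lin_0 (umap_linear smosX).
apply: Minf_eq => i j; rewrite !ampE// ?val_uphi//.
Qed.

(** Injectivity holds because every [f] in X^* is a vector functional, so the operator determines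
    all values of F. *)
Lemma uphi_bij : exists2 psi : sub_mos B -> D, cancel uphi psi & cancel psi uphi.
Proof.
have /choice[psi hpsi] : forall y : sub_mos B, exists F : D, uphi F = y.
  move=> y; have [F _ FE] := subsp_mem (y : subsp B) umap_range_subspace.
  by exists F; apply: val_inj; rewrite val_uphi.
exists psi => // F; apply: functional_eq => f; have [u [v [uv _]]] := vecform f.
by rewrite !uv -!val_uphi hpsi.
Qed.

Lemma uphi_order_mono : completely_order_mono uphi.
Proof.
have [psi uK Ku] := uphi_bij.
split; [|exact: can_inj uK|].
  split; first exact: uphi_linear.
  move=> F; apply: val_inj; rewrite val_uphi.
  rewrite insubd_subsp; [|exact: umap_range_subspace|].
    by rewrite val_uphi; exact/esym/adjoint_umap.
  by rewrite val_uphi; apply: umap_range_selfadjoint.2; exists F.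
move=> F sF; rewrite mcone_sub amp_uphi.
by split; [exact: umap_cone|exact: umap_cone_inv].
Qed.

Lemma mnorm_uphi (F : Minf D) : mnorm (amp uphi F) = mnorm (amp umap F).
Proof. by rewrite mnorm_sub amp_uphi. Qed.

Lemma uphi_embedding : complete_embedding uphi.
Proof.
split; first exact: uphi_linear.
  by exists 1 => F; rewrite mul1r mnorm_uphi; exact: mnorm_umap_le.
exists kappa^-1; first by rewrite invr_gt0.
by move=> F F1; rewrite mnorm_uphi -[kappa^-1]mulr1 -F1 ler_pdivrMl.
Qed.

Lemma uphi_isometry : kappa <= 1 -> complete_isometry uphi.
Proof.
move=> k1; split; first exact: uphi_linear.
move=> F; rewrite mnorm_uphi; apply/eqP; rewrite eq_le mnorm_umap_le /=.
apply: le_trans (umap_lb F) _; rewrite ler_piMl//.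
exact: (mnorm_op_ge0 (umap_linear smosX)).
Qed.

Lemma uphi_homeomorphism :
  homeomorphism (uphi : wstar (A : set (dual D)) -> sigma_weak_sub B).
Proof.
have [psi uK Ku] := uphi_bij.
split.
  apply: continuous_weak_top => _ [w sw <-].
  have [a Aa wE] := sigma_weak_predual sw.
  have -> : (w \o val) \o uphi = fapp a.
    by rewrite -wE; apply/funext => F /=; rewrite val_uphi.
  by apply: weak_top_gen; exists a.
exists psi; first by split.
apply: continuous_weak_top => _ [_ [f _ <-] <-].
have [u [v [uv _]]] := vecform f.
have -> : fapp (bidual_map f) \o psi = (fun T : bounded_op H => inner H (T u) v) \o val.
  by apply/funext => y /=; rewrite (bidual_mapE smosY) uv -val_uphi Ku.
by apply: weak_top_gen; exists (fun T : bounded_op H => inner H (T u) v) => //;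
  exact: sigma_weak_single.
Qed.

Lemma sigma_weak_cont_inner (T : bounded_op H) (u v : E) :
  weak_cont (@sigma_weak_functionals R H) T (fun T' => inner H (T' u) v).
Proof. by apply: weak_cont_gen; exact: sigma_weak_single. Qed.

Lemma umap_range_closed : closed (B : set (sigma_weak H)).
Proof.
move=> T clT.
have /choice[uv huv] : forall f : Y, exists uv : E * E,
   (forall F : D, (F : functional Y) f = inner H ((umap F : bounded_op H) uv.1) uv.2) /\
   nrm uv.1 * nrm uv.2 <= 2 * kappa * xnorm f.
  by move=> f; have [u [v h]] := vecform f; exists (u, v).
pose t (T : bounded_op H) f : C := inner H (T (uv f).1) (uv f).2.
have [M M0 hM] := bounded_op_bound (T : bounded_op H).
pose F_ : Y -> C^o := t T.
(* One pair of vectors is fixed for each [f], with no linearity in [f]; the estimate on their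
   lengths supplies boundedness. *)
have FP : F_ \in @is_functional R Y.
  apply/asboolP; split; last first.
    exists (M * (2 * kappa)) => f; apply: le_trans (hM _ _) _.
    by rewrite -mulrA ler_wpM2l// !inner_sqn; exact: (huv f).2.
  move=> a f g; apply/eqP; rewrite -subr_eq0; apply/eqP.
  (* The defect of linearity is a sigma-weakly continuous function of the operator and vanishes on
     the range, hence also at [T]. *)
  have cw : weak_cont (@sigma_weak_functionals R H) T
      (fun T' => t T' (a *: f + g) + ((- a) * t T' f + (-1) * t T' g)).
    apply: weak_contD; first exact: sigma_weak_cont_inner.
    by apply: weak_contD; apply: weak_contZ; exact: sigma_weak_cont_inner.
  have := weak_closure_eq0 clT cw.
  rewrite mulNr mulN1r -opprD; apply.
  move=> _ [F _ <-]; rewrite /t -!(huv _).1.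
  have -> : (F : functional Y) (a *: f + g) = a * F f + F g :> C.
    exact: functional_linear.
  by rewrite mulNr mulN1r -opprD subrr.
pose F : D := MkFunctional FP.
have [M' M'0 hM'] := bounded_op_bound (umap F : bounded_op H).
have tdelta q : (T : bounded_op H) (delta q) = (umap F : bounded_op H) (delta q).
  apply: ell2_eq => p; rewrite -!inner_delta.
  have [h hh] := umap_delta smosX p q; rewrite hh.
  apply/eqP; rewrite -subr_eq0; apply/eqP.
  (* The coefficient at two [delta] vectors and the coefficient at the vectors fixed for [h] agree
     on the range, hence also at [T]. *)
  have cw : weak_cont (@sigma_weak_functionals R H) T
      (fun T' => inner H (T' (delta q)) (delta p) + (-1) * t T' h).
    by apply: weak_contD; [|apply: weak_contZ]; exact: sigma_weak_cont_inner.
  have := weak_closure_eq0 clT cw; rewrite mulN1r; apply.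
  by move=> _ [G _ <-]; rewrite hh /t -(huv h).1 mulN1r subrr.
have ttrunc s x : uniq s ->
    (T : bounded_op H) (trunc s x) = (umap F : bounded_op H) (trunc s x).
  move=> us; rewrite trunc_delta//.
  rewrite (lin_sum (bounded_op_linear T)) (lin_sum (bounded_op_linear (umap F))).
  apply: eq_bigr => p _.
  by rewrite (lin_Z (bounded_op_linear T)) (lin_Z (bounded_op_linear (umap F))) tdelta.
exists F => //; apply: val_inj; apply/funext => x /=; apply: ell2_eq => p.
rewrite -!inner_delta; apply/eqP; rewrite -subr_eq0; apply/eqP.
apply: (@normc_eq0_approx _ _ (M' + M)) => e e0.
(* The two operators agree on truncations; boundedness extends the equality to all vectors. *)
have [s [us hs]] := trunc_nrm_approx x (sqrtr_ge0 (ell2_sqn (delta p))) e0.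
have -> : inner H ((umap F : bounded_op H) x) (delta p) - inner H ((T : bounded_op H) x) (delta p) =
   inner H ((umap F : bounded_op H) (x - trunc s x)) (delta p) -
   inner H ((T : bounded_op H) (x - trunc s x)) (delta p).
  have sub (S : bounded_op H) : S (x - trunc s x) = S x - S (trunc s x).
    by rewrite [x - _]addrC -scaleN1r (bounded_op_linear S) scaleN1r addrC.
  by rewrite !sub !(ipDl ipP) !(ipNl ipP) ttrunc//; ring.
apply: le_trans (le_normcD _ _) _; rewrite normcN mulrDr.
apply: lerD.
  by apply: le_trans (hM' _ _) _; rewrite [e * _]mulrC ler_wpM2l// !inner_sqn ltW.
by apply: le_trans (hM _ _) _; rewrite [e * _]mulrC ler_wpM2l// !inner_sqn ltW.
Qed.

(** If F and - F are positive, the image of F has norm 0, and the lower bound [umap_lb] gives F =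
    0. *)
Lemma bidual_mos : is_mos D.
Proof.
split; first exact: smosD.
move=> F cF cNF; apply: (mnorm0_eq0 smosD); apply/eqP; rewrite eq_le (mnorm_ge0 smosD) andbT.
apply: le_trans (umap_lb F) _; rewrite pmulr_rle0//.
by apply: (op_cone_antisym (umap_linear smosX)); exact: umap_cone.
Qed.

Lemma bidual_dual_quasi : dual_quasi_operator_system D A.
Proof.
split; first by split; [exact: bidual_mos|exact: canonical_predual_is_predual].
exists H, B, uphi; split.
- exact: umap_range_selfadjoint.
- exact: umap_range_closed.
- split; [|exact: uphi_order_mono|exact: uphi_embedding].
  by have [psi ? ?] := uphi_bij; exists psi.
- exact: uphi_homeomorphism.
Qed.

Lemma bidual_dual_operator_system : kappa <= 1 -> dual_operator_system D A.
Proof.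
move=> k1; have [mD [H' [B' [phi [sB cB iB hB]]]]] := bidual_dual_quasi.
split=> //; exists H, B, uphi; split.
- exact: umap_range_selfadjoint.
- exact: umap_range_closed.
- split; [|exact: uphi_order_mono|exact: uphi_embedding].
  by have [psi ? ?] := uphi_bij; exists psi.
- exact: uphi_isometry.
- exact: uphi_homeomorphism.
Qed.

End UniversalDual.

(** * Concrete operator systems *)

Section GramBound.
Variables (R : realType) (H : hilbert R).
Local Notation C := R[i].
Let ipP : semi_inner (inner H) := semi_inner_hilbert H.

(** [scal_mnorm] controls scalar vectors only. Writing the positive definite matrix (l + d) 1 - G as
    W^* W makes its form on vectors of H a sum of squares, which is the inequality up to [d]. *)
Lemma gram_vsqn_le n p (b : 'I_p -> Minf C^o) (h : nat -> H) :
  (forall k, mbnd n (b k)) ->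
  \sum_k vsqn n (fun j => \sum_(s < n) b k j s *: h s) <=
  scal_mnorm (\sum_k gram (b k)) * vsqn n h.
Proof.
move=> nb; set G := \sum_k gram (b k); set l := scal_mnorm G.
have l0 : 0 <= l by exact: scal_mnorm_ge0.
have GE i j : G i j = \sum_k gram (b k) i j by exact: mx_sum.
have nG : mbnd n G by move=> i j ij; rewrite GE big1// => k _; exact: mbnd_gram.
have v0 : 0 <= vsqn n h by apply: sumr_ge0 => i _; exact: sqn_ge0.
set T := \sum_k _.
suff bnd d : 0 < d -> T <= (l + d) * vsqn n h.
  apply/ler_addgt0Pr => e e0; have w0 : 0 < vsqn n h + 1 by rewrite ltr_wpDl.
  apply: le_trans (bnd _ (divr_gt0 e0 w0)) _.
  by rewrite mulrDl lerD2l mulrAC ler_pdivrMr// ler_wpM2l ?(ltW e0)// lerDl.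
move=> d0; pose a (i j : nat) : C := (if i == j then (l + d)%:C%C else 0) - G i j.
have aH (i j : 'I_n) : a j i = (a i j)^*.
  rewrite /a rmorphB /= eq_sym; congr (_ - _).
    by case: ifP; rewrite ?conj_real ?conjC0.
  rewrite !GE rmorph_sum; apply: eq_bigr => k _ /=.
  rewrite !(gramE _ _ (nb k)) rmorph_sum; apply: eq_bigr => r _ /=.
  by rewrite rmorphM /= conjCK mulrC.
have apos (c : 'I_n -> C) : d * \sum_i normc (c i) ^+ 2 <=
    Re (\sum_(i < n) \sum_(j < n) a i j * c j * (c i)^*).
  pose c' q : C := oapp c 0 (insub q).
  have c'E (i : 'I_n) : c' i = c i by rewrite /c' valK.
  have -> : \sum_(i < n) \sum_(j < n) a i j * c j * (c i)^* =
      ((l + d) * \sum_i normc (c i) ^+ 2)%:C%C - scal_form n G c' c'.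
    rewrite mulr_sumr rmorph_sum -sumrB; apply: eq_bigr => i _ /=.
    rewrite /a; under eq_bigr => j _ do rewrite mulrBl mulrBl.
    rewrite sumrB; congr (_ - _).
      rewrite (bigD1 i) //= eqxx big1 ?addr0 => [|j ji].
        rewrite rmorphM -mulrA /=; congr (_ * _).
        have := mul_conjC_ge0 (c i) => /ge0_complexE ->.
        by rewrite sqr_normc_mulc.
      by rewrite eq_sym val_eqE (negbTE ji) !mul0r.
    by apply: eq_bigr => j _; rewrite !c'E.
  have sE : \sum_(i < n) normc (c' i) ^+ 2 = \sum_i normc (c i) ^+ 2.
    by apply: eq_bigr => i _; rewrite c'E.
  have := le_trans (Re_le_normc _) (scal_mnorm_form c' c' nG).
  rewrite -expr2 sqr_sqrtr ?sE; last by apply: sumr_ge0 => i _; exact: sqr_ge0.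
  by rewrite cReB -/l /= => le; rewrite mulrDl; lra.
have [W [Wi [nW _ _ _ Wa]]] := hermitian_sqrt d0 aH apos.
have := gram_vec h nW Wa.
have -> : \sum_(i < n) \sum_(j < n) inner H (a i j *: h j) (h i) =
    ((l + d) * vsqn n h - T)%:C%C.
  rewrite rmorphB /= -[in (T)%:C%C]/T.
  have -> : (T)%:C%C = \sum_(i < n) \sum_(j < n) inner H ((G i j : C) *: h j) (h i).
    rewrite rmorph_sum /=.
    under eq_bigr => k _ do rewrite -(@gram_vec _ _ n (b k) (fun i j => gram (b k) i j) h (nb k) (fun _ _ => erefl)).
    rewrite exchange_big; apply: eq_bigr => i _ /=.
    rewrite exchange_big; apply: eq_bigr => j _ /=.
    by rewrite GE scaler_suml (ip_suml ipP).
  rewrite mulr_sumr rmorph_sum -sumrB; apply: eq_bigr => i _ /=.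
  rewrite /a; under eq_bigr => j _ do rewrite scalerBl (ipDl ipP) (ipNl ipP).
  rewrite sumrB; congr (_ - _).
  rewrite (bigD1 i) //= eqxx big1 ?addr0 => [|j ji].
    by rewrite (ipZl ipP) (ip_sqn ipP) -rmorphM.
  by rewrite eq_sym val_eqE (negbTE ji) scale0r (ip0l ipP).
move=> /(congr1 (@complex.Re R)) /= e; rewrite -subr_ge0 e.
by apply: sumr_ge0 => r _; exact: sqn_ge0.
Qed.

End GramBound.

(** * Operator space estimates for matrices of operators *)

Section Representations.
Variables (R : realType) (X : mos_data R) (H : hilbert R) (rho : X -> lop H).
Local Notation C := R[i].
Hypothesis rho_lin : linear rho.
Let ipP : semi_inner (inner H) := semi_inner_hilbert H.

(* Where no adjoint exists, [star] takes its default value 0, which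
   [star \o star = id] excludes. *)
Lemma rep_adjoint : injective rho -> (forall x : X, star (star x) = x) ->
  (forall x : X, rho (star x) = star (rho x)) ->
  forall (x : X) (u v : H), inner H ((rho x : bounded_op H) u) v =
    inner H u ((rho (star x) : bounded_op H) v).
Proof.
move=> inj stK rs x; rewrite rs.
have r0 := lin_0 rho_lin.
have [[S hS]|nS] := pselect (exists S : bounded_op H, forall u v : H,
    inner H ((rho x : bounded_op H) u) v = inner H u (S v)).
  by move=> u v; have -> : star (rho x) = S by exact: adjointP.
have s0 : star (rho x) = 0 by rewrite /= /adjoint xgetPN// => S hS; apply: nS; exists S.
have a0 : star (0 : lop H) = 0.
  by apply: adjointP => u v; rewrite (ip0l ipP) (ip0r ipP).
have x0 : x = 0.
  have sx : star x = 0 by apply: inj; rewrite rs s0 r0.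
  by rewrite -[x]stK sx; apply: inj; rewrite rs r0.
by move=> u v; rewrite s0 x0 r0 (ip0l ipP) (ip0r ipP).
Qed.

Lemma op_form_unit n (k : nat -> nat -> X) i j (u v : H) : (i < n)%N -> (j < n)%N ->
  op_form rho n k (fun q => if q == j then u else 0) (fun p => if p == i then v else 0) =
  inner H ((rho (k i j) : bounded_op H) u) v.
Proof.
move=> ni nj; rewrite /op_form (bigD1 (Ordinal ni)) //= [X in _ + X]big1 ?addr0; last first.
  move=> p; rewrite -val_eqE => /= /negbTE pi; apply: big1 => q _.
  by rewrite pi (ip0r ipP).
rewrite (bigD1 (Ordinal nj)) //= !eqxx big1 ?addr0// => q.
rewrite -val_eqE => /= /negbTE ->.
by rewrite (lin_0 (bounded_op_linear (rho _))) (ip0l ipP).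
Qed.

Lemma op_form_eq (inj : injective rho) (x y : Minf X) :
  (forall n h h', mbnd n x -> mbnd n y -> op_form rho n x h h' = op_form rho n y h h') ->
  x = y.
Proof.
move=> xy; have [m [mx my]] := mbnd_common x y; apply: Minf_eq => i j.
pose n := maxn m (maxn i j).+1.
have nx : mbnd n x by apply: mbnd_le mx; rewrite leq_maxl.
have ny : mbnd n y by apply: mbnd_le my; rewrite leq_maxl.
have ni : (i < n)%N by rewrite /n leq_max ltnS leq_maxl orbT.
have nj : (j < n)%N by rewrite /n leq_max ltnS leq_maxr orbT.
apply: inj; apply: val_inj; apply/funext => u; apply/eqP.
rewrite -subr_eq0 -normr_eq0; set w := _ - _.
suff : inner H w w = 0 by rewrite inner_normE => /eqP; rewrite expf_eq0.
have -> : inner H w w = inner H ((rho (x i j) : bounded_op H) u) w -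
    inner H ((rho (y i j) : bounded_op H) u) w by rewrite {1}/w (ipDl ipP) (ipNl ipP).
by rewrite -!(op_form_unit _ _ _ ni nj) xy// subrr.
Qed.

Lemma op_form0 n h h' : op_form rho n (0 : Minf X) h h' = 0.
Proof.
rewrite /op_form big1// => i _; rewrite big1// => j _.
by rewrite -[X in rho X]/(0 : X) (lin_0 rho_lin) (ip0l ipP).
Qed.

Lemma op_form_sum n p (z : 'I_p -> Minf X) h h' :
  op_form rho n (\sum_k z k) h h' = \sum_k op_form rho n (z k) h h'.
Proof.
apply: (big_morph (fun z : Minf X => op_form rho n z h h')) => [x y|].
  exact: op_form_D.
exact: op_form0.
Qed.

Lemma op_form_widen n m (x : Minf X) h h' : mbnd n x -> (n <= m)%N ->
  op_form rho m x h h' = op_form rho n x h h'.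
Proof.
move=> nx nm; apply: (@sum_ord2_widen _ n m
  (fun i j => inner H ((rho (x i j) : bounded_op H) (h j)) (h' i)) nm) => p q pq.
by rewrite nx// (lin_0 rho_lin) (ip0l ipP).
Qed.

Lemma mcone_op_form n (x : Minf X) : mbnd n x ->
  (forall h, 0 <= op_form rho n x h h) -> mcone (amp rho x).
Proof.
move=> nx h0; apply/(opmx_posP ipP (op_supp rho_lin nx)) => v.
by rewrite op_form_opmx.
Qed.

(** The scalar matrices pass to the vectors; Cauchy-Schwarz over k and [gram_vsqn_le] give the two
    Gram norms. *)
Lemma mnorm_amp_sandwich p (a b : 'I_p -> Minf C^o) (x : 'I_p -> Minf X) :
  mnorm (amp rho (\sum_k sandwich (a k) (x k) (b k))) <=
  Num.sqrt (scal_mnorm (\sum_k gram (a k))) *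
  Num.sqrt (scal_mnorm (\sum_k gram (b k))) *
  \big[Num.max/0]_k mnorm (amp rho (x k)).
Proof.
set S := \sum_k sandwich _ _ _; set m := \big[Num.max/0]_k _.
have m0 : 0 <= m by exact: bigmax_ge_id.
pose n := maxn (mdim S) (\max_k maxn (mdim (x k)) (maxn (mdim (a k)) (mdim (b k)))).
have nS : mbnd n S by apply: mbnd_le (mdimP S); rewrite leq_maxl.
have nk k : (maxn (mdim (x k)) (maxn (mdim (a k)) (mdim (b k))) <= n)%N.
  by rewrite /n leq_max (leq_bigmax k) orbT.
have nx k : mbnd n (x k) by apply: mbnd_le (mdimP _); apply: leq_trans (nk k); rewrite leq_maxl.
have na k : mbnd n (a k).
  by apply: mbnd_le (mdimP _); apply: leq_trans (nk k); rewrite !leq_max leqnn orbT.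
have nb k : mbnd n (b k).
  by apply: mbnd_le (mdimP _); apply: leq_trans (nk k); rewrite !leq_max leqnn !orbT.
apply: (mnorm_op_le rho_lin nS); first by rewrite !mulr_ge0 ?sqrtr_ge0.
move=> h h'; rewrite op_form_sum; apply: le_trans (normc_sum _ _ _) _.
pose ah k i := \sum_(r < n) a k i r *: h' r.
pose bh k j := \sum_(s < n) b k j s *: h s.
apply: (@le_trans _ _ (m * \sum_k Num.sqrt (vsqn n (bh k)) * Num.sqrt (vsqn n (ah k)))).
  rewrite mulr_sumr; apply: ler_sum => k _; rewrite (op_form_sandwich rho_lin _ _ _ _ _ (nx k)).
  apply: le_trans (op_form_le rho_lin _ _ (nx k)) _.
  rewrite ler_wpM2r ?mulr_ge0 ?sqrtr_ge0//; exact: (le_bigmax _ (fun k => mnorm (amp rho (x k)))).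
rewrite [leRHS](_ : _ = m * (Num.sqrt (scal_mnorm (\sum_k gram (b k)) * vsqn n h) *
   Num.sqrt (scal_mnorm (\sum_k gram (a k)) * vsqn n h'))); last first.
  have alg (s t r q z : R) : s * t * r * (q * z) = r * (t * q * (s * z)) by ring.
  by rewrite !sqrtrM ?scal_mnorm_ge0//; exact: alg.
rewrite ler_wpM2l//.
have v0 (g : nat -> H) : 0 <= vsqn n g by apply: sumr_ge0 => i _; exact: sqn_ge0.
apply: le_trans (cauchy_schwarz_seq _ _ _ _) _ => [k|k|]; [exact: v0|exact: v0|].
by apply: ler_pM; rewrite ?sqrtr_ge0// ler_wsqrtr//; exact: gram_vsqn_le.
Qed.

End Representations.

(** * Self-adjoint subspaces of L(H) as operator systems *)

Section SubMos.
Variables (R : realType) (H : hilbert R) (B : set (lop H)).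
Local Notation C := R[i].
Hypothesis saB : selfadjoint_subspace B.
Local Notation W := (sub_mos B).
Hypothesis star_inv : is_involution W.
Let ipP : semi_inner (inner H) := semi_inner_hilbert H.

Definition sub_rep (y : W) : lop H := val (y : subsp B).

Lemma sub_rep_linear : linear sub_rep.
Proof. by move=> a x y; rewrite /sub_rep valD_subsp valZ_subsp. Qed.

Lemma sub_rep_inj : injective sub_rep.
Proof. exact: val_inj. Qed.

Lemma sub_rep_star (y : W) : sub_rep (star y) = star (sub_rep y).
Proof.
apply: insubd_subsp; first exact: saB.1.
by apply: saB.2; exact: subsp_mem saB.1.
Qed.

Lemma sub_rep_adjoint (x : W) (u v : H) :
  inner H ((sub_rep x : bounded_op H) u) v =
  inner H u ((sub_rep (star x) : bounded_op H) v).
Proof.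
have [_ _ stK] := star_inv.
exact: (rep_adjoint sub_rep_linear sub_rep_inj stK sub_rep_star).
Qed.

Let lin := sub_rep_linear.

Lemma mnorm_sub_rep (x : Minf W) : mnorm x = mnorm (amp sub_rep x).
Proof. by []. Qed.

Lemma mcone_sub_rep (x : Minf W) : mcone x = mcone (amp sub_rep x).
Proof. by []. Qed.

Lemma sub_mnormD (x y : Minf W) : mnorm (x + y) <= mnorm x + mnorm y.
Proof.
have [n [nx ny]] := mbnd_common x y.
have nxy : mbnd n (x + y) by move=> i j ij; rewrite mxD nx// ny// addr0.
rewrite !mnorm_sub_rep; apply: (mnorm_op_le lin nxy).
  by rewrite addr_ge0//; exact: mnorm_op_ge0.
move=> h h'; rewrite op_form_D//; apply: le_trans (le_normcD _ _) _.
by rewrite mulrDl lerD//; exact: op_form_le.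
Qed.

Lemma sub_mnormZ_le c (x : Minf W) : mnorm (c *: x) <= normc c * mnorm x.
Proof.
have nx := mdimP x; set n := mdim x in nx.
have ncx : mbnd n (c *: x) by move=> i j ij; rewrite mxZ nx// scaler0.
rewrite !mnorm_sub_rep; apply: (mnorm_op_le lin ncx).
  by rewrite mulr_ge0 ?normc_ge0//; exact: mnorm_op_ge0.
move=> h h'; rewrite op_form_scale// ComplexField.Normc.normcM -mulrA.
by rewrite ler_wpM2l ?normc_ge0//; exact: op_form_le.
Qed.

Lemma sub_mnormZ c (x : Minf W) : mnorm (c *: x) = normc c * mnorm x.
Proof.
apply/eqP; rewrite eq_le sub_mnormZ_le andTb.
have [->|c0] := eqVneq c 0.
  by rewrite ComplexField.Normc.normc0 mul0r mnorm_sub_rep; exact: mnorm_op_ge0.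
have nc0 : 0 < normc c.
  by rewrite lt_def normc_ge0 andbT; apply: contra_neq c0 => /ComplexField.Normc.eq0_normc.
have := sub_mnormZ_le c^-1 (c *: x); rewrite scalerA mulVf// scale1r.
rewrite -(ler_pM2l nc0) mulrA -ComplexField.Normc.normcM mulfV//.
by rewrite ComplexField.Normc.normc1 mul1r.
Qed.

Lemma sub_mnorm0_eq0 (x : Minf W) : mnorm x <= 0 -> x = 0.
Proof.
move=> x0; apply: (op_form_eq sub_rep_inj) => n h h' nx _; rewrite op_form0//.
apply: ComplexField.Normc.eq0_normc; apply/eqP; rewrite eq_le normc_ge0 andbT.
apply: le_trans (op_form_le lin _ _ nx) _.
by rewrite -mnorm_sub_rep mulr_le0_ge0// mulr_ge0// sqrtr_ge0.
Qed.

Lemma sub_operator_space : is_operator_space W.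
Proof.
split; [exact: sub_mnormD|exact: sub_mnormZ| |].
  by move=> x x0; apply: sub_mnorm0_eq0; rewrite x0.
by move=> n a b x; exact: (mnorm_amp_sandwich lin a b x).
Qed.

Lemma sub_star0 : star (0 : W) = 0.
Proof. by have [_ sZ _] := star_inv; rewrite -(scale0r (0 : W)) sZ conjC0 !scale0r. Qed.

Lemma sub_mstarE (x : Minf W) i j : mstar x i j = star (x j i).
Proof.
apply: (@mxinfE _ _ (mdim x)) => k l kl; rewrite mdimP ?sub_star0//.
by rewrite andbC.
Qed.

Lemma sub_mbnd_mstar n (x : Minf W) : mbnd n x -> mbnd n (mstar x).
Proof. by move=> nx i j ij; rewrite sub_mstarE nx ?sub_star0// andbC. Qed.

Lemma sub_op_form_mstar n (x : Minf W) h h' :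
  op_form sub_rep n (mstar x) h h' = (op_form sub_rep n x h' h)^*.
Proof.
rewrite /op_form exchange_big rmorph_sum; apply: eq_bigr => i _ /=.
rewrite rmorph_sum; apply: eq_bigr => j _ /=.
by rewrite sub_mstarE (ipC ipP) sub_rep_adjoint.
Qed.

Lemma sub_mnorm_mstar (x : Minf W) : mnorm (mstar x) = mnorm x.
Proof.
have le (y : Minf W) : mnorm (mstar y) <= mnorm y.
  rewrite !mnorm_sub_rep; apply: (mnorm_op_le lin (sub_mbnd_mstar (mdimP y))).
    exact: mnorm_op_ge0.
  move=> h h'; rewrite sub_op_form_mstar normc_conj [X in _ * X]mulrC.
  exact: (op_form_le lin _ _ (mdimP y)).
have [_ _ stK] := star_inv.
have xx : mstar (mstar x) = x by apply: Minf_eq => i j; rewrite !sub_mstarE stK.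
apply/eqP; rewrite eq_le; apply/andP; split; first exact: le.
by have := le (mstar x); rewrite xx.
Qed.

(** A positive form is hermitian by polarization, and the form determines the matrix. *)
Lemma sub_cone_msa (x : Minf W) : mcone x -> mstar x = x.
Proof.
move=> cx; apply: (op_form_eq sub_rep_inj) => n h h' _ nx.
by rewrite sub_op_form_mstar -(ipC (op_form_semi_inner lin nx cx)).
Qed.

Lemma sub_cone_closed : norm_closed (@mnorm R W) mcone.
Proof.
move=> x hx; have nx := mdimP x; set n := mdim x in nx.
apply: (mcone_op_form lin nx) => h.
(* The size [m] needed for the approximant [y] varies with [e]; cutting [h] at [n] keeps the factor
   in the error estimate fixed. *)
pose h1 p := if (p < n)%N then h p else 0.
apply: (@ge0_approx _ _ (vsqn n h)) => e e0; have [y cy xy] := hx e e0.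
pose m := maxn n (mdim y); have nm : (n <= m)%N by rewrite leq_maxl.
have my : mbnd m y by apply: mbnd_le (mdimP y); rewrite leq_maxr.
have mx : mbnd m x by exact: mbnd_le nx.
have mxy : mbnd m (x - y) by move=> i j ij; rewrite mxB mx// my// subr0.
exists (op_form sub_rep m y h1 h1); first exact: op_form_pos.
have -> : op_form sub_rep n x h h = op_form sub_rep m x h1 h1.
  rewrite (op_form_widen lin _ _ nx nm); apply: eq_bigr => i _; apply: eq_bigr => j _.
  by rewrite /h1 !ltn_ord.
have -> : op_form sub_rep m x h1 h1 - op_form sub_rep m y h1 h1 =
    op_form sub_rep m (x - y) h1 h1.
  have -> : x - y = x + (-1) *: y by rewrite scaleN1r.
  by rewrite (op_form_D lin) (op_form_scale lin) mulN1r.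
apply: le_trans (op_form_le lin _ _ mxy) _; rewrite -mnorm_sub_rep -expr2.
have -> : vsqn m h1 = vsqn n h.
  rewrite /vsqn (@sum_ord_widen _ n m (fun i => sqn (inner H) (h1 i)) nm).
    by apply: eq_bigr => i _; rewrite /h1 ltn_ord.
  by move=> p np; rewrite /h1 ltnNge np /sqn (ip0l ipP).
have v0 : 0 <= vsqn n h by apply: sumr_ge0 => i _; exact: sqn_ge0.
by rewrite sqr_sqrtr// ler_wpM2r// ltW.
Qed.

Lemma sub_cone_sandwich p (a : 'I_p -> Minf C^o) (x : 'I_p -> Minf W) :
  (forall k, mcone (x k)) -> mcone (\sum_k sandwich (a k) (x k) (a k)).
Proof.
move=> cx; apply: (mcone_op_form lin (mdimP _)) => h; rewrite op_form_sum//.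
apply: sumr_ge0 => k _; rewrite (op_form_sandwich lin _ _ _ _ _ (mdimP (x k))).
exact: (op_form_pos lin _ (mdimP (x k)) (cx k)).
Qed.

Lemma sub_is_mos : is_mos W.
Proof.
split; last first.
  move=> x cx cNx; apply: sub_mnorm0_eq0; exact: (op_cone_antisym lin cx cNx).
split; [exact: sub_operator_space|exact: star_inv|exact: sub_mnorm_mstar| |].
  by split; [exact: sub_cone_msa|exact: sub_cone_closed].
by move=> n a x; exact: sub_cone_sandwich.
Qed.

Lemma sub_operator_system : operator_system W.
Proof.
have idE (x : Minf W) : amp id x = x by apply: Minf_eq => i j; exact: ampE.
split; first exact: sub_is_mos.
exists H, B, id; split; [exact: saB| |].
  split; first by exists id.
    split; [|by []|by move=> x _; rewrite idE].
    by split; first by move=> a x y.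
  split; first by move=> a x y.
    by exists 1 => x; rewrite idE mul1r.
  by exists 1 => // x x1; rewrite idE x1.
by split; [move=> a x y|move=> x; rewrite idE].
Qed.

End SubMos.

(** * Biduals of operator systems and of quasi-operator systems *)

Section Bidual.
Variable R : realType.
Local Notation C := R[i].
Implicit Types X Y T D : mos_data R.

Lemma amp_comp (U V W : lmodType C) (f : U -> V) (g : V -> W) (x : Minf U) :
  linear f -> linear g -> amp (g \o f) x = amp g (amp f x).
Proof.
move=> lf lg; have f0 := lin_0 lf; have g0 := lin_0 lg.
by apply: Minf_eq => i j; rewrite !ampE//= f0 g0.
Qed.

Definition bounded_rep X (H : hilbert R) (rho : X -> lop H) (c K : R) : Prop :=
  [/\ linear rho,
      forall (x : X) (u v : H), inner H ((rho x : bounded_op H) u) v =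
        inner H u ((rho (star x) : bounded_op H) v),
      forall k : Minf X, mcone k -> mcone (amp rho k),
      forall k : Minf X, mnorm k <= c * mnorm (amp rho k) &
      forall k : Minf X, mnorm (amp rho k) <= K * mnorm k].

Lemma operator_system_rep X : operator_system X ->
  exists (H : hilbert R) (rho : X -> lop H), bounded_rep rho 1 1.
Proof.
move=> [[smosX _] [H [B [phi [saB [_ [[philin phistar] phiinj phicone] _] [_ phinorm]]]]]].
have [_ [_ _ stK] _ [cone_sa _] _] := smosX.
pose rho (x : X) : lop H := sub_rep (phi x).
have ampE' k : amp rho k = amp (@sub_rep R H B) (amp phi k).
  by apply: amp_comp => //; exact: sub_rep_linear.
have rho_lin : linear rho by move=> a x y; rewrite /rho philin sub_rep_linear.
exists H, rho; split.
- exact: rho_lin.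
- apply: rep_adjoint => //.
    by move=> x y /sub_rep_inj/phiinj.
  by move=> x; rewrite /rho phistar; exact: sub_rep_star.
- by move=> k ck; rewrite ampE' -mcone_sub_rep; apply/phicone => //; exact: cone_sa.
- by move=> k; rewrite ampE' -mnorm_sub_rep phinorm mul1r.
- by move=> k; rewrite ampE' -mnorm_sub_rep phinorm mul1r.
Qed.

Lemma quasi_operator_system_rep X : quasi_operator_system X ->
  exists (H : hilbert R) (rho : X -> lop H) (c K : R),
    [/\ 0 < c, 0 < K & bounded_rep rho c K].
Proof.
move=> [[smosX _] [Y [phi [osY [_ [[philin phistar] phiinj phicone] [_ [K hK] [c c0 hc]]]]]]].
have [[smosY _] _] := osY; have [_ _ _ [cone_sa _] _] := smosX.
have [H [rho [rho_lin rho_star rho_cone rho_lb rho_ub]]] := operator_system_rep osY.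
have phi0 := lin_0 philin.
have ampE' k : amp (rho \o phi) k = amp rho (amp phi k) by exact: amp_comp.
have rn k : mnorm (amp (rho \o phi) k) = mnorm (amp phi k).
  rewrite ampE'; apply/eqP; rewrite eq_le; apply/andP; split.
    by have := rho_ub (amp phi k); rewrite mul1r.
  by have := rho_lb (amp phi k); rewrite mul1r.
have lb k : c * mnorm k <= mnorm (amp phi k).
  have [k0|k0] := eqVneq (mnorm k) 0; first by rewrite k0 mulr0 mnorm_ge0.
  have kp : 0 < mnorm k by rewrite lt_def k0 mnorm_ge0.
  have k1 : mnorm (((mnorm k)^-1)%:C%C *: k) = 1.
    by rewrite (mnormZ smosX) normc_real ger0_norm ?invr_ge0 ?(ltW kp)// mulVf.
  have := hc _ k1.
  have -> : amp phi (((mnorm k)^-1)%:C%C *: k) = ((mnorm k)^-1)%:C%C *: amp phi k.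
    by apply: Minf_eq => i j; rewrite mxZ !ampE// mxZ (lin_Z philin).
  rewrite (mnormZ smosY) normc_real ger0_norm ?invr_ge0 ?(ltW kp)//.
  by rewrite ler_pdivlMl// mulrC.
(* The lower bound is inverted because [bounded_rep] bounds a matrix by its image; the maximum makes
   the upper constant positive, which [K] need not be when X = 0. *)
exists H, (rho \o phi), c^-1, (Num.max K 1).
have m1 : 0 < Num.max K 1 by rewrite lt_max ltr01 orbT.
split; [by rewrite invr_gt0|by []|split].
- by move=> a x y; rewrite /= philin rho_lin.
- by move=> x u v; rewrite /= rho_star phistar.
- by move=> k ck; rewrite ampE'; apply: rho_cone; apply/phicone => //; exact: cone_sa.
- by move=> k; rewrite rn ler_pdivlMl.
- move=> k; rewrite rn; apply: le_trans (hK k) _.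
  by rewrite ler_wpM2r ?mnorm_ge0// le_max lexx.
Qed.

Lemma quasi_operator_system_bidual X : quasi_operator_system X ->
  dual_quasi_operator_system (dual (dual X)) (canonical_predual (dual X)).
Proof.
move=> qX; have [[smosX _] _] := qX.
have [H [rho [c [K [c0 K0 [r1 r2 r3 r4 r5]]]]]] := quasi_operator_system_rep qX.
apply: (@bidual_dual_quasi _ _ smosX (c * K)); first exact: mulr_gt0.
  exact: (mnorm_le_umap smosX r1 r2 r3 c0 K0 r4 r5).
exact: (functional_vector_form smosX r1 r2 r3 c0 K0 r4 r5).
Qed.

(** Both constants of the representation are 1, so [kappa <= 1] and the universal representation is
    completely isometric. *)
Lemma operator_system_bidual X : operator_system X ->
  dual_operator_system (dual (dual X)) (canonical_predual (dual X)).
Proof.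
move=> oX; have [[smosX _] _] := oX.
have [H [rho [r1 r2 r3 r4 r5]]] := operator_system_rep oX.
have k0 : 0 < 1 * 1 :> R by rewrite mulr1.
have k1 : 1 * 1 <= 1 :> R by rewrite mulr1.
apply: (@bidual_dual_operator_system _ _ smosX (1 * 1) k0 _ _ k1).
  exact: (mnorm_le_umap smosX r1 r2 r3 ltr01 ltr01 r4 r5).
exact: (functional_vector_form smosX r1 r2 r3 ltr01 ltr01 r4 r5).
Qed.

(** The involution laws of [sub_mos B] are transported from T^* along the bijection [phi]; they are
    what [sub_operator_system] requires in order to make it an operator system. *)
Lemma dualizable_dual_quasi T : dualizable T -> quasi_operator_system (dual T).
Proof.
move=> [[[smosT _] _] [[mosD _] [H [B [phi [saB _ iphi _]]]]]].
split=> //; exists (sub_mos B), phi; split=> //.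
apply: sub_operator_system => //.
have [[psi phiK psiK] [[philin phistar] _ _] _] := iphi.
have [[_ [sD sZ sK] _ _ _] _] := mosD.
split=> [x y|a x|x].
- rewrite -[x]psiK -[y]psiK -(lin_D philin) -!phistar sD.
  by rewrite (lin_D philin).
- rewrite -[x]psiK -(lin_Z philin) -!phistar sZ.
  by rewrite (lin_Z philin).
- by rewrite -[x]psiK -!phistar sK.
Qed.

End Bidual.

Theorem proposition3p12 (R : realType) :
  (forall X : mos_data R,
     (quasi_operator_system X ->
        dual_quasi_operator_system (dual (dual X))
          (canonical_predual (dual X))) /\
     (operator_system X ->
        dual_operator_system (dual (dual X))
          (canonical_predual (dual X)))) /\
  (forall T : mos_data R,
     dualizable T ->
       dual_quasi_operator_system (dual T) (canonical_predual T) /\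
       dualizable (dual T)).
Proof.
split=> [X|T dT].
  split; [exact: quasi_operator_system_bidual|exact: operator_system_bidual].
have qT := dualizable_dual_quasi dT.
split; first exact: dT.2.
(* Dualizability of T^* concerns its own dual T^** with predual T^*, which is the bidual statement
   for T. *)
by split; [exact: qT|exact: quasi_operator_system_bidual dT.1].
Qed.
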